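(* Let $\mathfrak{D}$ be a finite dimensional Hilbert space, suppose that $\mathcal{R}_k$ is a Banach algebra (with respect to multiplication of power series), and let $T$ be an operator similar to a part of $B_k\otimes I_{\mathfrak{D}}$, acting on the space $\mathcal{H}_k\otimes\mathfrak{D}$. Suppose that $$\lim_{n\to\infty}\Big(\inf_{j\ge0}\frac{k_j}{k_{n+j}}\Big)^{1/n}=\lim_{n\to\infty}k_n^{1/n}=1,$$ and also that $$\sum_{n=N}^\infty k_n\le CN^{-\varepsilon}\qquad\text{for all } N\ge1,$$ for some positive constants $C$ and $\varepsilon$ which do not depend on $N$. Suppose that the spectrum $\sigma(T)$ does not cover $\mathbb{D}$. Put $$E:=\big(\overline{\sigma(T)\cap\mathbb{D}}\big)\cap\mathbb{T}$$ and let $\{l_\nu\}$ denote the lengths of the finite complementary intervals of $E$ in $\mathbb{T}$. Then the Lebesgue measure of $E$ is $0$, and the Carleson condition holds: $$\sum_\nu l_\nu\log\frac{2\pi}{l_\nu}<\infty.$$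
   Context: $\mathbb{D}$ is the open unit disc, $\mathbb{T}$ the unit circle. Standing assumptions: $\alpha(t)=\sum_{n\ge0}\alpha_nt^n$ has real Taylor coefficients, belongs to the Wiener algebra $A_W$ (analytic functions on $\mathbb{D}$ with absolutely summable Taylor coefficients), does not vanish on $\mathbb{D}$, $\alpha_0=1$, and $k(t)=1/\alpha(t)=\sum_{n\ge0}k_nt^n$ satisfies $k_0=1$, $k_n>0$ for all $n\ge1$. $\mathcal{H}_k$ is the Hilbert space of power series $f=\sum f_nt^n$ with norm $\big(\sum_n|f_n|^2k_n\big)^{1/2}$, and $B_kf(t)=(f(t)-f(0))/t$. For a Hilbert space $\mathfrak{D}$, $\mathcal{H}_k\otimes\mathfrak{D}$ is the corresponding space of $\mathfrak{D}$-valued power series, on which $B_k\otimes I_{\mathfrak{D}}$ acts by the same formula. $\mathcal{R}_k$ is the Hilbert space of power series $g=\sum g_nt^n$ with norm $\big(\sum_n|g_n|^2/k_n\big)^{1/2}$. A part of an operator is its restriction to a closed invariant subspace. The complementary intervals of $E$ are the connected components (arcs) of $\mathbb{T}\setminus E$. *)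

(* Defs.v *)
From HB Require Import structures.
From mathcomp Require Import all_boot all_order all_algebra.
From mathcomp Require Import complex.
From mathcomp Require Import all_classical all_reals all_analysis.
Set Implicit Arguments.
Unset Strict Implicit.
Unset Printing Implicit Defensive.
Import Order.TTheory GRing.Theory Num.Theory.
Import numFieldNormedType.Exports.
Local Open Scope classical_set_scope.
Local Open Scope complex_scope.
Local Open Scope ring_scope.

(* The norm of a normed space over R[i] takes its values in R[i] (on the
   nonnegative real axis); [rnorm] is the same norm, valued in R. *)
Definition rnorm (R : realType) (V : normedModType R[i]) (x : V) : R :=
  complex.Re `|x|.

(* A Hilbert space is a completeNormedModType over R[i] together with an inner
   product (linear on the left, antilinear on the right) inducing its norm. *)
Definition induces_norm (R : realType) (V : normedModType R[i])
    (dot : {dot V for @Num.conj R[i]}) : Prop :=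
  forall x : V, `|x| ^+ 2 = dot x x.

Definition finite_dimensional (R : realType) (V : lmodType R[i]) : Prop :=
  exists (n : nat) (b : 'I_n -> V),
    forall v : V, exists c : 'I_n -> R[i], v = \sum_(i < n) c i *: b i.

Section PowerSeries.
Variable R : realType.

(* A power series is identified with its sequence of coefficients. *)

Definition power_series (a : nat -> R) (t : R[i]) : nat -> R[i]^o :=
  series (fun n => ((a n)%:C * t ^+ n : R[i]^o)).

Definition power_series_value (a : nat -> R) (t : R[i]) : R[i]^o :=
  limn (power_series a t).

Definition wiener (a : nat -> R) : Prop := cvgn (series (fun n => `|a n|)).

Definition cauchy_product (f g : nat -> R[i]^o) : nat -> R[i]^o :=
  fun n => \sum_(i < n.+1) (f i : R[i]) * g (n - i)%N.

Section Weighted.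
Variables (V : normedModType R[i]) (w : nat -> R).

Definition wnorm2 (f : nat -> V) : \bar R :=
  (\sum_(0 <= n <oo) (rnorm (f n) ^+ 2 * w n)%:E)%E.

Definition wspace : set (nat -> V) := [set f | (wnorm2 f < +oo)%E].

Definition wnorm (f : nat -> V) : R := Num.sqrt (fine (wnorm2 f)).

End Weighted.

(* L is a linear subspace of X, closed in X for the norm N. *)
Definition closed_subspace (V : lmodType R[i]) (X : set (nat -> V))
    (N : (nat -> V) -> R) (L : set (nat -> V)) : Prop :=
  [/\ L `<=` X,
      L 0,
      forall (a : R[i]) f g, L f -> L g -> L (a *: f + g) &
      forall (u : nat -> (nat -> V)) (f : nat -> V),
        (forall m, L (u m)) -> X f ->
        (fun m => N (u m - f)) @ \oo --> (0 : R) -> L f].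

(* H_k (x) V, of squared norm \sum_n |f_n|^2 k_n *)
Definition Hspace (V : normedModType R[i]) (k : nat -> R) : set (nat -> V) :=
  wspace k.

Definition Hnorm (V : normedModType R[i]) (k : nat -> R) (f : nat -> V) : R :=
  wnorm k f.

(* R_k, of squared norm \sum_n |g_n|^2 / k_n *)
Definition Rspace (k : nat -> R) : set (nat -> R[i]^o) :=
  wspace (fun n => (k n)^-1).

Definition Rnorm (k : nat -> R) (f : nat -> R[i]^o) : R :=
  wnorm (fun n => (k n)^-1) f.

(* As is usual for weighted l^2 algebras, multiplication is only required to
   be bounded, i.e. the norm is submultiplicative up to a constant. *)
Definition Rspace_banach_algebra (k : nat -> R) : Prop :=
  exists M : R, forall f g, Rspace k f -> Rspace k g ->
    Rspace k (cauchy_product f g) /\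
    Rnorm k (cauchy_product f g) <= M * Rnorm k f * Rnorm k g.

(* (f(t) - f(0)) / t *)
Definition backward_shift (V : lmodType R[i]) (f : nat -> V) : nat -> V :=
  fun n => f n.+1.

(* The bound on W from below says that W^-1 : L -> H exists and is bounded. *)
Definition similar_to_part_of_shift (V H : normedModType R[i]) (k : nat -> R)
    (T : H -> H) : Prop :=
  exists (L : set (nat -> V)) (W : {linear H -> (nat -> V)}),
    [/\ closed_subspace (@Hspace V k) (@Hnorm V k) L /\
          (forall f, L f -> L (backward_shift f)),
        range W = L,
        exists M : R, forall x, Hnorm k (W x) <= M * rnorm x,
        exists M : R, forall x, rnorm x <= M * Hnorm k (W x) &
        forall x, W (T x) = backward_shift (W x)].

End PowerSeries.

Section Spectrum.
Variable R : realType.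

Definition spectrum (H : normedModType R[i]) (T : {linear H -> H}) :
    set R[i]^o :=
  [set lam | ~ exists S : {linear H -> H},
      [/\ continuous S,
          forall x, S (T x - lam *: x) = x &
          forall x, T (S x) - lam *: S x = x]].

Definition disc : set R[i]^o := [set z | `|z| < 1].
Definition circle : set R[i]^o := [set z | `|z| = 1].

Definition boundary_spectrum (H : normedModType R[i]) (T : {linear H -> H}) :
    set R[i]^o :=
  closure (spectrum T `&` disc) `&` circle.

Definition cis (t : R) : R[i]^o := cos t +i* sin t.

(* Lebesgue (arc length) measure on the unit circle, of total mass 2 pi *)
Definition circle_measure (A : set R[i]^o) : \bar R :=
  lebesgue_measure (`[0, 2 * pi[ `&` cis @^-1` A).

(* If E is empty, the whole circle counts as one arc of length 2 pi; its
   contribution to the Carleson sum is 0. *)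
Definition complementary_arcs (E : set R[i]^o) : set (set R[i]^o) :=
  [set connected_component (circle `\` E) z | z in circle `\` E].

Definition arc_length (A : set R[i]^o) : R := fine (circle_measure A).

Definition carleson (E : set R[i]^o) : Prop :=
  (\esum_(A in complementary_arcs E)
     (arc_length A * ln (2 * pi / arc_length A))%:E < +oo)%E.

End Spectrum.

(* Main.v *)
(** Transposing T to the annihilator of its invariant subspace, a submodule of
    (R_k)^d with d the dimension of D, one finds d annihilating vectors whose
    determinant phi in R_k is nonzero at a point of the disc outside the
    spectrum; by Cramer's rule phi annihilates the whole subspace, that is
    phi(T) = 0.  Hence the partial sums satisfy phi_N(T) -> 0 in norm, so that
    phi_N -> 0 uniformly on the spectrum, and then on E.  The decay of the tails
    of k makes the partial sums of phi uniformly Hölder on the circle: on a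
    complementary arc of length l they are O(l^a), up to an error tending to 0.
    Jensen's inequality, which bounds the integral of log |phi_N| from below,
    then forces |E| = 0 and sum l log(1/l) < oo.  Working with partial sums
    throughout, Jensen's inequality is only needed for polynomials, where it
    follows by averaging over roots of unity. *)

(* The d annihilating vectors come from a chosen point lam of the disc outside the spectrum. For an
   orthonormal basis o_i of D, the geometric sequences lam^n o_i are eigenvectors of the backward
   shift. Their components w_i orthogonal to the range of W, weighted by k_n, become the rows of a
   matrix over R_k. Its value at lam is the Gram matrix of the w_i; were it singular, a combination
   of the geometric sequences would lie in the range, and T would have an eigenvector at lam.

   The operator phi(T) is never formed. That phi annihilates the range says that phi_N(T) is minus
   the tail of the operator series, and by duality this tail is controlled by the R_k norm of the
   tail of phi. The passage to the spectrum uses only p(T) - p(lam) = (T - lam) q(T) and a Neumann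
   series.

   Jensen's lower bound must not degenerate as N grows. If phi_m is the first nonzero coefficient,
   the partial sums divided by z^m all take the value phi_m at 0 once N > m, so that one constant
   serves for all of them. *)
Require Import Defs.
From HB Require Import structures.
From mathcomp Require Import all_boot all_order all_algebra.
From mathcomp Require Import complex.
From mathcomp Require Import all_classical all_reals all_analysis.
From mathcomp Require Import measurable_realfun.
From mathcomp Require Import ring lra zify.
Set Implicit Arguments.
Unset Strict Implicit.
Unset Printing Implicit Defensive.
Import Order.TTheory GRing.Theory Num.Theory.
Import numFieldNormedType.Exports.
Local Open Scope classical_set_scope.
Local Open Scope complex_scope.
Local Open Scope ring_scope.

(** * Jensen's inequality *)

Import Normc.

Section Modulus.
Variable R : rcfType.
Implicit Types z w : R[i].

Lemma normc_ge0 z : 0 <= normc z.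
Proof. by case: z => a b /=; exact: sqrtr_ge0. Qed.

Lemma normcX z n : normc (z ^+ n) = normc z ^+ n.
Proof.
by elim: n => [|n IH]; rewrite ?expr0 ?normc1// !exprS normcM IH.
Qed.

Lemma normcB z w : normc (z - w) <= normc z + normc w.
Proof. by rewrite -(normcN w); exact: le_normcD. Qed.

Lemma normc_distC z w : normc (z - w) = normc (w - z).
Proof. by rewrite -normcN opprB. Qed.

Lemma ler_dist_normc z w : `|normc z - normc w| <= normc (z - w).
Proof.
rewrite ler_norml; apply/andP; split; last first.
  by rewrite lerBlDr; have := le_normcD (z - w) w; rewrite subrK.
by rewrite lerNl opprB lerBlDr normc_distC; have := le_normcD (w - z) z; rewrite subrK.
Qed.

Lemma normc_sum I (r : seq I) (P : pred I) (F : I -> R[i]) :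
  normc (\sum_(i <- r | P i) F i) <= \sum_(i <- r | P i) normc (F i).
Proof.
elim/big_rec2: _ => [|i y z _ yz]; first by rewrite normc0.
by rewrite (le_trans (le_normcD _ _)) ?lerD2l.
Qed.

Lemma normc_prod I (r : seq I) (P : pred I) (F : I -> R[i]) :
  normc (\prod_(i <- r | P i) F i) = \prod_(i <- r | P i) normc (F i).
Proof.
elim/big_rec2: _ => [|i y z _ yz]; first exact: normc1.
by rewrite normcM yz.
Qed.

Lemma normc_real (x : R) : 0 <= x -> normc x%:C = x.
Proof. by move=> x0; rewrite /= expr0n addr0 sqrtr_sqr ger0_norm. Qed.

Lemma normc_eq0 z : (normc z == 0) = (z == 0).
Proof. by apply/eqP/eqP => [/eq0_normc|->]; rewrite ?normc0. Qed.

End Modulus.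

Section UnitCircle.
Variable R : realType.
Implicit Types x y t : R.

Lemma cisD x y : cis (x + y) = cis x * cis y.
Proof. by rewrite /cis cosD sinD [sin x * _ + _]addrC. Qed.

Lemma cis0 : cis (0 : R) = 1.
Proof. by rewrite /cis cos0 sin0. Qed.

Lemma cis_2pi : cis (2 * pi : R) = 1.
Proof. by rewrite /cis mulr_natl -[X in cos X]add0r cosD2pi -[X in sin X]add0r sinD2pi cos0 sin0. Qed.

Lemma cisMn x n : cis (x *+ n) = cis x ^+ n.
Proof. by elim: n => [|n IH]; rewrite ?cis0// mulrS cisD IH exprS. Qed.

Lemma normc_cis x : normc (cis x) = 1.
Proof. by rewrite /= cos2Dsin2 sqrtr1. Qed.

Lemma cis_eq1 x : 0 < x < 2 * pi -> cis x != 1.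
Proof.
move=> /andP[x0 x2]; apply/negP => /eqP[cx _].
have : 0 < sin (x / 2) by apply: sin_gt0_pi; lra.
suff -> : sin (x / 2) = 0 by rewrite ltxx.
have E : x / 2 *+ 2 = x by lra.
have := cos_mulr2n (x / 2); rewrite E cx => H.
have := cos2Dsin2 (x / 2) => H'.
by apply/eqP; rewrite -sqrf_eq0; apply/eqP; lra.
Qed.

Lemma prim_root_cis M : (0 < M)%N -> M.-primitive_root (cis (2 * pi / M%:R : R)).
Proof.
move=> M0; have M0' : M%:R != 0 :> R by rewrite pnatr_eq0 -lt0n.
rewrite /primitive_root_of_unity M0; apply/forallP => -[i iM] /=.
rewrite unity_rootE -cisMn -[_ *+ i.+1]mulr_natr.
have [->|iM'] := eqVneq i.+1 M; first by rewrite divfK// cis_2pi eqxx.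
apply/eqP/negbTE/cis_eq1; rewrite -mulrA [M%:R^-1 * _]mulrC.
have Mp : 0 < M%:R :> R by rewrite ltr0n.
have pi0 := pi_gt0 R.
rewrite mulr_gt0 ?divr_gt0 ?mulr_gt0 ?ltr0n//= gtr_pMr ?mulr_gt0//.
by rewrite ltr_pdivrMr// mul1r ltr_nat ltn_neqAle iM' iM.
Qed.

(** Rotating by [cis (- t)] moves the sampling points to the [M]-th roots of unity without changing
    any modulus, so the product equals [normc (b ^+ M - 1)] for the rotated point [b]. *)
Lemma prod_cis_sub (M : nat) t (a : R[i]) : (0 < M)%N ->
  `|normc a ^+ M - 1| <=
  \prod_(0 <= j < M) normc (cis (t + 2 * pi / M%:R *+ j) - a).
Proof.
move=> M0; have z := prim_root_cis M0.
set b := a * cis (- t).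
have E j : cis (t + 2 * pi / M%:R *+ j) - a =
    - (cis t * (b - cis (2 * pi / M%:R) ^+ j)).
  by rewrite mulrBr opprB /b mulrCA -cisD subrr cis0 mulr1 cisD cisMn.
under eq_bigr => j _ do rewrite E normcN normcM normc_cis mul1r.
rewrite -normc_prod.
have -> : \prod_(0 <= j < M) (b - cis (2 * pi / M%:R) ^+ j) = b ^+ M - 1.
  transitivity (\prod_(0 <= j < M) ('X - (cis (2 * pi / M%:R : R) ^+ j)%:P)).[b].
    by rewrite horner_prod; apply: eq_bigr => j _; rewrite hornerXsubC.
  by rewrite (factor_Xn_sub_1 z) hornerD hornerXn hornerN hornerC.
rewrite (le_trans _ (ler_dist_normc _ _))// normc1.
by rewrite normcX normcM normc_cis mulr1.
Qed.

(** It is essential that [c] does not depend on [M]: after taking logarithms and dividing by [M], it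
    disappears in the limit. For [r < 1] use [r ^+ M <= r]; for [r > 1] compare [1] with
    [r ^+ (M - 1)]. *)
Lemma dist_expr1_ge (r : R) : 0 <= r -> r != 1 -> exists2 c : R, 0 < c &
  forall M, (0 < M)%N -> c * r ^+ M <= `|r ^+ M - 1|.
Proof.
move=> r0; rewrite neq_lt => /orP[r1|r1].
  exists (1 - r) => [|[//|M] _]; first by rewrite subr_gt0.
  have rM : r ^+ M.+1 <= r.
    by rewrite exprS ler_piMr// exprn_ile1// ltW.
  rewrite ler0_norm ?opprB; last by rewrite subr_le0 (le_trans rM)// ltW.
  have : 0 <= r ^+ M.+1 by rewrite exprn_ge0.
  nra.
exists (1 - r^-1) => [|[//|M] _]; first by rewrite subr_gt0 invf_lt1// (lt_trans ltr01).
have r0' : r != 0 by rewrite gt_eqF// (lt_trans ltr01).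
rewrite ger0_norm; last by rewrite subr_ge0 exprn_ege1// ltW.
rewrite mulrBl mul1r exprS mulKf// lerD2l lerN2.
by rewrite exprn_ege1// ltW.
Qed.

(* Jensen's inequality, discretised over the M-th roots of unity: the product
   over the roots of unity of a linear factor is [a ^+ M - c ^+ M], and
   [|a| != 1] bounds it below by a fixed multiple of [|a| ^+ M]. *)
Lemma discrete_jensen (q : {poly R[i]}) :
  (forall z, root q z -> normc z != 1) ->
  exists2 c : R, 0 < c & forall M t, (0 < M)%N ->
    c * normc q.[0] ^+ M <=
    \prod_(0 <= j < M) normc q.[cis (t + 2 * pi / M%:R *+ j)].
Proof.
have [r ->] := closed_field_poly_normal q.
set l := lead_coef q => H.
have [->|l0] := eqVneq l 0.
  exists 1 => // M t M0; rewrite scale0r.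
  under eq_bigr => j _ do rewrite horner0 normc0.
  by rewrite horner0 normc0 big_const_nat iter_mulr_1 subn0 mul1r.
have {H}Hr z : z \in r -> normc z != 1.
  by move=> zr; apply: H; rewrite rootZ// root_prod_XsubC.
have [c c0 Hc] : exists2 c : R, 0 < c & forall M t, (0 < M)%N ->
    c * normc (\prod_(z <- r) ('X - z%:P)).[0] ^+ M <=
    \prod_(0 <= j < M)
       normc (\prod_(z <- r) ('X - z%:P)).[cis (t + 2 * pi / M%:R *+ j)].
  elim: r Hr => [|a r IH] Hr.
    exists 1 => // M t M0; rewrite big_nil.
    have E w : normc (1 : {poly R[i]}).[w] = 1 by rewrite hornerC normc1.
    by under eq_bigr => j _ do rewrite E; rewrite E big1_eq expr1n mul1r.
  have [|c c0 Hc] := IH; first by move=> z zr; apply: Hr; rewrite in_cons zr orbT.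
  have [||d d0 Hd] := @dist_expr1_ge (normc a); first exact: normc_ge0.
    by apply: Hr; rewrite in_cons eqxx.
  exists (d * c) => [|M t M0]; first exact: mulr_gt0.
  rewrite big_cons.
  under [leRHS]eq_bigr => j _ do rewrite hornerM normcM !hornerE.
  rewrite big_split /= hornerM !hornerE normcM normcN exprMn mulrACA.
  apply: ler_pM; rewrite ?mulr_ge0 ?exprn_ge0 ?normc_ge0 ?(ltW d0) ?(ltW c0)//.
    by rewrite (le_trans (Hd _ M0))// prod_cis_sub.
  exact: Hc.
exists c => // M t M0.
under [leRHS]eq_bigr => j _ do rewrite hornerZ normcM.
rewrite big_split /= hornerZ normcM exprMn mulrCA.
apply: ler_pM; rewrite ?mulr_ge0 ?exprn_ge0 ?normc_ge0 ?(ltW c0)//; last exact: Hc.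
by rewrite prodr_const_nat subn0.
Qed.

End UnitCircle.

Section RootsOfUnityAverage.
Variable R : realType.
Local Notation mu := (@lebesgue_measure R).

Lemma integral_shift (v : R -> R) (a b s : R) : continuous v -> a <= b ->
  (\int[mu]_(x in `[(a + s)%R, (b + s)%R]) (v x)%:E =
   \int[mu]_(x in `[a, b]) (v (x + s))%:E)%E.
Proof.
move=> cv ab.
have D x : derivable (fun x : R => x + s) x 1 by [].
have D1 : derive1 (fun x : R => x + s) = cst 1.
  by apply/funext => x; rewrite derive1E deriveD// derive_id derive_cst addr0.
rewrite (@integration_by_substitution_increasing _ (fun x => x + s) v a b)//.
- by apply: eq_integral => x _; rewrite D1 /= mulr1.
- by move=> x y _ _ xy; rewrite ltrD2r.
- by rewrite D1 => x _; exact: cvg_cst.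
- by rewrite D1; exact: is_cvg_cst.
- by rewrite D1; exact: is_cvg_cst.
- have C : continuous (fun x : R => x + s).
    by move=> x; apply: cvgD; [exact: cvg_id|exact: cvg_cst].
  split=> //; first by apply: cvg_at_right_filter; exact: C.
  by apply: cvg_at_left_filter; exact: C.
- by apply: continuous_subspaceT.
Qed.

(** Each of the [M] pieces of the interval is translated back onto the first one. The integrand
    becomes a sum over an equally spaced grid, the form in which the discrete inequality is
    available. *)
Lemma integral_split (v : R -> R) (g : R) (M : nat) : continuous v ->
  (forall x, 0 <= v x) -> 0 <= g ->
  (\int[mu]_(x in `[0%R, (g *+ M)%R]) (v x)%:E =
   \int[mu]_(x in `[0%R, g]) (\sum_(0 <= j < M) v (x + g *+ j)%R)%:E)%E.
Proof.
move=> cv v0 g0.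
have mv (A : set R) : measurable_fun A (EFin \o v).
  apply/measurable_EFinP; apply: measurable_funTS.
  exact: continuous_measurable_fun.
elim: M => [|M IH].
  rewrite mulr0n set_itv1 integral_set1.
  by under eq_integral => x _ do rewrite big_nil; rewrite integral0.
have le0M : 0 <= g *+ M by rewrite mulrn_wge0.
have leMS : g *+ M <= g *+ M.+1 by rewrite mulrSr lerDl.
have -> : `[0, g *+ M.+1]%classic = `[0, g *+ M[%classic `|` `[g *+ M, g *+ M.+1]%classic.
  by rewrite -itv_bndbnd_setU// bnd_simp.
rewrite ge0_integral_setU//=; last 2 first.
- by move=> x _; rewrite lee_fin.
- by apply/disj_setPRL => x /=; rewrite !in_itv /= => /andP[H _]; rewrite ltNge H andbF.
rewrite integral_itv_bndo_bndc// IH.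
have -> : `[g *+ M, g *+ M.+1]%classic = `[0 + g *+ M, g + g *+ M]%classic.
  by rewrite add0r mulrS.
rewrite integral_shift//.
rewrite -ge0_integralD//=.
- by apply: eq_integral => x _; rewrite big_nat_recr//= EFinD.
- by move=> x _; rewrite lee_fin sumr_ge0.
- apply/measurable_EFinP; apply: measurable_sum => j; apply: measurable_funTS.
  apply: continuous_measurable_fun => x; apply: continuous_comp; last exact: cv.
  by apply: cvgD; [exact: cvg_id|exact: cvg_cst].
- by move=> x _; rewrite lee_fin.
- apply/measurable_EFinP; apply: measurable_funTS.
  apply: continuous_measurable_fun => x; apply: continuous_comp; last exact: cv.
  by apply: cvgD; [exact: cvg_id|exact: cvg_cst].
- exact: mv.
Qed.

(** The integral over a period is exactly the integral, over one mesh of the grid, of the sampling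
    sums. Hence no convergence of Riemann sums is involved: the error [c] contributes at most
    [2 * pi * |c| / M], and [M] is arbitrary. *)
Lemma integral_le_average (v : R -> R) (K c : R) : continuous v ->
  (forall x, 0 <= v x) ->
  (forall (M : nat) x, (0 < M)%N ->
     \sum_(0 <= j < M) v (x + 2 * pi / M%:R *+ j) <= M%:R * K + c) ->
  (\int[mu]_(x in `[0%R, (2 * pi)%R]) (v x)%:E <= (2 * pi * K)%:E)%E.
Proof.
move=> cv v0 H.
have pi0 : 0 < 2 * pi :> R by rewrite mulr_gt0 ?pi_gt0.
have B M : (0 < M)%N ->
    (\int[mu]_(x in `[0%R, (2 * pi)%R]) (v x)%:E <=
      (2 * pi * K + 2 * pi * `|c| / M%:R)%:E)%E.
  move=> M0; have M0' : M%:R != 0 :> R by rewrite pnatr_eq0 -lt0n.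
  have {1}-> : 2 * pi = 2 * pi / M%:R *+ M :> R by rewrite -[_ *+ M]mulr_natr divfK.
  have g0 : 0 <= 2 * pi / M%:R :> R by rewrite divr_ge0// ltW.
  rewrite integral_split//.
  have S0 x : 0 <= \sum_(0 <= j < M) v (x + 2 * pi / M%:R *+ j).
    by rewrite sumr_ge0.
  have K0 : 0 <= M%:R * K + `|c|.
    rewrite (le_trans (S0 0))// (le_trans (H M 0 M0))// lerD2l.
    by rewrite ler_norm.
  apply: (@le_trans _ _ (\int[mu]_(x in `[0%R, (2 * pi / M%:R)%R]) (cst (M%:R * K + `|c|)%R%:E x))%E).
    apply: ge0_le_integral => //=.
    - by move=> x _; rewrite lee_fin.
    - apply/measurable_EFinP; apply: measurable_sum => j; apply: measurable_funTS.
      apply: continuous_measurable_fun => x; apply: continuous_comp; last exact: cv.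
      by apply: cvgD; [exact: cvg_id|exact: cvg_cst].
    - move=> x _; rewrite lee_fin (le_trans (H M x M0))// lerD2l.
      by rewrite ler_norm.
  rewrite integral_cst//= lebesgue_measure_itv/= lte_fin.
  case: ifPn => _; last first.
    rewrite mule0 lee_fin.
    have := mulr_ge0 g0 K0; rewrite mulrDr mulrA divfK//.
    by rewrite [_ / _ * `|c|]mulrAC.
  rewrite oppr0 adde0 lee_fin mulrC mulrDr mulrA divfK//.
  by rewrite [_ / _ * `|c|]mulrAC.
apply/lee_addgt0Pr => e e0.
set q := 2 * pi * `|c| / e.
have [M Mq] : exists M : nat, q < M%:R.
  by exists (Num.bound `|q|); rewrite (le_lt_trans (ler_norm _))// archi_boundP.
have Mp : 0 < M.+1%:R :> R by rewrite ltr0n.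
apply: (le_trans (B M.+1 isT)).
rewrite -EFinD lee_fin lerD2l ler_pdivrMr// -ler_pdivrMl// [e^-1 * _]mulrC -/q.
by rewrite (le_trans (ltW Mq))// ler_nat.
Qed.

End RootsOfUnityAverage.

Section JensenIntegral.
Variable R : realType.
Local Notation mu := (@lebesgue_measure R).

Lemma lipschitz_continuous (f : R -> R) (L : R) :
  (forall x y, `|f x - f y| <= L * `|x - y|) -> continuous f.
Proof.
move=> H x; apply/cvgrPdist_lt => e e0; near=> y.
have L1 : 0 < `|L| + 1 by rewrite ltr_wpDl.
apply: (@le_lt_trans _ _ ((`|L| + 1) * `|x - y|)).
  rewrite (le_trans (H _ _))// ler_wpM2r// (le_trans (ler_norm L))// lerDl//.
rewrite mulrC -ltr_pdivlMr//.
near: y; apply: cvgr_dist_lt; last exact: divr_gt0.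
exact: cvg_id.
Unshelve. all: by end_near. Qed.

Lemma normc_le_ReIm (a b : R) : normc (a +i* b) <= `|a| + `|b|.
Proof.
rewrite /= -[leRHS]ger0_norm ?addr_ge0// -sqrtr_sqr ler_wsqrtr//.
by rewrite sqrrD !real_normK ?num_real// addrAC lerDl mulrn_wge0.
Qed.

Lemma mvt_lipschitz (f df : R -> R) : (forall x : R, is_derive x 1 f (df x)) ->
  (forall x, `|df x| <= 1) -> forall x y, `|f x - f y| <= `|x - y|.
Proof.
move=> fd df1.
have cf : continuous f.
  by move=> x; apply: differentiable_continuous; apply/derivable1_diffP; case: (fd x).
have H x y : x <= y -> `|f x - f y| <= `|x - y|.
  move=> xy; have [|c _] := @MVT_segment _ f df x y xy (fun z _ => fd z).
    by apply: continuous_subspaceT.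
  rewrite distrC => ->; rewrite [`|x - y|]distrC normrM ler_piMl//.
move=> x y; case: (leP x y) => [/H//|/ltW/H].
by rewrite distrC [`|y - x|]distrC.
Qed.

Lemma cis_lipschitz (x y : R) : normc (cis x - cis y) <= 2 * `|x - y|.
Proof.
rewrite (le_trans (normc_le_ReIm _ _))// mulr_natl mulr2n lerD//.
  by apply: (@mvt_lipschitz cos (fun x => - sin x)) => z; rewrite normrN sin_max.
by apply: (@mvt_lipschitz sin cos) => z; exact: cos_max.
Qed.

(** The induction along Horner's scheme must carry a bound [K] of the polynomial on the closed disc
    together with [L], because the increment of [q * 'X] involves the size of [q]. *)
Lemma horner_lipschitz (q : {poly R[i]}) : exists2 L : R, 0 <= L &
  forall w z, normc w <= 1 -> normc z <= 1 ->
    normc (q.[w] - q.[z]) <= L * normc (w - z).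
Proof.
have : exists L K : R, [/\ 0 <= L, 0 <= K, forall w, normc w <= 1 -> normc q.[w] <= K
    & forall w z, normc w <= 1 -> normc z <= 1 ->
      normc (q.[w] - q.[z]) <= L * normc (w - z)].
  elim/poly_ind: q => [|q c [L [K [L0 K0 HK HL]]]].
    exists 0, 0; split=> // [w _|w z _ _]; first by rewrite horner0 normc0.
    by rewrite !horner0 subrr normc0 mul0r.
  exists (L + K), (K + normc c); split.
  - by rewrite addr_ge0.
  - by rewrite addr_ge0// normc_ge0.
  - move=> w w1; rewrite hornerMXaddC (le_trans (le_normcD _ _))// lerD2r normcM.
    by rewrite (le_trans (ler_piMr (normc_ge0 _) w1))// HK.
  - move=> w z w1 z1; rewrite !hornerMXaddC.
    have -> : q.[w] * w + c - (q.[z] * z + c) = (q.[w] - q.[z]) * w + q.[z] * (w - z).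
      by ring.
    rewrite (le_trans (le_normcD _ _))// [leRHS]mulrDl !normcM lerD//.
      by rewrite (le_trans (ler_piMr (normc_ge0 _) w1))// HL.
    by rewrite ler_wpM2r ?normc_ge0// HK.
by move=> [L [K [L0 _ _ H]]]; exists L.
Qed.

Lemma ln_prod (I : Type) (r : seq I) (F : I -> R) : (forall i, 0 < F i) ->
  ln (\prod_(i <- r) F i) = \sum_(i <- r) ln (F i).
Proof.
move=> F0; elim: r => [|i r IH]; first by rewrite !big_nil ln1.
by rewrite !big_cons lnM ?posrE ?prodr_gt0// IH.
Qed.

Lemma continuous_ln_normc_horner_cis (q : {poly R[i]}) :
  (forall z, root q z -> normc z != 1) ->
  continuous (fun t => ln (normc q.[cis t])).
Proof.
move=> Hq x; apply: continuous_comp; last first.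
  apply: continuous_ln; rewrite lt_def normc_ge0 andbT normc_eq0.
  by apply/negP => /Hq; rewrite normc_cis eqxx.
have [L L0 HL] := horner_lipschitz q.
apply: (@lipschitz_continuous _ (L * 2)) => {}x y.
rewrite (le_trans (ler_dist_normc _ _))//.
rewrite (le_trans (HL _ _ _ _)) ?normc_cis// -mulrA ler_wpM2l//.
exact: cis_lipschitz.
Qed.

(** The discrete inequality after taking logarithms, the constant [c] there becoming the bounded
    error of [integral_le_average]. Subtracting from [B] makes the integrand nonnegative. *)
Lemma jensen_integral (q : {poly R[i]}) (B : R) :
  (forall z, root q z -> normc z != 1) -> q.[0] != 0 ->
  (forall t, ln (normc q.[cis t]) <= B) ->
  (\int[mu]_(t in `[0%R, (2 * pi)%R]) (B - ln (normc q.[cis t]))%:E <=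
   (2 * pi * (B - ln (normc q.[0])))%:E)%E.
Proof.
move=> Hq q0 HB; have [c c0 Hc] := discrete_jensen Hq.
have qp t : 0 < normc q.[cis t].
  rewrite lt_def normc_ge0 andbT normc_eq0.
  by apply/negP => /Hq; rewrite normc_cis eqxx.
have q0p : 0 < normc q.[0] by rewrite lt_def normc_ge0 andbT normc_eq0.
apply: (@integral_le_average _ _ _ (- ln c)).
- by move=> x; apply: cvgB; [exact: cvg_cst|exact: continuous_ln_normc_horner_cis].
- by move=> x; rewrite subr_ge0.
- move=> M x M0; have := Hc M x M0.
  rewrite -ler_ln ?posrE ?mulr_gt0 ?exprn_gt0//; last first.
    by apply: prodr_gt0 => i _.
  rewrite lnM ?posrE ?exprn_gt0// lnXn// ln_prod// => H.
  rewrite sumrB sumr_const_nat subn0.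
  rewrite -[ln (normc q.[0]) *+ M]mulr_natr in H.
  rewrite -[B *+ M]mulr_natl mulrBr [M%:R * ln _]mulrC.
  by lra.
Qed.

(** As the integrand of [jensen_integral] is nonnegative, one may discard everything outside
    disjoint sets and replace it on each of them by the lower bound [B - b i]. It serves both for
    the single set [E] and for finite families of arcs. *)
Lemma jensen_sum (q : {poly R[i]}) (B : R) (I : choiceType) (s : seq I)
    (F : I -> set R) (b : I -> R) :
  (forall z, root q z -> normc z != 1) -> q.[0] != 0 ->
  (forall t, ln (normc q.[cis t]) <= B) ->
  (forall i, measurable (F i)) -> uniq s -> trivIset [set` s] F ->
  (forall i, F i `<=` `[0%R, (2 * pi)%R]) ->
  (forall i, i \in s -> b i <= B) ->
  (forall i t, i \in s -> F i t -> ln (normc q.[cis t]) <= b i) ->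
  \sum_(i <- s) (B - b i) * fine (mu (F i)) <= 2 * pi * (B - ln (normc q.[0])).
Proof.
move=> Hq q0 HB mF us tF F2 bB Hb.
rewrite -lee_fin; apply: le_trans (jensen_integral Hq q0 HB).
have cv : continuous (fun t => B - ln (normc q.[cis t])).
  by move=> x; apply: cvgB; [exact: cvg_cst|exact: continuous_ln_normc_horner_cis].
have mv (A : set R) : measurable_fun A (EFin \o (fun t => B - ln (normc q.[cis t]))).
  apply/measurable_EFinP; apply: measurable_funTS.
  exact: continuous_measurable_fun.
have v0 t : (0 <= (B - ln (normc q.[cis t]))%:E)%E by rewrite lee_fin subr_ge0.
set D := \big[setU/set0]_(i <- s) F i.
have mD : measurable D by apply: bigsetU_measurable.
have DI : D `<=` `[0%R, (2 * pi)%R].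
  by rewrite /D -bigcup_seq; apply: bigcup_sub => i _; exact: F2.
apply: (@le_trans _ _ (\int[mu]_(t in D) (B - ln (normc q.[cis t]))%:E)%E); last first.
  by apply: ge0_subset_integral => //; exact: mv.
rewrite /D ge0_integral_bigsetU//; last exact: mv.
rewrite -sumEFin big_seq [leRHS]big_seq; apply: lee_sum => i si.
have fi : (mu (F i) < +oo)%E.
  apply: (@le_lt_trans _ _ (mu `[0%R, (2 * pi)%R]%classic)).
    apply: le_measure; [by apply/mem_set; exact: mF|by apply/mem_set; exact: measurable_itv|exact: F2].
  by rewrite lebesgue_measure_itv/=; case: ifPn => _; rewrite ltry.
rewrite EFinM fineK; last by rewrite ge0_fin_numE.
rewrite -(integral_cst mu (mF i)); apply: ge0_le_integral => //=.
- exact: mF.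
- by move=> x _; rewrite lee_fin subr_ge0 bB.
- exact: mv.
- by move=> x Fx; rewrite lee_fin lerD2l lerN2 Hb.
Qed.

End JensenIntegral.

(** * Complementary arcs *)

Section Carleson.
Variable R : realType.
Local Notation mu := (@lebesgue_measure R).
Implicit Types E A : set R[i]^o.

(** Pigeonhole: the numbers [1 - d / (j + 1)] are distinct, and [s] cannot contain [size s + 1] of
    them. *)
Lemma avoid_near1 (s : seq R) (e : R) : 0 < e ->
  exists r : R, [/\ 0 < r, r < 1, 1 - r <= e & r \notin s].
Proof.
move=> e0; pose d := Num.min e (1 / 2).
have d0 : 0 < d by rewrite lt_min e0; lra.
have de : d <= e by rewrite ge_min lexx.
have d2 : d <= 1 / 2 by rewrite ge_min lexx orbT.
clearbody d; pose f (j : nat) : R := 1 - d / j.+1%:R.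
have fI : injective f.
  move=> i j /addrI /oppr_inj /mulfI; rewrite gt_eqF// => /(_ isT) /invr_inj.
  by move/eqP; rewrite eqr_nat eqSS => /eqP.
have fP j : [/\ 0 < f j, f j < 1 & 1 - f j <= e].
  have j0 : 0 < j.+1%:R :> R by [].
  have H0 : 0 < d / j.+1%:R by rewrite divr_gt0.
  have H1 : d / j.+1%:R <= d by rewrite ler_pdivrMr// ler_peMr ?(ltW d0)// ler1n.
  by rewrite /f; move: (d / _) H0 H1 => u H0 H1; split; lra.
have [/allP H|/allPn[x /mapP[j _ ->] xs]] :=
    boolP (all (mem s) (map f (iota 0 (size s).+1))); last first.
  by have [? ? ?] := fP j; exists (f j).
have := @uniq_leq_size _ _ s _ H.
by rewrite map_inj_uniq ?iota_uniq// size_map size_iota ltnn => /(_ isT).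
Qed.

(** Take [q(z) = p(r z)] with [r] close to 1 and different from the modulus of every root of [p]: a
    root of [q] on the circle would give a root of [p] of modulus [r]. The value at 0, the only one
    in Jensen's lower bound, does not change. *)
Lemma perturb_roots (p : {poly R[i]}) (e : R) : p != 0 -> 0 < e ->
  exists q : {poly R[i]}, [/\ forall z, root q z -> normc z != 1, q.[0] = p.[0] &
    forall w, normc w = 1 -> normc q.[w] <= normc p.[w] + e].
Proof.
move=> p0 e0; have [L L0 HL] := horner_lipschitz p.
have [s sE] := closed_field_poly_normal p.
have L1 : 0 < L + 1 by rewrite ltr_wpDl.
have [r [r0 r1 re rs]] := avoid_near1 (map (@normc _) s) (divr_gt0 e0 L1).
have qE w : (p \Po (r%:C *: 'X)).[w] = p.[r%:C * w].
  by rewrite horner_comp !hornerE.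
exists (p \Po (r%:C *: 'X)); split.
- move=> z; rewrite /root qE => rz; apply/eqP => z1.
  have {}rz : root p (r%:C * z) by [].
  rewrite sE rootZ ?lead_coef_eq0// root_prod_XsubC in rz.
  move: rs; apply/negP; rewrite negbK; apply/mapP; exists (r%:C * z) => //.
  by rewrite normcM z1 mulr1 normc_real// ltW.
- by rewrite qE mulr0.
- move=> w w1; rewrite qE.
  have rw : normc (r%:C * w - w) = 1 - r.
    rewrite -{2}[w]mul1r -mulrBl normcM w1 mulr1 normc_distC.
    have -> : (1 - r%:C : R[i]) = (1 - r)%:C by rewrite rmorphB.
    by rewrite normc_real// subr_ge0 ltW.
  have -> : p.[r%:C * w] = p.[w] + (p.[r%:C * w] - p.[w]) by rewrite addrC subrK.
  rewrite (le_trans (le_normcD _ _))// lerD2l (le_trans (HL _ _ _ _)) ?w1//.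
    by rewrite normcM w1 mulr1 normc_real ltW.
  rewrite rw (@le_trans _ _ ((L + 1) * (1 - r)))//.
    by rewrite ler_wpM2r ?subr_ge0 ?(ltW r1)// lerDl.
  by rewrite mulrC -ler_pdivlMr.
Qed.

Lemma continuous_cis : continuous (@cis R).
Proof.
move=> x; apply/cvgrPdist_lt => -[e ei]; rewrite ltcE /= => /andP[/eqP -> e0].
near=> y.
rewrite -[ltLHS]/((normc (cis x - cis y))%:C) ltcR.
apply: le_lt_trans (cis_lipschitz _ _) _.
rewrite mulrC -ltr_pdivlMr//.
near: y; apply: cvgr_dist_lt; last exact: divr_gt0.
exact: cvg_id.
Unshelve. all: by end_near. Qed.

Lemma cis_surj (z : R[i]) : normc z = 1 ->
  exists2 t, 0 <= t < 2 * pi & z = cis t.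
Proof.
case: z => x y /= H.
have {}H : x ^+ 2 + y ^+ 2 = 1.
  have h0 : 0 <= x ^+ 2 + y ^+ 2 by rewrite addr_ge0 ?sqr_ge0.
  by rewrite -[LHS]sqr_sqrtr// H expr1n.
have x1 : -1 <= x <= 1.
  by rewrite -ler_norml -(@ler_pXn2r _ 2) ?nnegrE// real_normK ?num_real// expr1n; nra.
have pi0 := pi_gt0 R.
have S : sin (acos x) = `|y|.
  rewrite sin_acos//; have -> : 1 - x ^+ 2 = y ^+ 2 by lra.
  by rewrite sqrtr_sqr.
have [y0|y0] := leP 0 y.
  exists (acos x); first by rewrite acos_ge0//=; have := acos_lepi x1; lra.
  by rewrite /cis acosK ?in_itv// S ger0_norm.
exists (2 * pi - acos x).
  have := acos_lepi x1; have := acos_ge0 x1; rewrite le_eqVlt => /orP[/eqP E|]; last by lra.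
  by move: S y0; rewrite -E sin0 => /esym/eqP; rewrite normr_eq0 => /eqP ->; rewrite ltxx.
have -> : 2 * pi - acos x = - acos x + pi *+ 2 by rewrite -mulr_natl; lra.
by rewrite /cis cosD2pi sinD2pi cosN sinN acosK ?in_itv// S ltr0_norm// opprK.
Qed.

Lemma circle_cis t : circle (cis t : R[i]^o).
Proof. by rewrite /circle /= -[LHS]/((normc (cis t))%:C) normc_cis. Qed.

Lemma circle_normc (z : R[i]^o) : circle z -> normc z = 1.
Proof. by rewrite /circle /= -[LHS]/((normc z)%:C) => -[]. Qed.

(** A complementary arc is a maximal connected subset of the complement of [E] in the circle, so it
    absorbs the image of every connected parameter set that meets it and avoids [E]. Measurability
    of the arcs and their distance to [E] rest on this, without describing them as intervals. *)
Lemma complementary_arcs_sub E A (S : set R) t : complementary_arcs E A ->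
  A (cis t) -> S t -> connected S -> (forall s, S s -> ~ E (cis s)) ->
  S `<=` (@cis R) @^-1` A.
Proof.
move=> [z [cz Ez] <-] At St cS SE.
rewrite (same_connected_component At).
have cc : connected (@cis R @` S).
  apply: connected_continuous_connected => //.
  by apply: continuous_subspaceT => x; exact: continuous_cis.
have SS : @cis R @` S `<=` @circle R `\` E.
  by move=> _ [u Su <-]; split; [exact: circle_cis|exact: SE].
move=> s Ss; apply: (@connected_component_max _ _ (@cis R @` S) _ _ SS cc); last by exists s.
by exists t.
Qed.

Lemma complementary_arcs_trivIset E (s : seq (set R[i]^o)) :
  (forall A, A \in s -> complementary_arcs E A) ->
  trivIset [set` s] (fun A => `[0%R, (2 * pi)%R[%classic `&` (@cis R) @^-1` A).
Proof.
move=> H A B /= /H [z _ <-] /H[z' _ <-] [t [[_ /= ht] [_ /= ht']]].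
by rewrite (same_connected_component ht) (same_connected_component ht').
Qed.

(** The set of parameters of an arc is open: a small interval around one of them avoids the closed
    set [E], hence stays in the arc. *)
Lemma measurable_arc E A : closed E -> complementary_arcs E A ->
  measurable (`[0%R, (2 * pi)%R[%classic `&` (@cis R) @^-1` A).
Proof.
move=> cE EA; apply: measurableI; first exact: measurable_itv.
apply: open_measurable; rewrite openE => t /= At.
have EAsub : A `<=` ~` E.
  by case: EA => z _ <-; apply: subset_trans (@connected_component_sub _ _ _) _ => w [].
have : nbhs t ((@cis R) @^-1` (~` E)).
  apply: continuous_cis; apply: open_nbhs_nbhs; split; last exact: EAsub.
  exact: closed_openC.
move=> /nbhs_ballP[d /= d0 dE]; apply/nbhs_ballP; exists d => //.
apply: (complementary_arcs_sub EA At (ballxx _ d0)).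
  by rewrite ball_itv; apply/connected_intervalP; exact: interval_is_interval.
by move=> s /dE.
Qed.

Lemma measurable_cis_preimage E : closed E ->
  measurable (`[0%R, (2 * pi)%R[%classic `&` (@cis R) @^-1` E).
Proof.
move=> cE; apply: measurableI; first exact: measurable_itv.
apply: closed_measurable; apply: preimage_closed => // x _; exact: continuous_cis.
Qed.

Lemma circle_measure_le2pi E : measurable (`[0%R, (2 * pi)%R[%classic `&` (@cis R) @^-1` E) ->
  (circle_measure E <= (2 * pi)%:E)%E.
Proof.
move=> mE; rewrite /circle_measure.
apply: (@le_trans _ _ (mu `[0%R, (2 * pi)%R[%classic)).
  apply: le_measure; [by apply/mem_set|by apply/mem_set; exact: measurable_itv|].
  exact: subIsetl.
rewrite lebesgue_measure_itv/= lte_fin.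
by rewrite mulr_gt0 ?pi_gt0// oppr0 adde0.
Qed.

(** A parameter interval of length [2 * l] ending at [z] is too long to fit in an arc of length [l],
    so it meets [E]. The factor 4 is this 2 times the Lipschitz constant 2 of [cis]. *)
Lemma arc_near E A z : closed E -> complementary_arcs E A -> A z ->
  0 < arc_length A < pi / 2 -> exists2 e, E e & normc (z - e) <= 4 * arc_length A.
Proof.
move=> cE EA Az /andP[l0 lpi]; set l := arc_length A in l0 lpi *.
have Ac : A `<=` @circle R.
  by case: EA => z' _ <-; apply: subset_trans (@connected_component_sub _ _ _) _ => w [].
have [t /andP[t0 t2] zt] := cis_surj (circle_normc (Ac _ Az)).
(* The interval goes to the right of [t], or to the left if it would pass [2 * pi]. Since
   [l < pi / 2], one of the two sides has room, so wrapping around never occurs. *)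
have [S [St [cS mS] SI Sl Sd]] : exists S : set R, [/\ S t, connected S /\ measurable S,
    S `<=` `[0%R, (2 * pi)%R[, mu S = (2 * l)%:E & forall s, S s -> `|t - s| <= 2 * l].
  have [h|h] := ltP (t + 2 * l) (2 * pi).
    exists `[t, t + 2 * l]%classic; split.
    - by rewrite /= in_itv /= lexx lerDl mulr_ge0// ltW.
    - split; last exact: measurable_itv.
      by apply/connected_intervalP; exact: interval_is_interval.
    - move=> s /=; rewrite !in_itv /= => /andP[ts st].
      by rewrite (le_trans t0 ts) (le_lt_trans st h).
    - by rewrite lebesgue_measure_itv/= lte_fin ltrDl mulr_gt0// -EFinD addrAC subrr add0r.
    - by move=> s /=; rewrite in_itv /= => /andP[ts st]; rewrite distrC ger0_norm; lra.
  exists `[t - 2 * l, t]%classic; split.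
  - by rewrite /= in_itv /= lexx andbT; lra.
  - split; last exact: measurable_itv.
    by apply/connected_intervalP; exact: interval_is_interval.
  - by move=> s /=; rewrite !in_itv /= => /andP[ts st]; apply/andP; split; lra.
  - rewrite lebesgue_measure_itv/= lte_fin ltrBlDl ltrDr mulr_gt0// -EFinD.
    by congr EFin; lra.
  - by move=> s /=; rewrite in_itv /= => /andP[ts st]; rewrite ger0_norm; lra.
have [[s [Ss Es]]|H] := pselect (exists s, S s /\ E (cis s)).
  exists (cis s) => //; rewrite zt (le_trans (cis_lipschitz _ _))//.
  by have := Sd _ Ss; lra.
have mA := measurable_arc cE EA.
have SA : S `<=` `[0%R, (2 * pi)%R[%classic `&` (@cis R) @^-1` A.
  move=> s Ss; split; first exact: SI.
  apply: (complementary_arcs_sub EA (t := t)) Ss => //; first by rewrite -zt.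
  by move=> u Su Eu; apply: H; exists u.
have : (mu S <= circle_measure A)%E.
  by apply: le_measure => //; apply/mem_set.
have A2 := circle_measure_le2pi mA.
have Afin : circle_measure A \is a fin_num.
  by rewrite ge0_fin_numE ?measure_ge0// (le_lt_trans A2) ?ltry.
by rewrite Sl -(fineK Afin) lee_fin -/(arc_length A) -/l; lra.
Qed.

End Carleson.

(** * Hölder estimates for partial sums, and the Carleson condition *)

Section PowerSeriesOnCircle.
Variable R : realType.
Local Notation mu := (@lebesgue_measure R).

Definition ps_trunc (phi : nat -> R[i]) (N : nat) (z : R[i]) : R[i] :=
  \sum_(0 <= n < N) phi n * z ^+ n.

Lemma normc_expB (w z : R[i]) n : normc w <= 1 -> normc z <= 1 ->
  normc (w ^+ n - z ^+ n) <= n%:R * normc (w - z).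
Proof.
move=> w1 z1; elim: n => [|n IH]; first by rewrite !expr0 subrr normc0 mul0r.
have -> : w ^+ n.+1 - z ^+ n.+1 = w * (w ^+ n - z ^+ n) + (w - z) * z ^+ n.
  by rewrite !exprS; ring.
rewrite (le_trans (le_normcD _ _))// !normcM -[n.+1]addn1 natrD mulrDl mul1r lerD//.
  by rewrite (le_trans _ IH)// ler_piMl// normc_ge0.
by rewrite normcX ler_piMr ?normc_ge0// exprn_ile1// normc_ge0.
Qed.

Section Bounds.
Variables (phi : nat -> R[i]) (A0 C b : R).
Hypothesis phi_sum : forall N, \sum_(0 <= n < N) normc (phi n) <= A0.
Hypothesis b_gt0 : 0 < b.
Hypothesis phi_tail : forall P N, (1 <= P)%N ->
  \sum_(P <= n < N) normc (phi n) <= C * P%:R `^ (- b).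

Lemma ps_trunc_le N z : normc z <= 1 -> normc (ps_trunc phi N z) <= A0.
Proof.
move=> z1; rewrite (le_trans _ (phi_sum N))// (le_trans (normc_sum _ _ _))//.
apply: ler_sum => n _; rewrite normcM ler_piMr ?normc_ge0//.
by rewrite normcX exprn_ile1// normc_ge0.
Qed.

Lemma phi_sum_ge0 : 0 <= A0.
Proof. by have := phi_sum 0; rewrite big_geq. Qed.

(** Cut the series at degree [P]. Below it, [z ^+ n] is Lipschitz on the circle with constant at
    most [P]; above it, each difference is at most [2 * normc (phi n)], and the tail bound
    applies. *)
Lemma ps_truncB_le N P w z : normc w = 1 -> normc z = 1 -> (1 <= P)%N ->
  normc (ps_trunc phi N w - ps_trunc phi N z) <=
  A0 * (P%:R * normc (w - z)) + 2 * (C * P%:R `^ (- b)).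
Proof.
move=> w1 z1 P1; rewrite /ps_trunc -sumrB.
apply: le_trans (normc_sum _ _ _) _.
have H n : normc (phi n * w ^+ n - phi n * z ^+ n) <=
    normc (phi n) * (P%:R * normc (w - z)) + (if (P <= n)%N then 2 * normc (phi n) else 0).
  rewrite -mulrBr normcM; case: leqP => Pn.
    rewrite -[leLHS]add0r lerD ?mulr_ge0 ?normc_ge0//.
    rewrite mulrC ler_wpM2r ?normc_ge0// (le_trans (normcB _ _))//.
    by rewrite !normcX w1 z1 !expr1n; lra.
  rewrite addr0 ler_wpM2l ?normc_ge0// (le_trans (normc_expB _ _ _)) ?w1 ?z1//.
  by rewrite ler_wpM2r ?normc_ge0// ler_nat ltnW.
apply: le_trans (ler_sum _ (fun n _ => H n)) _.
rewrite big_split/= -mulr_suml lerD//.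
  by rewrite ler_wpM2r// mulr_ge0// normc_ge0.
rewrite -big_mkcond/= -mulr_sumr ler_wpM2l//.
apply: le_trans (phi_tail N P1).
have [NP|PN] := leqP N P.
  rewrite big_nat_cond big1; first by rewrite sumr_ge0// => n _; exact: normc_ge0.
  by move=> n /andP[/andP[_ nN] Pn]; move: (leq_trans nN NP); rewrite ltnNge Pn.
rewrite (@big_cat_nat _ _ _ P)//=; last exact: ltnW.
rewrite big_nat_cond big1 ?add0r; last first.
  by move=> n /andP[/andP[_ nN]]; rewrite leqNgt nN.
rewrite big_nat_cond [leRHS]big_nat_cond le_eqVlt; apply/orP; left; apply/eqP.
by apply: eq_bigl => n; case: (P <= n)%N.
Qed.

(** Cutting at [P] of order [l ^ (-1/2)] balances the two parts of [ps_truncB_le]: the first is of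
    order [l ^ (1/2) + l], the second of order [l ^ (b/2)]. What matters is that [C'] and [a] are
    independent of [N]. *)
Lemma ps_trunc_holder (L0 : R) : 0 < L0 -> exists C' a : R, [/\ 0 < C', 0 < a &
  forall l N w z, 0 < l <= L0 -> normc w = 1 -> normc z = 1 ->
    normc (w - z) <= 4 * l ->
    normc (ps_trunc phi N w) <= C' * l `^ a + normc (ps_trunc phi N z)].
Proof.
move=> L00; pose a := Num.min (1 / 2) (b / 2).
have a0 : 0 < a by rewrite lt_min !divr_gt0.
have a1 : a <= 1 / 2 by rewrite ge_min lexx.
have ab : a <= b / 2 by rewrite ge_min lexx orbT.
clearbody a.
have Ap := phi_sum_ge0.
(* This reduces all occurring powers of [l] to the smallest exponent [a]; for it, [l] has to stay
   below a fixed [L0]. *)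
have powle l x : 0 < l <= L0 -> a <= x -> l `^ x <= L0 `^ (x - a) * l `^ a.
  move=> /andP[l0 lL] ax.
  rewrite -{1}[x](subrK a) powRD; last by rewrite (gt_eqF l0) implybT.
  by rewrite ler_wpM2r ?powR_ge0// ge0_ler_powR ?nnegrE ?subr_ge0// ltW.
exists (4 * A0 * (L0 `^ (1 / 2 - a) + L0 `^ (1 - a)) + 2 * (`|C| * L0 `^ (b / 2 - a)) + 1), a.
have c1 : 0 <= L0 `^ (1 / 2 - a) by rewrite powR_ge0.
have c2 : 0 <= L0 `^ (1 - a) by rewrite powR_ge0.
have c3 : 0 <= L0 `^ (b / 2 - a) by rewrite powR_ge0.
have Cp : 0 <= `|C| by [].
split=> //; first by rewrite ltr_wpDl// addr_ge0// !mulr_ge0// addr_ge0.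
move=> l N w z /[dup] lL /andP[l0 _] w1 z1 wz.
pose y := l `^ (- (1 / 2)).
have y0 : 0 < y by rewrite powR_gt0.
pose P := (Num.truncn y).+1.
have yP : y < P%:R by exact: truncnS_gt.
have Py : P%:R <= y + 1 by rewrite /P -natr1 lerD2r truncn_le// ltW.
have P0 : 0 < P%:R :> R by rewrite ltr0n.
have -> : ps_trunc phi N w = (ps_trunc phi N w - ps_trunc phi N z) + ps_trunc phi N z by rewrite subrK.
apply: le_trans (le_normcD _ _) _; rewrite lerD2r.
apply: le_trans (ps_truncB_le N w1 z1 (isT : (1 <= P)%N)) _.
have lh : y * l = l `^ (1 / 2).
  rewrite /y -{2}[l](powRr1 (ltW l0)) -powRD; last by rewrite (gt_eqF l0) implybT.
  by congr (_ `^ _); lra.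
have t1 : P%:R * normc (w - z) <= 4 * ((L0 `^ (1 / 2 - a) + L0 `^ (1 - a)) * l `^ a).
  apply: (@le_trans _ _ ((y + 1) * (4 * l))).
    by apply: ler_pM => //; rewrite ?normc_ge0// ltW.
  have -> : (y + 1) * (4 * l) = 4 * (y * l + l) by ring.
  rewrite ler_wpM2l// mulrDl lerD//; first by rewrite lh powle.
  rewrite -{1}[l](powRr1 (ltW l0)) powle//; lra.
have t2 : P%:R `^ (- b) <= L0 `^ (b / 2 - a) * l `^ a.
  rewrite (le_trans _ (powle _ _ lL ab))//.
  have -> : l `^ (b / 2) = y `^ (- b).
    by rewrite /y -powRrM; congr (_ `^ _); lra.
  rewrite !powRN lef_pV2 ?posrE ?powR_gt0//.
  by rewrite ge0_ler_powR ?nnegrE// ltW.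
have la : 0 <= l `^ a by rewrite powR_ge0.
rewrite [leRHS]mulrDl [1 * l `^ a]mul1r -[leLHS]addr0 lerD// [leRHS]mulrDl lerD//.
  by rewrite (le_trans (ler_wpM2l Ap t1))// le_eqVlt; apply/orP; left; apply/eqP; ring.
rewrite -mulrA ler_wpM2l//.
apply: (@le_trans _ _ (`|C| * P%:R `^ (- b))).
  by rewrite ler_wpM2r ?powR_ge0// ler_norm.
by rewrite -mulrA ler_wpM2l.
Qed.

End Bounds.

Theorem carleson_of_zero_set (phi : nat -> R[i]) (A0 C b : R) (eps : nat -> R)
    (E : set R[i]^o) :
  (forall N, \sum_(0 <= n < N) normc (phi n) <= A0) -> 0 < b ->
  (forall P N, (1 <= P)%N ->
    \sum_(P <= n < N) normc (phi n) <= C * P%:R `^ (- b)) ->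
  (exists n, phi n != 0) ->
  closed E -> E `<=` @circle R ->
  eps @ \oo --> (0 : R) ->
  (forall N z, E z -> normc (ps_trunc phi N z) <= eps N) ->
  circle_measure E = 0%E /\ carleson E.
Proof.
move=> phi_sum b0 phi_tail /ex_minnP[m pm0 mmin] cE Ec.
wlog eps_ge0 : eps / forall N, 0 <= eps N => [H eps0 Heps|eps0 Heps].
  apply: (H (fun N => `|eps N|)) => // [|N z Ez].
    by rewrite -(@normr0 _ R^o); exact: cvg_norm.
  by rewrite (le_trans (Heps N z Ez))// ler_norm.
have pi0 := pi_gt0 R.
have phi_lt n : (n < m)%N -> phi n = 0.
  by move=> nm; apply/eqP; apply: contraTT nm => /mmin; rewrite -leqNgt.
have Ap := phi_sum_ge0 phi_sum.
have L00 : 0 < 2 * pi :> R by rewrite mulr_gt0.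
have [C1 [a [C10 a0 Hol]]] := ps_trunc_holder phi_sum b0 phi_tail L00.
(* The second summand is for arcs of length at least [pi / 2], where [arc_near] does not apply:
   there [C' * l ^ a] already exceeds the trivial bound [A0]. *)
pose C' := C1 + A0 / (pi / 2) `^ a.
have p2a : 0 < (pi / 2) `^ a :> R by rewrite powR_gt0// divr_gt0.
have C1C' : C1 <= C' by rewrite lerDl divr_ge0// ltW.
have C'0 : 0 < C' by exact: lt_le_trans C1C'.
(* The polynomial [q] is the partial sum divided by [z ^+ m], which keeps the modulus on the circle,
   then moved by at most [1 / (N + 1)] so as to have no zero there. *)
have Q d : 0 < d -> exists N (q : {poly R[i]}), [/\ forall z, root q z -> normc z != 1,
    q.[0] = phi m, eps N + N.+1%:R^-1 <= d &
    forall w, normc w = 1 -> normc q.[w] <= normc (ps_trunc phi N w) + N.+1%:R^-1].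
  move=> d0.
  have d2 : 0 < d / 2 by rewrite divr_gt0.
  have [N [mN e1 e2]] : exists N, [/\ (m < N)%N, eps N <= d / 2 & N.+1%:R^-1 <= d / 2].
    near \oo => N; exists N; split; near: N.
    - exact: nbhs_infty_gt.
    - have /cvgrPdist_le /(_ _ d2) := eps0; apply: filterS => n.
      by rewrite sub0r normrN; apply: le_trans; exact: ler_norm.
    - have /cvgrPdist_le /(_ _ d2) := @cvg_harmonic R; apply: filterS => n.
      by rewrite sub0r normrN; apply: le_trans; exact: ler_norm.
  pose p := \poly_(n < N - m) phi (n + m)%N.
  have p0 : p.[0] = phi m.
    rewrite horner_coef0 coef_poly subn_gt0 mN add0n//.
  have pn0 : p != 0 by apply: contraNneq pm0 => pz; rewrite -p0 pz horner0.
  have [|q [q1 q2 q3]] := @perturb_roots _ p N.+1%:R^-1 pn0; first by rewrite invr_gt0.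
  exists N, q; split=> //; [by rewrite q2|by rewrite (le_trans (lerD e1 e2))// -splitr|].
  move=> w w1; rewrite (le_trans (q3 _ w1))// lerD2r.
  have -> : ps_trunc phi N w = w ^+ m * p.[w]; last first.
    by rewrite normcM normcX w1 expr1n mul1r.
  rewrite /ps_trunc (@big_cat_nat _ _ _ m)//=; last exact: ltnW.
  rewrite big_nat_cond big1 ?add0r; last first.
    by move=> n /andP[/andP[_ nm] _]; rewrite phi_lt// mul0r.
  rewrite horner_poly mulr_sumr -{1}[m]add0n big_addn big_mkord.
  by apply: eq_bigr => i _; rewrite addnC exprD; ring.
have mE := measurable_cis_preimage cE.
(* The first entry dominates [ln (normc q)] on the whole circle, the extra 1 covering the
   perturbation. The second dominates the bounds used on the arcs, whose lengths are at most
   [2 * pi]. *)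
pose B0 := Num.max (ln (A0 + 1)) (ln (2 * C') + a * ln (2 * pi)).
have B01 : ln (A0 + 1) <= B0 by rewrite le_max lexx.
have B02 : ln (2 * C') + a * ln (2 * pi) <= B0 by rewrite le_max lexx orbT.
clearbody B0.
pose K := 2 * pi * (B0 - ln (normc (phi m))).
(* Jensen's inequality with [N] eliminated: for a large [N] the number [d] absorbs [eps N] and the
   perturbation, while [K] depends only on [phi]. *)
have J d (I : choiceType) (s : seq I) (F : I -> set R) (g : I -> R) :
    0 < d <= 1 -> (forall i, measurable (F i)) -> uniq s -> trivIset [set` s] F ->
    (forall i, F i `<=` `[0%R, (2 * pi)%R]) ->
    (forall i, i \in s -> 0 < g i /\ ln (g i + d) <= B0) ->
    (forall i t N, i \in s -> F i t -> normc (ps_trunc phi N (cis t)) <= g i + eps N) ->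
    \sum_(i <- s) (B0 - ln (g i + d)) * fine (mu (F i)) <= K.
  move=> /andP[d0 d1] mF us tF F2 gB Hg.
  have [N [q [q1 q2 q3 q4]]] := Q d d0.
  have qp t : 0 < normc q.[cis t].
    rewrite lt_def normc_ge0 andbT normc_eq0.
    by apply/negP => /q1; rewrite normc_cis eqxx.
  have N0 : 0 <= N.+1%:R^-1 :> R by rewrite invr_ge0.
  rewrite /K -q2; apply: jensen_sum => //.
  - by rewrite q2.
  - move=> t; rewrite (le_trans _ B01)// ler_ln ?posrE//; last by rewrite ltr_wpDl.
    rewrite (le_trans (q4 _ (normc_cis _)))// lerD//.
      by apply: (ps_trunc_le phi_sum); rewrite normc_cis.
    by rewrite invf_le1// ler1n.
  - by move=> i si; have [] := gB i si.
  - move=> i t si Ft; have [g0 _] := gB i si.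
    rewrite ler_ln ?posrE//; last by rewrite addr_gt0.
    rewrite (le_trans (q4 _ (normc_cis _)))//.
    by move: (Hg i t N si Ft) q3; move: (N.+1%:R^-1) => u; lra.
split.
- have E2 := circle_measure_le2pi mE.
  have Efin : circle_measure E \is a fin_num.
    by rewrite ge0_fin_numE ?measure_ge0// (le_lt_trans E2) ?ltry.
  rewrite -(fineK Efin); congr EFin; set x := fine _.
  have x0 : 0 <= x by rewrite fine_ge0// measure_ge0.
  apply/eqP; rewrite eq_le x0 andbT leNgt; apply/negP => xp.
  (* If [E] had measure [x > 0], the bound [(B0 - ln d) * x <= K] would hold for every small [d];
     this [d] makes the left side at least [|K| + x]. One half of [d] is used as [g], the other as
     the error in [J]. *)
  pose d := Num.min 1 (expR (B0 - (`|K| / x + 1))).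
  have d0 : 0 < d by rewrite lt_min expR_gt0 ltr01.
  have d1 : d <= 1 by rewrite ge_min lexx.
  have dB : ln d <= B0 - (`|K| / x + 1).
    by rewrite -[leRHS]expRK ler_ln ?posrE ?expR_gt0// ge_min lexx orbT.
  have d2 : 0 < d / 2 by rewrite divr_gt0.
  have KX : 0 <= `|K| / x by rewrite divr_ge0// ltW.
  have := @J (d / 2) unit [:: tt]
    (fun=> `[0%R, (2 * pi)%R[%classic `&` (@cis R) @^-1` E) (fun=> d / 2).
  rewrite big_seq1 -splitr => H.
  have {H} : (B0 - ln d) * x <= K.
    apply: H => //.
    - by rewrite d2/=; lra.
    - by move=> i j _ _ _; case: i; case: j.
    - by move=> _ t [/=]; rewrite !in_itv /= => /andP[-> /ltW ->].
    - by move=> _ _; split => //; lra.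
    - by move=> _ t N _ [_ Et]; rewrite (le_trans (Heps N _ Et))// lerDr ltW.
  have h : `|K| / x + 1 <= B0 - ln d by lra.
  apply/negP; rewrite -ltNge.
  apply: (@lt_le_trans _ _ ((`|K| / x + 1) * x)); last by rewrite ler_wpM2r.
  by rewrite mulrDl divfK ?gt_eqF// (le_lt_trans (ler_norm K))// mul1r ltrDl.
- have A2 A : complementary_arcs E A -> 0 <= arc_length A <= 2 * pi /\
      forall z N, A z -> 0 < arc_length A ->
        normc (ps_trunc phi N z) <= C' * arc_length A `^ a + eps N.
    move=> EA; have mA := measurable_arc cE EA.
    have H2 := circle_measure_le2pi mA.
    have Afin : circle_measure A \is a fin_num.
      by rewrite ge0_fin_numE ?measure_ge0// (le_lt_trans H2) ?ltry.
    have l0 : 0 <= arc_length A by rewrite fine_ge0// measure_ge0.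
    have l2 : arc_length A <= 2 * pi by rewrite -lee_fin fineK.
    split=> [|z N Az lp]; first by rewrite l0.
    have z1 : normc z = 1.
      apply: circle_normc; case: EA Az => z' _ <- Az.
      by have [] := connected_component_sub Az.
    have [lpi|lpi] := ltP (arc_length A) (pi / 2).
      have [|e Ee ze] := arc_near cE EA Az; first by rewrite lp.
      have e1 := circle_normc (Ec _ Ee).
      rewrite (le_trans (Hol (arc_length A) N z e _ z1 e1 ze)) ?lp// lerD ?Heps//.
      by rewrite ler_wpM2r ?powR_ge0.
    rewrite (@le_trans _ _ A0) ?(ps_trunc_le phi_sum) ?z1// -[leLHS]addr0 lerD//.
    apply: (@le_trans _ _ (A0 / (pi / 2) `^ a * arc_length A `^ a)).
      rewrite -mulrA ler_peMr// mulrC ler_pdivlMr// mul1r.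
      by rewrite ge0_ler_powR ?nnegrE ?(ltW a0)// ltW// divr_gt0.
    by rewrite ler_wpM2r ?powR_ge0// lerDr ltW.
  (* Every finite subfamily of arcs has sum at most [K / a]: by the choice of [B0], the difference
     [B0 - ln (2 * C' * l ^ a)] is at least [a * ln (2 * pi / l)]. *)
  apply: le_lt_trans (ltry (K / a)).
  apply: ge_ereal_sup => _ [X [finX XE] <-].
  rewrite fsbig_finite//= sumEFin lee_fin.
  (* Arcs of length 0 contribute 0 to the sum and are discarded, since the logarithm estimates need
     a positive length. *)
  set s := [seq A : set R[i]^o <- finmap.enum_fset (fset_set X) | 0 < arc_length A].
  have us : uniq s by apply: filter_uniq; exact: finmap.fset_uniq.
  have sE A : A \in s -> 0 < arc_length A /\ complementary_arcs E A.
    rewrite mem_filter => /andP[-> AX]; split=> //; apply: XE.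
    by move: AX; rewrite in_fset_set// inE.
  have -> : \sum_(A <- finmap.enum_fset (fset_set X)) arc_length A * ln (2 * pi / arc_length A) =
      \sum_(A <- s) arc_length A * ln (2 * pi / arc_length A).
    rewrite big_filter [RHS]big_mkcond /= [LHS]big_seq [RHS]big_seq.
    apply: eq_bigr => A; rewrite in_fset_set// inE => AX.
    case: ltP => // l0; have [/andP[l0' _] _] := A2 A (XE _ AX).
    have -> : arc_length A = 0 by apply/eqP; rewrite eq_le l0.
    by rewrite mul0r.
  pose g A := C' * arc_length A `^ a.
  (* As the family is finite, the error [d] can be taken below every [g A], whence
     [g A + d <= 2 * g A]; this is the 2 in [B0]. *)
  have [d d01 dg] : exists2 d : R, 0 < d <= 1 & forall A, A \in s -> d <= g A.
    have : forall A, A \in s -> 0 < g A.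
      by move=> A /sE[l0 _]; rewrite mulr_gt0// powR_gt0.
    elim: s {us sE} => [|A s IH] Hs; first by exists 1 => //; rewrite ltr01 lexx.
    have [|d /andP[d0 d1] dg] := IH; first by move=> B Bs; rewrite Hs// in_cons Bs orbT.
    have gA : 0 < g A by rewrite Hs// mem_head.
    exists (Num.min d (g A)); first by rewrite lt_min d0 gA ge_min d1.
    move=> B; rewrite in_cons => /orP[/eqP ->|/dg dB]; first by rewrite ge_min lexx orbT.
    by rewrite ge_min dB.
  have lng A : A \in s -> ln (g A + d) <= ln (2 * C') + a * ln (arc_length A).
    move=> As; have [l0 _] := sE A As.
    have g0 : 0 < g A by rewrite mulr_gt0// powR_gt0.
    rewrite -ln_powR -lnM ?posrE ?powR_gt0 ?mulr_gt0// ler_ln ?posrE ?mulr_gt0 ?powR_gt0//.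
      by have := dg A As; rewrite -mulrA -/(g A) => dA; lra.
    by rewrite addr_gt0//; case/andP: d01.
  rewrite ler_pdivlMr// mulr_suml.
  (* [J] asks for measurability at every index, so sets that are not among the chosen arcs are
     replaced by the empty set. *)
  pose F (A : set R[i]^o) := if A \in s then `[0%R, (2 * pi)%R[%classic `&` (@cis R) @^-1` A else set0.
  apply: le_trans (@J d (set R[i]^o) s F g d01 _ us _ _ _ _).
  + rewrite big_seq [leRHS]big_seq; apply: ler_sum => A As.
    have [l0 EA] := sE A As; have [/andP[_ l2] _] := A2 A EA.
    rewrite /F As -[fine _]/(arc_length A) [leLHS]mulrAC -mulrA [leLHS]mulrC ler_wpM2r ?(ltW l0)//.
    rewrite lnM ?posrE ?invr_gt0// lnV ?posrE//.
    by have := lng A As; lra.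
  + move=> A; rewrite /F; case: ifPn => // As; apply: (measurable_arc cE).
    by have [] := sE A As.
  + move=> A B /= As Bs; rewrite /F As Bs.
    by apply: (@complementary_arcs_trivIset _ E s) => // A' /sE[].
  + move=> A; rewrite /F; case: ifPn => As t; last by [].
    by case=> /=; rewrite !in_itv /= => /andP[-> /ltW ->].
  + move=> A As; have [l0 EA] := sE A As; have [/andP[_ l2] _] := A2 A EA.
    split; first by rewrite mulr_gt0// powR_gt0.
    rewrite (le_trans (lng A As))// (le_trans _ B02)// lerD2l ler_wpM2l ?(ltW a0)//.
    by rewrite ler_ln ?posrE.
  + move=> A t N As; rewrite /F As => -[_ At]; have [l0 EA] := sE A As.
    by have [_ H] := A2 A EA; exact: H.
Unshelve. all: by end_near. Qed.

End PowerSeriesOnCircle.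

(** * Weighted sums and the algebra R_k *)

Section WeightedSums.
Variable R : realType.

Lemma cauchy_schwarz_nat (x y : nat -> R) N :
  (\sum_(0 <= n < N) x n * y n) ^+ 2 <=
  (\sum_(0 <= n < N) x n ^+ 2) * (\sum_(0 <= n < N) y n ^+ 2).
Proof.
elim: N => [|N IH]; first by rewrite !big_geq// expr0n mulr0.
rewrite !big_nat_recr//=; move: IH.
set S := \sum_(0 <= n < N) x n * y n.
set A := \sum_(0 <= n < N) x n ^+ 2; set B := \sum_(0 <= n < N) y n ^+ 2.
have A0 : 0 <= A by rewrite sumr_ge0// => n _; exact: sqr_ge0.
have B0 : 0 <= B by rewrite sumr_ge0// => n _; exact: sqr_ge0.
move: (x N) (y N) => u v SAB.
have SS : `|S| <= Num.sqrt A * Num.sqrt B.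
  by rewrite -sqrtrM// -sqrtr_sqr ler_wsqrtr.
have : S * (u * v) <= Num.sqrt A * Num.sqrt B * (`|u| * `|v|).
  by rewrite (le_trans (ler_norm _))// !normrM ler_wpM2r// mulr_ge0.
have h1 : A * v ^+ 2 = (Num.sqrt A * `|v|) ^+ 2.
  by rewrite exprMn sqr_sqrtr// real_normK// num_real.
have h2 : B * u ^+ 2 = (Num.sqrt B * `|u|) ^+ 2.
  by rewrite exprMn sqr_sqrtr// real_normK// num_real.
have := sqr_ge0 (Num.sqrt A * `|v| - Num.sqrt B * `|u|); rewrite sqrrB -h1 -h2 => h3 h4.
have -> : (S + u * v) ^+ 2 = S ^+ 2 + 2 * (S * (u * v)) + u ^+ 2 * v ^+ 2 by ring.
have -> : (A + u ^+ 2) * (B + v ^+ 2) = A * B + A * v ^+ 2 + B * u ^+ 2 + u ^+ 2 * v ^+ 2 by ring.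
have h5 : Num.sqrt A * `|v| * (Num.sqrt B * `|u|) = Num.sqrt A * Num.sqrt B * (`|u| * `|v|) by ring.
rewrite -mulr_natr h5 in h3; lra.
Qed.

(** With [w = k] the two weights are those of H_k and R_k: the bilinear pairing of the two spaces is
    bounded. *)
Lemma cauchy_schwarz_weight (w x y : nat -> R) N : (forall n, 0 < w n) ->
  (\sum_(0 <= n < N) x n * y n) ^+ 2 <=
  (\sum_(0 <= n < N) x n ^+ 2 * w n) * (\sum_(0 <= n < N) y n ^+ 2 / w n).
Proof.
move=> w0; have s0 n : Num.sqrt (w n) != 0 by rewrite gt_eqF// sqrtr_gt0.
have := cauchy_schwarz_nat (fun n => x n * Num.sqrt (w n)) (fun n => y n / Num.sqrt (w n)) N.
congr (_ ^+ 2 <= _ * _); apply: eq_bigr => n _ /=.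
- by rewrite mulrACA mulfV// mulr1.
- by rewrite exprMn sqr_sqrtr// ltW.
- by rewrite exprMn exprVn sqr_sqrtr// ltW.
Qed.

Lemma sum_triangle (V : zmodType) (F : nat -> nat -> V) N :
  \sum_(0 <= j < N) \sum_(0 <= i < j.+1) F i (j - i)%N =
  \sum_(0 <= i < N) \sum_(0 <= m < N - i) F i m.
Proof.
elim: N => [|N IH]; first by rewrite !big_geq.
rewrite big_nat_recr//= IH [RHS]big_nat_recr//= subSnn big_nat1.
rewrite [X in _ + X]big_nat_recr//= subnn addrA; congr (_ + _).
rewrite -big_split/= big_nat_cond [RHS]big_nat_cond; apply: eq_bigr => i.
by rewrite andbT => /andP[_ iN]; rewrite subSn 1?ltnW// big_nat_recr.
Qed.

Section Norms.
Variables (V : normedModType R[i]) (w : nat -> R).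
Hypothesis w_ge0 : forall n, 0 <= w n.
Implicit Types f : nat -> V.

Lemma rnorm_ge0 (v : V) : 0 <= rnorm v.
Proof. by have : 0 <= `|v| by []; rewrite lecE => /andP[]. Qed.

Lemma rnormE (v : V) : `|v| = (rnorm v)%:C.
Proof.
rewrite /rnorm; have : 0 <= `|v| by [].
by case: `|v| => a b; rewrite lecE /= => /andP[/eqP -> _].
Qed.

Lemma wterm_ge0 f n : (0 <= (rnorm (f n) ^+ 2 * w n)%:E)%E.
Proof. by rewrite lee_fin mulr_ge0// sqr_ge0. Qed.

(** Together with [wnorm_sum], this is the passage between the series in the extended reals and the
    finite partial sums on which the later estimates are made. *)
Lemma wspace_bound f K : (forall N, \sum_(0 <= n < N) rnorm (f n) ^+ 2 * w n <= K) ->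
  wspace w f /\ wnorm w f ^+ 2 <= K.
Proof.
move=> H; have H2 : (wnorm2 w f <= K%:E)%E.
  apply: lime_le; first by apply: is_cvg_nneseries => n _ _; exact: wterm_ge0.
  by apply: nearW => N; rewrite sumEFin lee_fin.
have H0 : (0 <= wnorm2 w f)%E by apply: nneseries_ge0 => n _ _; exact: wterm_ge0.
split; first by rewrite /wspace /= (le_lt_trans H2) ?ltry.
rewrite /wnorm sqr_sqrtr ?fine_ge0// -lee_fin fineK//.
by rewrite ge0_fin_numE// (le_lt_trans H2) ?ltry.
Qed.

Lemma wnorm_sum f N : wspace w f ->
  \sum_(0 <= n < N) rnorm (f n) ^+ 2 * w n <= wnorm w f ^+ 2.
Proof.
rewrite /wspace /= => H.
have H0 : (0 <= wnorm2 w f)%E by apply: nneseries_ge0 => n _ _; exact: wterm_ge0.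
rewrite /wnorm sqr_sqrtr ?fine_ge0// -lee_fin fineK ?ge0_fin_numE//.
rewrite -sumEFin; apply: nneseries_lim_ge => n _ _; exact: wterm_ge0.
Qed.

Lemma wnorm_ge0 f : 0 <= wnorm w f.
Proof. exact: sqrtr_ge0. Qed.

End Norms.

Section Algebra.
Variable k : nat -> R.
Hypothesis k_gt0 : forall n, 0 < k n.

(* [g] belongs to R_k, with squared norm at most [K]. *)
Definition Rk_bound (g : nat -> R[i]) (K : R) : Prop :=
  forall N, \sum_(0 <= n < N) normc (g n) ^+ 2 / k n <= K.

Lemma Rk_bound_ge0 g K : Rk_bound g K -> 0 <= K.
Proof. by move=> /(_ 0%N); rewrite big_geq. Qed.

Lemma Rk_bound_sub g K g' : Rk_bound g K -> (forall n, normc (g' n) <= normc (g n)) ->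
  Rk_bound g' K.
Proof.
move=> H H' N; rewrite (le_trans _ (H N))// ler_sum// => n _.
rewrite ler_wpM2r ?invr_ge0 ?(ltW (k_gt0 n))//.
by rewrite ler_pXn2r ?nnegrE ?normc_ge0.
Qed.

Lemma Rk_boundD f g K1 K2 : Rk_bound f K1 -> Rk_bound g K2 ->
  Rk_bound (fun n => f n + g n) (2 * (K1 + K2)).
Proof.
move=> H1 H2 N; apply: (@le_trans _ _ (2 * (\sum_(0 <= n < N) normc (f n) ^+ 2 / k n
   + \sum_(0 <= n < N) normc (g n) ^+ 2 / k n))); last by rewrite ler_wpM2l// lerD.
rewrite -big_split/= mulr_sumr ler_sum// => n _.
rewrite -mulrDl mulrA ler_wpM2r ?invr_ge0 ?(ltW (k_gt0 n))//.
have := le_normcD (f n) (g n); have := normc_ge0 (f n + g n).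
have := sqr_ge0 (normc (f n) - normc (g n)).
have := normc_ge0 (f n); have := normc_ge0 (g n); nra.
Qed.

(** [Rk_bound] measures squared norms, so the constant of the algebra appears squared, which also
    makes it nonnegative. *)
Lemma Rk_bound_mul : Rspace_banach_algebra k -> exists2 M : R, 0 <= M &
  forall f g K1 K2, Rk_bound f K1 -> Rk_bound g K2 ->
    Rk_bound (cauchy_product f g) (M * (K1 * K2)).
Proof.
move=> [M HM]; exists (M ^+ 2) => [|f g K1 K2 fK gK]; first exact: sqr_ge0.
have kV n : 0 <= (k n)^-1 by rewrite invr_ge0 ltW.
have [fs fn] := @wspace_bound R[i]^o _ kV f K1 fK.
have [gs gn] := @wspace_bound R[i]^o _ kV g K2 gK.
have [fgs fgn] := HM _ _ fs gs.
move=> N; apply: le_trans (wnorm_sum kV N fgs) _.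
rewrite -[M ^+ 2 * _]mulr1 -/(Rnorm _ _).
have : Rnorm k (cauchy_product f g) ^+ 2 <= (M * Rnorm k f * Rnorm k g) ^+ 2.
  rewrite ler_pXn2r ?nnegrE ?wnorm_ge0//.
  by rewrite (le_trans _ fgn) ?wnorm_ge0.
move=> /le_trans -> //; rewrite mulr1 !exprMn -mulrA ler_wpM2l ?sqr_ge0//.
by apply: ler_pM => //; exact: sqr_ge0.
Qed.

(* Bounds the operator [phi |-> \sum_n phi_n B^n], truncated to [N <= n < P], on
   H_k: testing against the sequence [k_m v_m] turns it into the adjoint of the
   multiplication operator on R_k. *)
Lemma shift_calculus_bound (M : R) (phi : nat -> R[i]) (f : nat -> R) (N P Q : nat) (t K : R) :
  0 <= M ->
  (forall f g K1 K2, Rk_bound f K1 -> Rk_bound g K2 ->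
    Rk_bound (cauchy_product f g) (M * (K1 * K2))) ->
  (forall n, 0 <= f n) ->
  Rk_bound (fun n => if (N <= n)%N then phi n else 0) t ->
  (forall J, \sum_(0 <= n < J) f n ^+ 2 * k n <= K) ->
  \sum_(0 <= m < Q) k m * (\sum_(N <= n < P) normc (phi n) * f (n + m)%N) ^+ 2 <=
    M * t * K.
Proof.
move=> M0 HM f0 ht hK.
pose v m := \sum_(N <= n < P) normc (phi n) * f (n + m)%N.
have v0 m : 0 <= v m by rewrite sumr_ge0// => n _; rewrite mulr_ge0// normc_ge0.
pose a n : R := if (N <= n < P)%N then normc (phi n) else 0.
pose c m : R := if (m < Q)%N then k m * v m else 0.
have a0 n : 0 <= a n by rewrite /a; case: ifP => // _; exact: normc_ge0.
have c0 n : 0 <= c n by rewrite /c; case: ifP => // _; rewrite mulr_ge0// ltW.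
rewrite -[leLHS]/(\sum_(0 <= m < Q) k m * v m ^+ 2).
(* [W] is both the quantity to be bounded and the squared R_k norm of [c], because
   [(k v)^2 / k = k v^2]. *)
set W := \sum_(0 <= m < Q) k m * v m ^+ 2.
have W0 : 0 <= W by rewrite sumr_ge0// => m _; rewrite mulr_ge0 ?sqr_ge0// ltW.
pose u j : R := \sum_(0 <= i < j.+1) a i * c (j - i)%N.
have u0 j : 0 <= u j by rewrite sumr_ge0// => i _; rewrite mulr_ge0.
have ua : Rk_bound (fun n => (u n)%:C) (M * (t * W)).
  have -> : (fun n => (u n)%:C) =
      cauchy_product (fun n => (a n)%:C) (fun n => (c n)%:C).
    apply/funext => n; rewrite /u /cauchy_product big_mkord rmorph_sum/=.
    by apply: eq_bigr => i _; rewrite rmorphM.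
  apply: HM.
    apply: Rk_bound_sub ht _ => n; rewrite normc_real// /a.
    case: (leqP N n) => _; last by rewrite normc0.
    by case: ifP => // _; exact: normc_ge0.
  move=> J; have cE n : normc (c n)%:C ^+ 2 / k n = if (n < Q)%N then k n * v n ^+ 2 else 0.
    rewrite normc_real// /c; case: ifP => _; last by rewrite expr0n mul0r.
    by field; rewrite gt_eqF.
  under eq_bigr => n _ do rewrite cE.
  rewrite -big_mkcond /= /W.
  have [JQ|QJ] := leqP J Q.
    rewrite (@big_cat_nat _ _ _ J 0 Q)//= big_nat_cond [X in _ <= X + _]big_nat_cond.
    rewrite (eq_bigl (fun i => (0 <= i < J)%N && true)); last first.
      by move=> i; case: (ltnP i J) => //= iJ; rewrite (leq_trans iJ JQ).
    by rewrite lerDl sumr_ge0// => m _; rewrite mulr_ge0 ?sqr_ge0// ltW.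
  rewrite (@big_cat_nat _ _ _ Q 0 J)//=; last exact: ltnW.
  rewrite [X in _ + X <= _]big_nat_cond [X in _ + X <= _]big1 ?addr0; last first.
    by move=> i /andP[/andP[Qi _]]; rewrite ltnNge Qi.
  rewrite big_nat_cond [leRHS]big_nat_cond (eq_bigl (fun i => (0 <= i < Q)%N && true))//.
  by move=> i; case: (i < Q)%N.
(* Expanding one of the two factors [v m] writes [W] as a sum over the rectangle [i < P], [m < Q].
   It lies in the triangle [i + m < P + Q], which carries the pairing of [f] with the product [u] of
   [a] and [c]; all terms are nonnegative. *)
have WE : W <= \sum_(0 <= j < P + Q) f j * u j.
  have -> : \sum_(0 <= j < P + Q) f j * u j =
     \sum_(0 <= i < P + Q) \sum_(0 <= m < P + Q - i) a i * c m * f (i + m)%N.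
    rewrite -sum_triangle; apply: eq_bigr => j _; rewrite mulr_sumr.
    rewrite big_nat_cond [RHS]big_nat_cond; apply: eq_bigr => i.
    by rewrite andbT => /andP[_ ij]; rewrite subnKC// mulrC.
  apply: (@le_trans _ _ (\sum_(0 <= i < P) \sum_(0 <= m < Q) a i * c m * f (i + m)%N)).
    rewrite exchange_big/= /W; apply: ler_sum_nat => m /andP[_ mQ].
    rewrite /c mQ.
    have -> : k m * v m ^+ 2 = \sum_(N <= n < P) normc (phi n) * (k m * v m) * f (n + m)%N.
      rewrite expr2 mulrA {2}/v mulr_sumr; apply: eq_bigr => n _; ring.
    rewrite le_eqVlt; apply/orP; left; apply/eqP; rewrite /a.
    have [NP|PN] := leqP N P; last first.
      rewrite [LHS]big_geq 1?ltnW// big1_seq// => i; rewrite mem_index_iota => /andP[_ iP].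
      by rewrite leqNgt (ltn_trans iP PN)/= !mul0r.
    rewrite [RHS](@big_cat_nat _ _ _ N)//= [X in _ = X + _]big_nat_cond [X in _ = X + _]big1 ?add0r.
      rewrite big_nat_cond [RHS]big_nat_cond; apply: eq_bigr => i.
      by rewrite andbT => ->.
    by move=> i /andP[/andP[_ iN] _]; rewrite leqNgt iN/= !mul0r.
  have H0 i m : 0 <= a i * c m * f (i + m)%N by rewrite !mulr_ge0.
  rewrite [leRHS](@big_cat_nat _ _ _ P)//= ?leq_addr// -[leLHS]addr0 lerD//; last first.
    by rewrite sumr_ge0// => i _; rewrite sumr_ge0.
  apply: ler_sum_nat => i /andP[_ iP].
  rewrite [leRHS](@big_cat_nat _ _ _ Q)//=; last by lia.
  by rewrite lerDl sumr_ge0.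
have := cauchy_schwarz_weight f u (P + Q) k_gt0.
set S := \sum_(0 <= n < P + Q) f n * u n in WE * => CS.
(* [W] occurs on both sides because the norm of [u] is bounded through that of [c]; it remains to
   divide by [W]. *)
have S2 : W ^+ 2 <= K * (M * (t * W)).
  apply: (@le_trans _ _ (S ^+ 2)); first by rewrite ler_pXn2r ?nnegrE// (le_trans W0).
  apply: le_trans CS _; apply: ler_pM.
  - by rewrite sumr_ge0// => n _; rewrite mulr_ge0 ?sqr_ge0// ltW.
  - by rewrite sumr_ge0// => n _; rewrite mulr_ge0 ?sqr_ge0// invr_ge0 ltW.
  - exact: hK.
  have := ua (P + Q)%N; congr (_ <= _); apply: eq_bigr => n _.
  by rewrite normc_real.
have [->|Wn0] := eqVneq W 0.
  have t0 := Rk_bound_ge0 ht.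
  by have := hK 0%N; rewrite big_geq// => K0; rewrite !mulr_ge0.
have Wp : 0 < W by rewrite lt_def Wn0.
rewrite -(ler_pM2r Wp) -expr2 (le_trans S2)//.
by rewrite le_eqVlt; apply/orP; left; apply/eqP; ring.
Qed.

End Algebra.
End WeightedSums.

(** * Annihilators in R_k *)

Section FormalPowerSeries.
Variable A : comNzRingType.

(* A synonym of [nat -> A] carrying the Cauchy product; [nat -> A] itself
   carries the pointwise one. *)
Definition fps : Type := nat -> A.
Implicit Types f g h : fps.

HB.instance Definition _ := gen_eqMixin fps.
HB.instance Definition _ := gen_choiceMixin fps.

Definition fps_add f g : fps := fun n => f n + g n.
Definition fps_opp f : fps := fun n => - f n.
Definition fps_mul f g : fps := fun n => \sum_(i < n.+1) f i * g (n - i)%N.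
Definition fps_const (a : A) : fps := fun n => if n == 0%N then a else 0.

Definition fps_trunc N f : {poly A} := \poly_(i < N) f i.

(** A coefficient of a product depends on finitely many coefficients of the factors, so
    associativity and commutativity are inherited from polynomials. *)
Lemma fps_mul_trunc N f g n : (n < N)%N ->
  fps_mul f g n = (fps_trunc N f * fps_trunc N g)`_n.
Proof.
move=> nN; rewrite coefM; apply: eq_bigr => i _; rewrite !coef_poly.
by rewrite (leq_ltn_trans _ nN) ?leq_ord// (leq_ltn_trans _ nN) ?leq_subr.
Qed.

Lemma fps_addA : associative fps_add.
Proof. by move=> f g h; apply/funext => n; exact: addrA. Qed.
Lemma fps_addC : commutative fps_add.
Proof. by move=> f g; apply/funext => n; exact: addrC. Qed.
Lemma fps_add0 : left_id (fun=> 0) fps_add.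
Proof. by move=> f; apply/funext => n; exact: add0r. Qed.
Lemma fps_addN : left_inverse (fun=> 0) fps_opp fps_add.
Proof. by move=> f; apply/funext => n; exact: addNr. Qed.

HB.instance Definition _ := GRing.isZmodule.Build fps
  fps_addA fps_addC fps_add0 fps_addN.

Lemma fps_mulC : commutative fps_mul.
Proof.
by move=> f g; apply/funext => n; rewrite !(fps_mul_trunc _ _ (ltnSn n)) mulrC.
Qed.

Lemma fps_mulA : associative fps_mul.
Proof.
have trM f g N i : (i < N)%N -> (fps_trunc N (fps_mul f g))`_i =
    (fps_trunc N f * fps_trunc N g)`_i.
  by move=> iN; rewrite coef_poly iN (fps_mul_trunc _ _ iN).
move=> f g h; apply/funext => n; rewrite !(fps_mul_trunc _ _ (ltnSn n)).
transitivity ((fps_trunc n.+1 f * (fps_trunc n.+1 g * fps_trunc n.+1 h))`_n).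
  by rewrite !coefM; apply: eq_bigr => i _; rewrite trM// ltnS leq_subr.
by rewrite mulrA !coefM; apply: eq_bigr => i _; rewrite trM.
Qed.

Lemma fps_mul1 : left_id (fps_const 1) fps_mul.
Proof.
move=> f; apply/funext => n; rewrite /fps_mul big_ord_recl subn0 mul1r.
by rewrite big1 ?addr0// => i _; rewrite mul0r.
Qed.

Lemma fps_mulDl : left_distributive fps_mul fps_add.
Proof.
move=> f g h; apply/funext => n; rewrite /fps_mul /fps_add -big_split.
by apply: eq_bigr => i _; rewrite mulrDl.
Qed.

Lemma fps_1neq0 : fps_const 1 != 0 :> fps.
Proof.
apply/eqP => /(congr1 (fun f : fps => f 0%N)) /eqP; apply/negP.
exact: oner_neq0.
Qed.

HB.instance Definition _ := GRing.Zmodule_isComNzRing.Build fps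
  fps_mulA fps_mulC fps_mul1 fps_mulDl fps_1neq0.

Lemma fpsD f g n : (f + g) n = f n + g n. Proof. by []. Qed.
Lemma fpsN f n : (- f) n = - f n. Proof. by []. Qed.
Lemma fpsM f g n : (f * g) n = \sum_(i < n.+1) f i * g (n - i)%N.
Proof. by []. Qed.

End FormalPowerSeries.

Section RkIdeal.
Variables (R : realType) (k : nat -> R).
Hypothesis k_gt0 : forall n, 0 < k n.
Variable M : R.
Hypothesis M_ge0 : 0 <= M.
Hypothesis Rk_mul : forall f g K1 K2, Rk_bound k f K1 -> Rk_bound k g K2 ->
  Rk_bound k (cauchy_product f g) (M * (K1 * K2)).
Local Notation fpsC := (fps (R[i])).

Definition Rk (g : fpsC) : Prop := exists K, Rk_bound k g K.

Lemma RkD f g : Rk f -> Rk g -> Rk (f + g).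
Proof. by move=> [K1 f1] [K2 g2]; eexists; exact: Rk_boundD. Qed.

Lemma RkN f : Rk f -> Rk (- f).
Proof.
by move=> [K fK]; exists K; apply: Rk_bound_sub fK _ => // n; rewrite fpsN normcN.
Qed.

Lemma RkM f g : Rk f -> Rk g -> Rk (f * g).
Proof. by move=> [K1 f1] [K2 g2]; eexists; exact: Rk_mul. Qed.

Lemma Rk_const c : Rk (fps_const c).
Proof.
exists (normc c ^+ 2 / k 0%N) => -[|N]; first by rewrite big_geq// divr_ge0 ?sqr_ge0// ltW.
rewrite big_nat_recl// big1 ?addr0// => n _.
by rewrite [fps_const c _](_ : _ = 0)// normc0 expr0n mul0r.
Qed.

Lemma Rk1 : Rk 1. Proof. exact: Rk_const. Qed.
Lemma Rk0 : Rk 0.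
Proof. by exists 0 => N; rewrite big1// => n _; rewrite normc0 expr0n mul0r. Qed.

Lemma Rk_sum (I : Type) (r : seq I) (P : pred I) (F : I -> fpsC) :
  (forall i, P i -> Rk (F i)) -> Rk (\sum_(i <- r | P i) F i).
Proof. by move=> H; apply: big_ind => //; [exact: Rk0|exact: RkD]. Qed.

Lemma Rk_prod (I : Type) (r : seq I) (P : pred I) (F : I -> fpsC) :
  (forall i, P i -> Rk (F i)) -> Rk (\prod_(i <- r | P i) F i).
Proof. by move=> H; apply: big_ind => //; [exact: Rk1|exact: RkM]. Qed.

Lemma Rk_sign n f : Rk f -> Rk ((-1) ^+ n * f).
Proof.
move=> fR; rewrite -signr_odd; case: odd; rewrite ?expr1 ?expr0 ?mul1r// mulN1r.
exact: RkN.
Qed.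

Lemma Rk_det n (G : 'M[fpsC]_n) : (forall i j, Rk (G i j)) -> Rk (\det G).
Proof.
by move=> H; apply: Rk_sum => s _; apply: Rk_sign; apply: Rk_prod => i _; exact: H.
Qed.

Lemma Rk_adj n (G : 'M[fpsC]_n) : (forall i j, Rk (G i j)) ->
  forall i j, Rk (\adj G i j).
Proof.
move=> H i j; rewrite mxE /cofactor; apply: Rk_sign; apply: Rk_det => i' j'.
by rewrite !mxE.
Qed.

(** Convergence to 0 through the real-valued modulus, so that the estimates take place in [R] and
    not in the order and topology of [R[i]]. *)
Definition vanishing (u : nat -> R[i]) : Prop :=
  forall e, 0 < e -> \forall N \near \oo, normc (u N) <= e.

Lemma vanishing0 : vanishing (fun=> 0).
Proof. by move=> e e0; apply: nearW => N; rewrite normc0 ltW. Qed.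

Lemma vanishingD u v : vanishing u -> vanishing v -> vanishing (fun N => u N + v N).
Proof.
move=> Hu Hv e e0; have e2 : 0 < e / 2 by rewrite divr_gt0.
apply: filterS2 (Hu _ e2) (Hv _ e2) => N h1 h2.
by rewrite (le_trans (le_normcD _ _))// (splitr e) lerD.
Qed.

Lemma vanishingM (a : R[i]) u : vanishing u -> vanishing (fun N => a * u N).
Proof.
move=> Hu e e0; have a1 : 0 < normc a + 1 by rewrite ltr_wpDl// normc_ge0.
apply: filterS (Hu _ (divr_gt0 e0 a1)) => N h; rewrite normcM.
apply: (@le_trans _ _ ((normc a + 1) * normc (u N))).
  by rewrite ler_wpM2r ?normc_ge0// lerDl.
by rewrite mulrC -ler_pdivlMr.
Qed.

Lemma vanishingN u : vanishing u -> vanishing (fun N => - u N).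
Proof. by move=> H; under eq_fun do rewrite -mulN1r; exact: vanishingM. Qed.

Lemma vanishing_sum (I : Type) (r : seq I) (u : I -> nat -> R[i]) :
  (forall i, vanishing (u i)) -> vanishing (fun N => \sum_(i <- r) u i N).
Proof.
move=> H; elim: r => [|i r IH].
  by under eq_fun do rewrite big_nil; exact: vanishing0.
by under eq_fun do rewrite big_cons; exact: vanishingD.
Qed.

Lemma vanishing_shift u m : vanishing u -> vanishing (fun N => u (N - m)%N).
Proof.
move=> H e /H [N0 _ HN]; exists (N0 + m)%N => // N /= mN; apply: HN => /=.
by rewrite leq_subRL ?(leq_trans _ mN) ?leq_addl// addnC.
Qed.

Lemma vanishing_near u v : (\forall N \near \oo, u N = v N) -> vanishing u -> vanishing v.
Proof. by move=> uv Hu e /Hu; apply: filterS2 uv => N ->. Qed.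

Lemma vanishing_cst c : vanishing (fun=> c) -> c = 0.
Proof.
move=> H; apply/eqP; rewrite -normc_eq0 eq_le normc_ge0 andbT leNgt.
apply/negP => c0; have /H [N _ /(_ N (leqnn _))] : 0 < normc c / 2 by rewrite divr_gt0.
by apply/negP; rewrite -ltNge gtr_pMr// invf_lt1// ltr1n.
Qed.

(** Multiplication by [a] transposes to the backward shift: the pairing of [a * h] with [f]
    combines, with the coefficients of [a], the pairings of [h] with the iterated shifts of [f]. The
    cut-off [N - i] keeps the identity exact on partial sums. *)
Lemma pairing_mul (a h : fpsC) (f : nat -> R[i]) N :
  \sum_(0 <= n < N) (a * h) n * f n =
  \sum_(0 <= i < N) a i * \sum_(0 <= m < N - i) h m * f (m + i)%N.
Proof.
transitivity (\sum_(0 <= i < N) \sum_(0 <= m < N - i) a i * (h m * f (m + i)%N)).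
  rewrite -sum_triangle; apply: eq_bigr => n _.
  rewrite fpsM big_mkord mulr_suml; apply: eq_bigr => i _.
  by rewrite mulrA subnK// -ltnS.
by apply: eq_bigr => i _; rewrite mulr_sumr.
Qed.

Lemma pairing_bound (g : fpsC) (f : nat -> R[i]) K1 K2 N : Rk_bound k g K1 ->
  (forall N, \sum_(0 <= n < N) normc (f n) ^+ 2 * k n <= K2) ->
  normc (\sum_(0 <= n < N) g n * f n) ^+ 2 <= K1 * K2.
Proof.
move=> gK fK.
have S0 : 0 <= \sum_(0 <= n < N) normc (f n) * normc (g n).
  by rewrite sumr_ge0// => n _; rewrite mulr_ge0// normc_ge0.
apply: (@le_trans _ _ ((\sum_(0 <= n < N) normc (f n) * normc (g n)) ^+ 2)).
  rewrite ler_pXn2r ?nnegrE ?normc_ge0//.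
  rewrite (le_trans (normc_sum _ _ _))// ler_sum// => n _.
  by rewrite normcM mulrC.
rewrite (le_trans (cauchy_schwarz_weight (fun n => normc (f n)) (fun n => normc (g n)) N k_gt0))//.
rewrite mulrC; apply: ler_pM => //.
- by rewrite sumr_ge0// => n _; rewrite mulr_ge0 ?sqr_ge0// invr_ge0 ltW.
- by rewrite sumr_ge0// => n _; rewrite mulr_ge0 ?sqr_ge0// ltW.
Qed.

Lemma Rk_tail_cvg a : Rk a -> exists2 tau : nat -> R, tau @ \oo --> (0 : R) &
  forall P, Rk_bound k (fun n => if (P <= n)%N then a n else 0) (tau P).
Proof.
move=> [K aK]; pose u N := \sum_(0 <= n < N) normc (a n) ^+ 2 / k n.
have un : {homo u : n m / (n <= m)%N >-> n <= m}.
  apply/nondecreasing_seqP => n; rewrite /u big_nat_recr//= lerDl.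
  by rewrite mulr_ge0 ?sqr_ge0// invr_ge0 ltW.
have cu : cvgn u by apply: nondecreasing_is_cvgn => //; exists K => _ [n _ <-]; exact: aK.
exists (fun P => limn u - u P).
  by rewrite -(subrr (limn u)); apply: cvgB => //; exact: cvg_cst.
move=> P N; have [NP|PN] := leqP N P.
  rewrite big1_seq ?subr_ge0 ?nondecreasing_cvgn_le// => i /andP[_].
  rewrite mem_index_iota => /andP[_ iN].
  by rewrite leqNgt (leq_trans iN NP) normc0 expr0n mul0r.
rewrite (@big_cat_nat _ _ _ P)//=; last exact: ltnW.
rewrite big1_seq ?add0r; last first.
  move=> i /andP[_]; rewrite mem_index_iota => /andP[_ iN].
  by rewrite leqNgt iN normc0 expr0n mul0r.
have -> : \sum_(P <= i < N) normc (if (P <= i)%N then a i else 0) ^+ 2 / k i = u N - u P.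
  rewrite /u (@big_cat_nat _ _ _ P 0 N)//=; last exact: ltnW.
  by rewrite [RHS]addrC addKr; apply: eq_big_nat => i /andP[-> _].
by rewrite lerB// nondecreasing_cvgn_le.
Qed.

Lemma Rk_tail a : Rk a -> forall e, 0 < e -> exists P,
  Rk_bound k (fun n => if (P <= n)%N then a n else 0) e.
Proof.
move=> /Rk_tail_cvg[tau tau0 Htau] e e0.
have /cvgrPdist_le /(_ _ e0) [P _ /(_ P (leqnn _))] := tau0.
rewrite sub0r normrN => /(le_trans (ler_norm _)) HP.
by exists P => N; rewrite (le_trans (Htau P N)).
Qed.

Section Annihilator.
Variables (d : nat) (S : set ('I_d -> nat -> R[i])).
Hypothesis S_shift : forall f, S f -> S (fun j n => f j n.+1).
Hypothesis S_bound : forall f, S f -> forall j, exists K, forall N,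
  \sum_(0 <= n < N) normc (f j n) ^+ 2 * k n <= K.

(** The pairing is bilinear, not sesquilinear, so that transposing a multiplication does not
    conjugate its coefficients. *)
Definition annihilates (h : 'I_d -> fpsC) : Prop := forall f, S f ->
  vanishing (fun N => \sum_(0 <= n < N) \sum_j h j n * f j n).

Lemma annihilatesD h1 h2 : annihilates h1 -> annihilates h2 ->
  annihilates (fun j => h1 j + h2 j).
Proof.
move=> H1 H2 f Sf; have := vanishingD (H1 f Sf) (H2 f Sf).
congr vanishing; apply/funext => N; rewrite -big_split; apply: eq_bigr => n _ /=.
by rewrite -big_split; apply: eq_bigr => j _ /=; rewrite fpsD mulrDl.
Qed.

Lemma annihilates0 : annihilates (fun=> 0).
Proof.
move=> f _; rewrite (_ : (fun N => _) = fun=> 0); first exact: vanishing0.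
by apply/funext => N; rewrite big1// => n _; rewrite big1// => j _; rewrite mul0r.
Qed.

Lemma annihilates_sum (I : Type) (r : seq I) (h : I -> 'I_d -> fpsC) :
  (forall i, annihilates (h i)) -> annihilates (fun j => \sum_(i <- r) h i j).
Proof.
move=> H; elim: r => [|i r IH].
  by under eq_fun do rewrite big_nil; exact: annihilates0.
by under eq_fun do rewrite big_cons; exact: annihilatesD.
Qed.

Lemma S_iter f m : S f -> S (fun j n => f j (n + m)%N).
Proof.
move=> Sf; elim: m => [|m IH]; first by under eq_fun do under eq_fun do rewrite addn0.
have := S_shift IH; congr S; apply/funext => j; apply/funext => n.
by rewrite addSnnS.
Qed.

(* The annihilator is an R_k-submodule: it is invariant under multiplication by
   polynomials, and these approximate [a] in R_k. *)
Lemma annihilatesM a h : Rk a -> (forall j, Rk (h j)) -> annihilates h ->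
  annihilates (fun j => a * h j).
Proof.
move=> aR hR Hh f Sf e e0.
have [Kh hK] : exists Kh, forall j, Rk_bound k (h j) Kh.
  have [Kh hK] := choice hR.
  exists (\big[Num.max/0]_j Kh j) => j N; rewrite (le_trans (hK j N))//.
  exact: le_bigmax.
have [Kf fK] : exists Kf, forall j N, \sum_(0 <= n < N) normc (f j n) ^+ 2 * k n <= Kf.
  have [Kf fK] := choice (S_bound Sf).
  exists (\big[Num.max/0]_j Kf j) => j N; rewrite (le_trans (fK j N))//.
  exact: le_bigmax.
(* Half of [e] is shared among the [d] coordinates; [d.+1] avoids a division by zero when [d = 0].
   The tail of [a] is then cut so that each coordinate of its pairing is at most [b]. *)
pose b := e / 2 / d.+1%:R.
have b0 : 0 < b by rewrite !divr_gt0.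
have e2 : 0 < e / 2 by rewrite divr_gt0.
pose c := M * `|Kh| * `|Kf| + 1.
have c0 : 0 < c by rewrite ltr_wpDl// !mulr_ge0.
have [P HP] := Rk_tail aR (divr_gt0 (exprn_gt0 2 b0) c0).
pose a1 : fpsC := fun n => if (P <= n)%N then a n else 0.
pose a0 : fpsC := fun n => if (P <= n)%N then 0 else a n.
have aE : a = a0 + a1.
  by apply/funext => n; rewrite fpsD /a0 /a1; case: leqP; rewrite ?add0r ?addr0.
have small N : normc (\sum_(0 <= n < N) \sum_j (a1 * h j) n * f j n) <= e / 2.
  rewrite exchange_big/=; apply: le_trans (normc_sum _ _ _) _.
  apply: (@le_trans _ _ (\sum_(j < d) b)); last first.
    rewrite sumr_const card_ord -[b *+ d]mulr_natr /b mulrAC ler_pdivrMr//.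
    by rewrite ler_wpM2l ?(ltW e2)// ler_nat.
  apply: ler_sum => j _.
  rewrite -(@ler_pXn2r _ 2) ?nnegrE ?normc_ge0 ?(ltW b0)//.
  have := pairing_bound N (Rk_mul HP (hK j)) (fK j).
  move/le_trans; apply.
  apply: (@le_trans _ _ (M * (b ^+ 2 / c * `|Kh|) * `|Kf|)).
    apply: ler_pM; rewrite ?ler_norm//.
    - rewrite mulr_ge0// mulr_ge0 ?divr_ge0 ?sqr_ge0 ?(ltW c0)//.
      exact: Rk_bound_ge0 (hK j).
    - by have := fK j 0%N; rewrite big_geq.
    rewrite ler_wpM2l// ler_wpM2l ?ler_norm// divr_ge0 ?sqr_ge0// ltW//.
  have -> : M * (b ^+ 2 / c * `|Kh|) * `|Kf| = b ^+ 2 * ((M * `|Kh| * `|Kf|) / c) by ring.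
  by rewrite ler_piMr ?sqr_ge0// ler_pdivrMr// mul1r lerDl.
(* The polynomial part of [a] gives a finite combination of pairings of [h] with iterated shifts of
   [f], which stay in [S]. *)
have V : vanishing (fun N => \sum_(0 <= i < P)
    a i * \sum_(0 <= m < N - i) \sum_j h j m * f j (m + i)%N).
  apply: vanishing_sum => i; apply: vanishingM.
  exact: (vanishing_shift i (Hh _ (S_iter i Sf))).
have V0 : vanishing (fun N => \sum_(0 <= n < N) \sum_j (a0 * h j) n * f j n).
  apply: vanishing_near V; exists P => // N /= PN.
  rewrite exchange_big/=; under [RHS]eq_bigr do rewrite pairing_mul.
  rewrite [RHS]exchange_big/= [RHS](@big_cat_nat _ _ _ P)//=.
  rewrite [X in _ = _ + X]big1_seq ?addr0; last first.
    move=> i /andP[_]; rewrite mem_index_iota => /andP[Pi _].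
    by rewrite big1// => j _; rewrite /a0 Pi mul0r.
  apply: eq_big_nat => i /andP[_ iP].
  rewrite /a0 leqNgt iP/= exchange_big/= mulr_sumr.
  by apply: eq_bigr.
apply: filterS (V0 _ e2) => N hN.
have -> : \sum_(0 <= n < N) \sum_j (a * h j) n * f j n =
    \sum_(0 <= n < N) \sum_j (a0 * h j) n * f j n +
    \sum_(0 <= n < N) \sum_j (a1 * h j) n * f j n.
  rewrite -big_split; apply: eq_bigr => n _ /=; rewrite -big_split.
  by apply: eq_bigr => j _ /=; rewrite -mulrDl -fpsD -mulrDl -aE.
by rewrite (le_trans (le_normcD _ _))// (splitr e) lerD.
Qed.

End Annihilator.

Section Evaluation.
Variable lam : R[i].
Hypothesis lam_bound : exists K, forall N,
  \sum_(0 <= n < N) normc (lam ^+ n) ^+ 2 * k n <= K.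

Definition evaluates (g : fpsC) (s : R[i]) : Prop :=
  vanishing (fun N => \sum_(0 <= n < N) g n * lam ^+ n - s).

Lemma evaluatesD f g s t : evaluates f s -> evaluates g t -> evaluates (f + g) (s + t).
Proof.
move=> fs gt; have := vanishingD fs gt; congr vanishing; apply/funext => N.
rewrite addrACA -opprD -big_split/=; congr (_ - _).
by apply: eq_bigr => n _; rewrite fpsD mulrDl.
Qed.

Lemma evaluates_const c : evaluates (fps_const c) c.
Proof.
apply: vanishing_near vanishing0; exists 1%N => // -[//|N] _.
rewrite big_nat_recl// big1; first by rewrite /fps_const/= mulr1 addr0 subrr.
by move=> n _; rewrite mul0r.
Qed.

Lemma evaluates1 : evaluates 1 1.
Proof. by rewrite (_ : 1 = fps_const 1 :> fpsC)//; exact: evaluates_const. Qed.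

Lemma evaluatesN f s : evaluates f s -> evaluates (- f) (- s).
Proof.
move=> /vanishingN; congr vanishing; apply/funext => N.
rewrite opprB opprK [RHS]addrC -sumrN; congr (_ + _).
by apply: eq_bigr => n _; rewrite fpsN mulNr.
Qed.

(* The power series vanishing at [lam] form the annihilator of the geometric
   sequence of ratio [lam], hence an ideal of R_k. *)
Lemma evaluates0M a h : Rk a -> Rk h -> evaluates h 0 -> evaluates (a * h) 0.
Proof.
move=> aR hR h0.
pose S := [set f : 'I_1 -> nat -> R[i] | exists c, f = fun _ n => c * lam ^+ n].
have S_shift f : S f -> S (fun j n => f j n.+1).
  move=> [c ->]; exists (c * lam).
  by apply/funext => j; apply/funext => n; rewrite exprS mulrA.
have S_bound f : S f -> forall j, exists K, forall N,
    \sum_(0 <= n < N) normc (f j n) ^+ 2 * k n <= K.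
  move=> [c ->] _; have [K HK] := lam_bound; exists (normc c ^+ 2 * K) => N.
  rewrite (_ : \sum_(0 <= n < N) _ = normc c ^+ 2 * \sum_(0 <= n < N) normc (lam ^+ n) ^+ 2 * k n).
    by rewrite ler_wpM2l// sqr_ge0.
  by rewrite mulr_sumr; apply: eq_bigr => n _; rewrite normcM; ring.
have Hh : annihilates S (fun=> h).
  move=> _ [c ->]; have := vanishingM c h0; congr vanishing; apply/funext => N.
  by rewrite subr0 mulr_sumr; apply: eq_bigr => n _; rewrite big_ord1; ring.
have := annihilatesM S_shift S_bound aR (fun=> hR) Hh (ex_intro _ 1 erefl).
congr vanishing; apply/funext => N; rewrite subr0.
by apply: eq_bigr => n _; rewrite big_ord1 mul1r.
Qed.

(** [a * b - s * t] is [b * (a - s) + s * (b - t)], and both terms lie in the ideal of series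
    vanishing at [lam]. No product of partial sums has to be estimated. *)
Lemma evaluatesM a b s t : Rk a -> Rk b -> evaluates a s -> evaluates b t ->
  evaluates (a * b) (s * t).
Proof.
move=> aR bR ea eb.
have zero f c : evaluates f c -> evaluates (f - fps_const c) 0.
  by move=> fc; rewrite -(subrr c); apply: evaluatesD => //; apply/evaluatesN/evaluates_const.
have RkB f c : Rk f -> Rk (f - fps_const c).
  by move=> fR; apply: RkD => //; apply/RkN/Rk_const.
have cM : fps_const s * fps_const t = fps_const (s * t) :> fpsC.
  apply/funext => -[|n]; rewrite fpsM; first by rewrite big_ord1.
  by rewrite big_ord_recl/= mulr0 add0r big1// => i _; rewrite mul0r.
have -> : a * b = (b * (a - fps_const s) + fps_const s * (b - fps_const t)) + fps_const (s * t).
  by rewrite -cM; ring.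
rewrite -[X in evaluates _ X]add0r; apply: evaluatesD; last exact: evaluates_const.
rewrite -[X in evaluates _ X]addr0; apply: evaluatesD; apply: evaluates0M => //.
- exact: RkB.
- exact: zero.
- exact: Rk_const.
- exact: RkB.
- exact: zero.
Qed.

Lemma evaluates_prod (I : Type) (r : seq I) (F : I -> fpsC) (c : I -> R[i]) :
  (forall i, Rk (F i)) -> (forall i, evaluates (F i) (c i)) ->
  evaluates (\prod_(i <- r) F i) (\prod_(i <- r) c i).
Proof.
move=> FR Fc; apply: (big_ind2 (fun f s => Rk f /\ evaluates f s) _ _ _).2 => //.
  by split; [exact: Rk1|exact: evaluates1].
by move=> f a g b [fR fa] [gR gb]; split; [exact: RkM|exact: evaluatesM].
Qed.

Lemma evaluates_det n (G : 'M[fpsC]_n) (Gam : 'M[R[i]]_n) :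
  (forall i j, Rk (G i j)) -> (forall i j, evaluates (G i j) (Gam i j)) ->
  evaluates (\det G) (\det Gam).
Proof.
move=> GR Gev; rewrite /determinant.
have ev0 : evaluates 0 0 by have := evaluates_const 0; congr evaluates; apply/funext => -[].
apply: (big_ind2 evaluates) => [//|f s g t|s _]; first exact: evaluatesD.
rewrite -signr_odd -[in X in evaluates _ X]signr_odd; case: odd.
  by rewrite !expr1 !mulN1r; apply/evaluatesN/evaluates_prod.
by rewrite !expr0 !mul1r; exact: evaluates_prod.
Qed.

End Evaluation.
End RkIdeal.

(** * Hilbert space geometry *)

Section Dot.
Variables (R : realType) (D : completeNormedModType R[i]).
Variable dotD : {dot D for @Num.conj R[i]}.
Hypothesis dotD_norm : induces_norm dotD.

Lemma dotDl u v w : dotD (u + v) w = dotD u w + dotD v w.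
Proof. by rewrite linearDl. Qed.
Lemma dotDr u v w : dotD w (u + v) = dotD w u + dotD w v.
Proof. by rewrite linearDr. Qed.
Lemma dotZl a u v : dotD (a *: u) v = a * dotD u v.
Proof. by rewrite linearZl_LR. Qed.
Lemma dotZr a u v : dotD u (a *: v) = conjc a * dotD u v.
Proof. by rewrite linearZr_LR. Qed.
Lemma dotC u v : dotD u v = conjc (dotD v u).
Proof. by rewrite hermC expr0 mul1r. Qed.
Lemma dotNl u v : dotD (- u) v = - dotD u v.
Proof. by rewrite -scaleN1r dotZl mulN1r. Qed.
Lemma dot_suml (I : Type) (r : seq I) (F : I -> D) v :
  dotD (\sum_(i <- r) F i) v = \sum_(i <- r) dotD (F i) v.
Proof. by elim/big_rec2: _ => [|i y z _ <-]; rewrite ?linear0l ?dotDl. Qed.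
Lemma dotNr u v : dotD u (- v) = - dotD u v.
Proof. by rewrite dotC dotNl rmorphN/= [in RHS]dotC. Qed.
Lemma dot_sumr (I : Type) (r : seq I) (F : I -> D) v :
  dotD v (\sum_(i <- r) F i) = \sum_(i <- r) dotD v (F i).
Proof. by elim/big_rec2: _ => [|i y z _ <-]; rewrite ?linear0r ?dotDr. Qed.
Lemma dot0l v : dotD 0 v = 0. Proof. by rewrite -(scale0r 0) dotZl mul0r. Qed.

Lemma dot_rnorm u : dotD u u = (rnorm u ^+ 2)%:C.
Proof. by rewrite -dotD_norm rnormE -rmorphXn. Qed.

Lemma rnormZ a (u : D) : rnorm (a *: u) = normc a * rnorm u.
Proof. by apply: complexI; rewrite rmorphM -!rnormE normrZ rnormE. Qed.

Lemma rnormN (u : D) : rnorm (- u) = rnorm u.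
Proof. by rewrite /rnorm normrN. Qed.

Lemma rnorm_eq0 (u : D) : rnorm u = 0 -> u = 0.
Proof. by move=> H; apply/normr0_eq0; rewrite rnormE H. Qed.

Lemma rnorm_sqrD u v : rnorm (u + v) ^+ 2 =
  rnorm u ^+ 2 + rnorm v ^+ 2 + 2 * complex.Re (dotD u v).
Proof.
apply: complexI; rewrite -dot_rnorm !rmorphD/= -!dot_rnorm [(2 * _)%:C]rmorphM/= dotDl !dotDr.
rewrite [dotD v u]dotC -[dotD u u + _ + _]addrA [dotD u v + _]addrA addcJ.
have -> : (2 : R)%:C = 2 :> R[i] by exact: (rmorph_nat (real_complex R) 2).
ring.
Qed.

(** It reduces complex limits of pairings to limits of real parts. *)
Lemma Im_dot u v : complex.Im (dotD u v) = complex.Re (dotD (- 'i *: u) v).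
Proof. by rewrite dotZl; case: (dotD u v) => a b /=; ring. Qed.

(** Gram-Schmidt. A vector already in the span of those treated before it has residual 0 and adds
    nothing, so the given family may be dependent. *)
Lemma orthonormal_seq (b : seq D) : exists o : seq D, [/\ uniq o,
    {in o &, forall x y, dotD x y = (x == y)%:R} &
    {in b, forall v, v = \sum_(x <- o) dotD v x *: x}].
Proof.
elim: b => [|v b [ o [ou oo ob]]]; first by exists [::].
pose r := v - \sum_(x <- o) dotD v x *: x.
have ro x : x \in o -> dotD r x = 0.
  move=> xo; rewrite /r dotDl dotNl dot_suml.
  rewrite (bigD1_seq x)//= dotZl (oo x x)// eqxx mulr1 big_seq_cond big1 ?addr0 ?subrr//.
  by move=> y /andP[yo yx]; rewrite dotZl (oo y x)// (negbTE yx) mulr0.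
have [r0|rn0] := eqVneq r 0.
  exists o; split=> // u; rewrite in_cons => /orP[/eqP ->|/ob //].
  by apply/eqP; rewrite -subr_eq0; exact/eqP.
have nr : rnorm r != 0 by apply: contra_neq rn0 => /rnorm_eq0.
pose e := (rnorm r)^-1%:C *: r.
have ee : dotD e e = 1.
  rewrite dot_rnorm rnormZ normc_real ?invr_ge0 ?rnorm_ge0//.
  by rewrite mulVf// expr1n.
have eo x : x \in o -> dotD e x = 0 by move=> xo; rewrite dotZl ro// mulr0.
have oe x : x \in o -> dotD x e = 0 by move=> xo; rewrite dotC eo// conjc0.
have eno : e \notin o.
  apply/negP => eo'; have /eqP := eo _ eo'; rewrite ee; exact/negP/oner_neq0.
exists (e :: o); split.
- by rewrite /= eno.
- move=> x y; rewrite !in_cons => /orP[/eqP ->|xo] /orP[/eqP ->|yo].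
  + by rewrite ee eqxx.
  + by rewrite eo//; case: eqP => // ey; rewrite ey yo in eno.
  + by rewrite oe//; case: eqP => // ey; rewrite -ey xo in eno.
  + exact: oo.
- move=> u; rewrite in_cons big_cons => /orP[/eqP ->|ub]; last first.
    have ue : dotD u e = 0.
      rewrite (ob _ ub) dot_suml big_seq big1// => x xo.
      by rewrite dotZl oe// mulr0.
    by rewrite ue scale0r add0r -ob.
  have -> : dotD v e *: e = r.
    have vE : v = r + \sum_(x <- o) dotD v x *: x by rewrite subrK.
    have -> : dotD v e = dotD r e.
      rewrite {1}vE dotDl dot_suml [X in _ + X]big_seq [X in _ + X]big1 ?addr0// => x xo.
      by rewrite dotZl oe// mulr0.
    rewrite /e dotZr conjc_real dot_rnorm !scalerA -!rmorphM/=.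
    by rewrite (_ : _ * _ = 1) ?scale1r//; field.
  by rewrite subrK.
Qed.

Lemma orthonormal_basis : finite_dimensional D ->
  exists (d : nat) (o : 'I_d -> D), (forall i j, dotD (o i) (o j) = (i == j)%:R) /\
    forall v, v = \sum_i dotD v (o i) *: o i.
Proof.
move=> [n [b bP]]; have [ o [ou oo ob]] := orthonormal_seq (map b (enum 'I_n)).
exists (size o), (fun i => nth 0 o i); split.
  move=> i j; rewrite oo ?mem_nth// nth_uniq//.
have H v : v = \sum_(x <- o) dotD v x *: x.
  have [c ->] := bP v; rewrite [RHS](_ : _ = \sum_(x <- o) \sum_i (c i * dotD (b i) x) *: x).
    rewrite exchange_big/=; apply: eq_bigr => i _.
    have {1}-> : b i = \sum_(x <- o) dotD (b i) x *: x by apply: ob; rewrite map_f// mem_enum.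
    by rewrite scaler_sumr; apply: eq_bigr => x _; rewrite scalerA.
  apply: eq_bigr => x _; rewrite dot_suml scaler_suml.
  by apply: eq_bigr => i _; rewrite dotZl.
by move=> v; rewrite [LHS]H (big_nth 0) big_mkord.
Qed.

Lemma rnorm_dot_le u o : dotD o o = 1 -> normc (dotD u o) <= rnorm u.
Proof.
move=> oo; pose v := u - dotD u o *: o.
have vo : dotD v o = 0 by rewrite /v dotDl dotNl dotZl oo mulr1 subrr.
have : rnorm u ^+ 2 = rnorm v ^+ 2 + normc (dotD u o) ^+ 2.
  have {1}-> : u = v + dotD u o *: o by rewrite subrK.
  rewrite rnorm_sqrD dotZr vo mulr0 mulr0 addr0 rnormZ.
  have -> : rnorm o = 1; last by rewrite mulr1.
  have /eqP := dot_rnorm o; rewrite oo => /eqP [] /esym/eqP.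
  by rewrite sqrf_eq1 => /orP[/eqP//|/eqP ho]; have := rnorm_ge0 o; rewrite ho; lra.
move=> H; rewrite -(@ler_pXn2r _ 2) ?nnegrE ?normc_ge0 ?rnorm_ge0//.
by rewrite H lerDr sqr_ge0.
Qed.

Variable w : nat -> R.
Hypothesis w_ge0 : forall n, 0 <= w n.
Implicit Types u v : nat -> D.

Definition wsum u N : R := \sum_(0 <= n < N) rnorm (u n) ^+ 2 * w n.
Definition wdot u v N : R := \sum_(0 <= n < N) complex.Re (dotD (u n) (v n)) * w n.

Lemma wsum_ge0 u N : 0 <= wsum u N.
Proof. by rewrite sumr_ge0// => n _; rewrite mulr_ge0// sqr_ge0. Qed.

Lemma wsumD u v N : wsum (u + v) N = wsum u N + wsum v N + 2 * wdot u v N.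
Proof.
rewrite /wsum /wdot mulr_sumr -!big_split; apply: eq_bigr => n _ /=.
by rewrite rnorm_sqrD; ring.
Qed.

Lemma wsumN u N : wsum (- u) N = wsum u N.
Proof. by apply: eq_bigr => n _; rewrite rnormN. Qed.

Lemma wdotNr u v N : wdot u (- v) N = - wdot u v N.
Proof.
by rewrite /wdot -sumrN; apply: eq_bigr => n _; rewrite dotNr; case: (dotD _ _) => a b /=; rewrite mulNr.
Qed.

Lemma wsumZ a u N : wsum (a *: u) N = normc a ^+ 2 * wsum u N.
Proof.
rewrite /wsum mulr_sumr; apply: eq_bigr => n _.
rewrite -[(a *: u) n]/(a *: u n) rnormZ; ring.
Qed.

Lemma wdotZr (a : R) u v N : wdot u (a%:C *: v) N = a * wdot u v N.
Proof.
rewrite /wdot mulr_sumr; apply: eq_bigr => n _.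
rewrite -[(a%:C *: v) n]/(a%:C *: v n) dotZr conjc_real.
by case: (dotD _ _) => x y /=; ring.
Qed.

Lemma wspace_cvg u : wspace w u -> wsum u @ \oo --> wnorm w u ^+ 2.
Proof.
move=> uS; have H N := wnorm_sum w_ge0 N uS.
have un : {homo wsum u : n m / (n <= m)%N >-> n <= m}.
  apply/nondecreasing_seqP => n; rewrite /wsum big_nat_recr//= lerDl.
  by rewrite mulr_ge0// sqr_ge0.
have cu : cvgn (wsum u).
  by apply: nondecreasing_is_cvgn => //; exists (wnorm w u ^+ 2) => _ [n _ <-]; exact: H.
have -> : wnorm w u ^+ 2 = limn (wsum u); last exact: cu.
apply/eqP; rewrite eq_le; apply/andP; split.
  apply: (wspace_bound w_ge0 _).2 => N; exact: nondecreasing_cvgn_le.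
by apply: limr_le => //; apply: nearW => N; exact: H.
Qed.

Lemma wspaceD u v : wspace w u -> wspace w v -> wspace w (u + v).
Proof.
move=> uS vS; apply: (wspace_bound w_ge0 (K := 2 * (wnorm w u ^+ 2 + wnorm w v ^+ 2)) _).1 => N.
have := wnorm_sum w_ge0 N uS; have := wnorm_sum w_ge0 N vS.
have := wsumD u (- v) N; have := wsumD u v N; have := wsum_ge0 (u - v) N.
rewrite wsumN wdotNr /wsum; lra.
Qed.

Lemma wspaceZ a u : wspace w u -> wspace w (a *: u).
Proof.
move=> uS; apply: (wspace_bound w_ge0 (K := normc a ^+ 2 * wnorm w u ^+ 2) _).1 => N.
by rewrite -/(wsum _ N) wsumZ ler_wpM2l ?sqr_ge0//; exact: wnorm_sum.
Qed.

Lemma wspaceN u : wspace w u -> wspace w (- u).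
Proof. by move=> uS; rewrite -scaleN1r; exact: wspaceZ. Qed.

(** By polarization: the limit is written with norms, whose partial sums are monotone and hence
    known to converge. *)
Lemma wdot_cvg u v : wspace w u -> wspace w v ->
  wdot u v @ \oo --> (wnorm w (u + v) ^+ 2 - wnorm w (u - v) ^+ 2) / 4.
Proof.
move=> uS vS.
have -> : wdot u v = (fun N => (wsum (u + v) N - wsum (u - v) N) / 4).
  by apply/funext => N; rewrite !wsumD wsumN wdotNr; lra.
apply: cvgM; last exact: cvg_cst.
by apply: cvgB; apply: wspace_cvg; apply: wspaceD => //; exact: wspaceN.
Qed.

(** First-order condition at a minimum: with [b] the limit of the pairing, the quadratic
    [s ^+ 2 * |v|^2 + 2 * s * b] is nonnegative for all real [s], so [b = 0]. *)
Lemma wdot_vanish u v : wspace w u -> wspace w v ->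
  (forall s : R, wnorm w u ^+ 2 <= wnorm w (u + s%:C *: v) ^+ 2) ->
  wdot u v @ \oo --> (0 : R).
Proof.
move=> uS vS Hmin; have := wdot_cvg uS vS; set b := (_ / 4) => cb; clearbody b.
suff -> : 0 = b by [].
have E s : wnorm w (u + s%:C *: v) ^+ 2 =
    wnorm w u ^+ 2 + s ^+ 2 * wnorm w v ^+ 2 + 2 * (s * b).
  have c1 := wspace_cvg (wspaceD uS (wspaceZ s%:C vS)).
  have c2 : wsum (u + s%:C *: v) @ \oo --> wnorm w u ^+ 2 + s ^+ 2 * wnorm w v ^+ 2 + 2 * (s * b).
    have -> : wsum (u + s%:C *: v) = (fun N => wsum u N + s ^+ 2 * wsum v N + 2 * (s * wdot u v N)).
      apply/funext => N; rewrite wsumD wsumZ wdotZr.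
      by rewrite (_ : normc s%:C ^+ 2 = s ^+ 2)//= expr0n addr0 sqr_sqrtr// sqr_ge0.
    apply: cvgD.
      apply: cvgD; first exact: wspace_cvg.
      by apply: cvgM; [exact: cvg_cst|exact: wspace_cvg].
    by apply: cvgM; [exact: cvg_cst|apply: cvgM => //; exact: cvg_cst].
  exact: (cvg_unique _ c1 c2).
have B s : 0 <= s ^+ 2 * wnorm w v ^+ 2 + 2 * (s * b).
  by rewrite -(lerD2l (wnorm w u ^+ 2)) addr0 addrA -(E s); exact: Hmin.
apply/esym/eqP; set q := wnorm w v ^+ 2 in B.
have q0 : 0 <= q by exact: sqr_ge0.
have q1 : 0 < q + 1 by rewrite ltr_wpDl.
(* The minimum of the quadratic is at [- b / q]; the added 1 avoids dividing by zero when [v] has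
   norm 0, and the value is still negative unless [b = 0]. *)
have := B (- b / (q + 1)).
have -> : (- b / (q + 1)) ^+ 2 * q + 2 * (- b / (q + 1) * b) =
    - (b ^+ 2 * ((q + 2) / (q + 1) ^+ 2)) by field; rewrite gt_eqF.
rewrite oppr_ge0 pmulr_lle0; last by rewrite divr_gt0 ?exprn_gt0//; lra.
by move=> b0; rewrite -sqrf_eq0 eq_le b0 sqr_ge0.
Qed.

Lemma complex_sum_vanishing (u v : nat -> D) (x : R[i]) :
  wdot u v @ \oo --> complex.Re x -> wdot (- 'i *: u) v @ \oo --> complex.Im x ->
  vanishing (fun N => \sum_(0 <= n < N) dotD (u n) (v n) * (w n)%:C - x).
Proof.
move=> c1 c2 e e0; have e2 : 0 < e / 2 by rewrite divr_gt0.
have /cvgrPdist_le /(_ _ e2) n1 := c1; have /cvgrPdist_le /(_ _ e2) n2 := c2.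
apply: filterS2 n1 n2 => N h1 h2.
have -> : \sum_(0 <= n < N) dotD (u n) (v n) * (w n)%:C =
    wdot u v N +i* wdot (- 'i *: u) v N.
  rewrite /wdot; elim: N {h1 h2} => [|N IH]; first by rewrite !big_geq.
  rewrite !big_nat_recr//= IH -Im_dot.
  case: (dotD (u N) (v N)) => a b; apply/eqP.
  by rewrite eq_complex /=; apply/andP; split; apply/eqP; ring.
case: x h1 h2 {c1 c2} => a b /= h1 h2.
rewrite (le_trans (normc_le_ReIm _ _))// (splitr e).
by rewrite lerD// -normrN opprB.
Qed.

Lemma wpairing_cvg u v : wspace w u -> wspace w v ->
  exists x, vanishing (fun N => \sum_(0 <= n < N) dotD (u n) (v n) * (w n)%:C - x).
Proof.
move=> uS vS.
exists (((wnorm w (u + v) ^+ 2 - wnorm w (u - v) ^+ 2) / 4) +i*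
  ((wnorm w (- 'i *: u + v) ^+ 2 - wnorm w (- 'i *: u - v) ^+ 2) / 4)).
apply: complex_sum_vanishing; first exact: wdot_cvg.
by apply: wdot_cvg => //; exact: wspaceZ.
Qed.

Lemma rnorm_cauchy_cvg (H : completeNormedModType R[i]) (x : nat -> H) :
  (forall r : R, 0 < r -> exists N, forall i j, (N <= i)%N -> (N <= j)%N ->
     rnorm (x i - x j) <= r) ->
  exists z, forall r : R, 0 < r -> \forall n \near \oo, rnorm (x n - z) <= r.
Proof.
move=> Hx; have : cvg (x @ \oo).
  apply: cauchy_cvg; apply: cauchy_exP => -[r ri]; rewrite ltcE /= => /andP[/eqP -> r0].
  have [N HN] := Hx _ (divr_gt0 r0 (ltr0n R 2)); exists (x N).
  exists N => // n /= Nn; rewrite -ball_normE /= rnormE.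
  rewrite ltcR (le_lt_trans (HN _ _ _ Nn))// ltr_pdivrMr// ltr_pMr// ltr1n//.
move=> /cvg_ex[z xz]; exists z => r r0.
have r0C : 0 < r%:C by rewrite ltcR.
have /cvgrPdist_le /(_ _ r0C) := xz; apply: filterS => n.
by rewrite distrC rnormE lecR.
Qed.

Section Projection.
Variable H : completeNormedModType R[i].
Variable W : {linear H -> (nat -> D)}.
Hypothesis W_space : forall x, wspace w (W x).
Variables M1 M2 : R.
Hypothesis W_le : forall x, wnorm w (W x) <= M1 * rnorm x.
Hypothesis W_ge : forall x, rnorm x <= M2 * wnorm w (W x).

Lemma parallelogram u v : wspace w u -> wspace w v ->
  wnorm w (u + v) ^+ 2 + wnorm w (u - v) ^+ 2 = 2 * (wnorm w u ^+ 2 + wnorm w v ^+ 2).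
Proof.
move=> uS vS; have vS' := wspaceN vS.
have c1 : (fun N => wsum (u + v) N + wsum (u - v) N) @ \oo -->
    wnorm w (u + v) ^+ 2 + wnorm w (u - v) ^+ 2.
  by apply: cvgD; apply: wspace_cvg; exact: wspaceD.
have c2 : (fun N => wsum (u + v) N + wsum (u - v) N) @ \oo -->
    2 * (wnorm w u ^+ 2 + wnorm w v ^+ 2).
  have -> : (fun N => wsum (u + v) N + wsum (u - v) N) =
      (fun N => 2 * (wsum u N + wsum v N)).
    by apply/funext => N; rewrite !wsumD wsumN wdotNr; lra.
  by apply: cvgM; [exact: cvg_cst|apply: cvgD; exact: wspace_cvg].
exact: (cvg_unique _ c1 c2).
Qed.

Lemma wnormZ_real (a : R) u : wspace w u -> wnorm w (a%:C *: u) ^+ 2 = a ^+ 2 * wnorm w u ^+ 2.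
Proof.
move=> uS; have c1 := wspace_cvg (wspaceZ a%:C uS).
have c2 : wsum (a%:C *: u) @ \oo --> a ^+ 2 * wnorm w u ^+ 2.
  have -> : wsum (a%:C *: u) = (fun N => a ^+ 2 * wsum u N).
    apply/funext => N; rewrite wsumZ.
    by rewrite (_ : normc a%:C ^+ 2 = a ^+ 2)//= expr0n addr0 sqr_sqrtr// sqr_ge0.
  by apply: cvgM; [exact: cvg_cst|exact: wspace_cvg].
exact: (cvg_unique _ c1 c2).
Qed.

(** Expand the squared norm of [sqrt t * u - v / sqrt t], which is nonnegative. With a small [t],
    adding [v] costs little on the norm of [u]; this takes the place of the triangle inequality. *)
Lemma wnorm_sqrD_le (t : R) u v : 0 < t -> wspace w u -> wspace w v ->
  wnorm w (u + v) ^+ 2 <= (1 + t) * wnorm w u ^+ 2 + (1 + t^-1) * wnorm w v ^+ 2.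
Proof.
move=> t0 uS vS; apply: (wspace_bound w_ge0 _).2 => N.
have a1 := wnorm_sum w_ge0 N uS; have a2 := wnorm_sum w_ge0 N vS.
have t1 : 0 < t^-1 by rewrite invr_gt0.
apply: (@le_trans _ _ ((1 + t) * wsum u N + (1 + t^-1) * wsum v N)); last first.
  by apply: lerD; apply: ler_wpM2l => //; lra.
pose s := Num.sqrt t; have s0 : s != 0 by rewrite gt_eqF// sqrtr_gt0.
have ts : t = s ^+ 2 by rewrite sqr_sqrtr// ltW.
rewrite -/(wsum _ N) wsumD.
have := wsum_ge0 (s%:C *: u + (- s^-1)%:C *: v) N.
have E (a : R) : normc a%:C ^+ 2 = a ^+ 2.
  by rewrite /= expr0n addr0 sqr_sqrtr// sqr_ge0.
rewrite wsumD !wsumZ wdotZr !E sqrrN exprVn -ts.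
have -> : wdot (s%:C *: u) v N = s * wdot u v N.
  rewrite /wdot mulr_sumr; apply: eq_bigr => n _.
  rewrite -[(s%:C *: u) n]/(s%:C *: u n) dotZl.
  by case: (dotD _ _) => x y /=; ring.
rewrite mulNr mulKf//.
move: (wsum u N) (wsum v N) (wdot u v N) (t^-1) => a b c d; nra.
Qed.

Lemma approx_minimizers (e : nat -> D) : wspace w e -> exists (x : nat -> H) (m : R),
  (forall y, m <= wnorm w (e - W y) ^+ 2) /\
  (forall j, wnorm w (e - W (x j)) ^+ 2 <= m + j.+1%:R^-1).
Proof.
move=> eS; pose S := [set wnorm w (e - W y) ^+ 2 | y in setT].
have S0 : has_inf S.
  split; first by exists (wnorm w (e - W 0) ^+ 2), 0.
  by exists 0 => _ [y _ <-]; exact: sqr_ge0.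
have Hj j : exists y, wnorm w (e - W y) ^+ 2 <= inf S + j.+1%:R^-1.
  have j0 : 0 < j.+1%:R^-1 :> R by rewrite invr_gt0.
  by have [_ [y _ <-] Hy] := inf_adherent j0 S0; exists y; exact: ltW.
have [x Hx] := choice Hj.
exists x, (inf S); split => // y; apply: ge_inf; first by case: S0.
by exists y.
Qed.

(** The point of the range of [W] nearest to [e]. Since [W] is bounded below, a minimizing sequence
    is Cauchy already in [H], whose completeness provides the limit; no completeness of the weighted
    sequence space is needed. *)
Lemma hilbert_projection (e : nat -> D) : wspace w e ->
  exists x, forall y,
    vanishing (fun N => \sum_(0 <= n < N) dotD (W y n) ((e - W x) n) * (w n)%:C).
Proof.
have WB a b : W (a - b) = W a - W b by exact: linearB.
have WD a b : W (a + b) = W a + W b by exact: linearD.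
have WZ a b : W (a *: b) = a *: W b by exact: linearZ.
move=> eS; have [x [m [Hm Hx]]] := approx_minimizers eS.
have eW y : wspace w (e - W y) by apply: wspaceD => //; exact: wspaceN.
(* Parallelogram identity: the image of the midpoint of [x i] and [x j] is at squared distance at
   least [m] from [e]. *)
have dist i j : wnorm w (W (x i - x j)) ^+ 2 <= 2 * (i.+1%:R^-1 + j.+1%:R^-1).
  have := parallelogram (eW (x j)) (eW (x i)).
  have -> : e - W (x j) - (e - W (x i)) = W (x i - x j).
    by rewrite WB opprB addrC addrA subrK.
  have -> : e - W (x j) + (e - W (x i)) = 2%:C *: (e - W (2^-1%:C *: (x j + x i))).
    rewrite scalerBr WZ scalerA -rmorphM mulfV// scale1r WD opprD.
    rewrite (_ : 2%:C = 2%:R :> R[i]); last exact: (rmorph_nat (real_complex R) 2).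
    by rewrite scaler_nat mulr2n addrACA.
  rewrite wnormZ_real//.
  have := Hm (2^-1%:C *: (x j + x i)); have := Hx i; have := Hx j.
  by move: (i.+1%:R^-1) (j.+1%:R^-1) => a b; lra.
have M20 y : rnorm y ^+ 2 <= M2 ^+ 2 * wnorm w (W y) ^+ 2.
  rewrite -exprMn ler_pXn2r ?nnegrE ?rnorm_ge0//.
  by rewrite (le_trans _ (W_ge y))// rnorm_ge0.
have [z xz] : exists z, forall r : R, 0 < r -> \forall n \near \oo, rnorm (x n - z) <= r.
  apply: rnorm_cauchy_cvg => r r0.
  have c0 : 0 < M2 ^+ 2 * 4 + 1 by rewrite ltr_wpDl// mulr_ge0 ?sqr_ge0.
  have b0 : 0 < r ^+ 2 / (M2 ^+ 2 * 4 + 1) by rewrite divr_gt0 ?exprn_gt0.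
  have /cvgrPdist_le /(_ _ b0) [N _ HN] := @cvg_harmonic R; exists N => i j Ni Nj.
  have {}HN n : (N <= n)%N -> n.+1%:R^-1 <= r ^+ 2 / (M2 ^+ 2 * 4 + 1).
    by move=> /HN /=; rewrite sub0r normrN; apply: le_trans; exact: ler_norm.
  rewrite -(@ler_pXn2r _ 2) ?nnegrE ?rnorm_ge0 ?(ltW r0)//.
  apply: le_trans (M20 _) _.
  apply: (@le_trans _ _ (M2 ^+ 2 * (4 * (r ^+ 2 / (M2 ^+ 2 * 4 + 1))))).
    rewrite ler_wpM2l ?sqr_ge0// (le_trans (dist i j))//.
    by move: (HN i Ni) (HN j Nj); move: (i.+1%:R^-1) (j.+1%:R^-1) (_ / _) => a b c; lra.
  rewrite mulrA mulrCA ler_piMr ?sqr_ge0// ler_pdivrMr// mul1r lerDl//.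
exists z => y.
(* The minimum is attained at [z], up to three errors of size [h / 3]: [t * m], the defect
   [1 / (j + 1)] of [x j], and the distance from [x j] to [z], amplified by [1 + t^-1]. Hence [t] is
   fixed before [j]. *)
have zmin y' : wnorm w (e - W z) ^+ 2 <= wnorm w (e - W y') ^+ 2.
  apply: le_trans (Hm y'); apply/ler_addgt0Pr => h h0.
  have h3 : 0 < h / 3 by rewrite divr_gt0.
  have m1 : 0 < `|m| + 1 by rewrite ltr_wpDl.
  pose t := h / 3 / (`|m| + 1).
  have t0 : 0 < t by rewrite divr_gt0.
  have tm : t * m <= h / 3.
    apply: (@le_trans _ _ (t * (`|m| + 1))); last by rewrite divfK// gt_eqF.
    by rewrite ler_wpM2l ?(ltW t0)// (le_trans (ler_norm m))// lerDl.
  have t1 : 0 < 1 + t by rewrite addr_gt0.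
  have ti : 0 < 1 + t^-1 by rewrite addr_gt0// invr_gt0.
  pose r := h / 3 / (1 + t^-1).
  have r0 : 0 < r by rewrite divr_gt0.
  have c0 : 0 < M1 ^+ 2 + 1 by rewrite ltr_wpDl// sqr_ge0.
  have s0 : 0 < Num.sqrt (r / (M1 ^+ 2 + 1)) by rewrite sqrtr_gt0 divr_gt0.
  have [j [Hj1 Hj2]] : exists j, j.+1%:R^-1 <= h / 3 / (1 + t) /\
      rnorm (x j - z) <= Num.sqrt (r / (M1 ^+ 2 + 1)).
    near \oo => j; exists j; split; near: j; last exact: xz.
    have /cvgrPdist_le /(_ _ (divr_gt0 h3 t1)) := @cvg_harmonic R; apply: filterS => n.
    by rewrite sub0r normrN; apply: le_trans; exact: ler_norm.
  have -> : e - W z = (e - W (x j)) + W (x j - z).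
    by rewrite WB addrA subrK.
  apply: le_trans (wnorm_sqrD_le t0 (eW _) (W_space _)) _.
  have q1 : (1 + t) * wnorm w (e - W (x j)) ^+ 2 <= m + h / 3 + h / 3.
    apply: (@le_trans _ _ ((1 + t) * (m + j.+1%:R^-1))); first by rewrite ler_wpM2l// ltW.
    rewrite mulrDr mulrDl mul1r lerD ?lerD2l//.
    by rewrite mulrC -ler_pdivlMr.
  have q2 : (1 + t^-1) * wnorm w (W (x j - z)) ^+ 2 <= h / 3.
    rewrite mulrC -ler_pdivlMr// -/r.
    apply: (@le_trans _ _ ((M1 * rnorm (x j - z)) ^+ 2)).
      rewrite ler_pXn2r ?nnegrE ?wnorm_ge0//.
      by rewrite (le_trans _ (W_le _))// wnorm_ge0.
    rewrite exprMn; apply: (@le_trans _ _ (M1 ^+ 2 * (r / (M1 ^+ 2 + 1)))).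
      rewrite ler_wpM2l ?sqr_ge0// -[leRHS]sqr_sqrtr; last by rewrite divr_ge0 ?ltW.
      by rewrite ler_pXn2r ?nnegrE ?rnorm_ge0 ?sqrtr_ge0.
    rewrite mulrCA ler_piMr ?(ltW r0)// ler_pdivrMr// mul1r lerDl//.
  by lra.
have V y' : wdot (W y') (e - W z) @ \oo --> (0 : R).
  have -> : wdot (W y') (e - W z) = wdot (e - W z) (W y').
    apply/funext => N; apply: eq_bigr => n _; rewrite dotC.
    by case: (dotD _ _).
  apply: wdot_vanish => // s.
  have -> : e - W z + s%:C *: W y' = e - W (z - s%:C *: y').
    by rewrite WB WZ opprB addrA addrAC.
  exact: zmin.
(* Minimality along real directions gives the real part; the imaginary part is the real part at
   [- 'i *: y], which is also in [H]. *)
have := @complex_sum_vanishing (W y) (e - W z) 0 (V y).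
under eq_fun do rewrite subr0; apply.
by rewrite -WZ; exact: V.
Unshelve. all: by end_near. Qed.

End Projection.
End Dot.

(** * Operators *)

Section OperatorCalculus.
Variables (R : realType) (H : completeNormedModType R[i]).
Implicit Types x y : H.

Lemma ler_rnormD x y : rnorm (x + y) <= rnorm x + rnorm y.
Proof. by rewrite -lecR rmorphD/= -!rnormE ler_normD. Qed.

Lemma rnorm_scale a x : rnorm (a *: x) = normc a * rnorm x.
Proof. by apply: complexI; rewrite rmorphM -!rnormE normrZ rnormE. Qed.

Lemma rnorm_opp x : rnorm (- x) = rnorm x.
Proof. by rewrite /rnorm normrN. Qed.

Lemma rnorm_distC x y : rnorm (x - y) = rnorm (y - x).
Proof. by rewrite -rnorm_opp opprB. Qed.

Lemma rnorm0 : rnorm (0 : H) = 0.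
Proof. by rewrite /rnorm normr0. Qed.

Lemma rnorm_le0 x : rnorm x <= 0 -> x = 0.
Proof.
move=> h; apply/normr0_eq0; rewrite rnormE.
by rewrite (_ : rnorm x = 0)//; apply/eqP; rewrite eq_le h rnorm_ge0.
Qed.

Lemma linear_of_linear (f : H -> H) : linear f ->
  exists F : {linear H -> H}, F =1 f.
Proof.
move=> lf; pose m := GRing.isLinear.Build R[i] H H *:%R f lf.
pose F : {linear H -> H} := HB.pack f m.
by exists F.
Qed.

Lemma bounded_linear_continuous_rnorm (f : {linear H -> H}) (c : R) :
  (forall x, rnorm (f x) <= c * rnorm x) -> continuous f.
Proof.
move=> fc x; apply/cvgrPdist_lt => -[e ei]; rewrite ltcE /= => /andP[/eqP -> e0].
near=> y; rewrite -linearB rnormE ltcR.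
have c1 : 0 < `|c| + 1 by rewrite ltr_wpDl.
apply: (@le_lt_trans _ _ ((`|c| + 1) * rnorm (x - y))).
  rewrite (le_trans (fc _))// ler_wpM2r ?rnorm_ge0// (le_trans (ler_norm c))// lerDl//.
rewrite mulrC -ltr_pdivlMr// -ltcR -rnormE.
near: y; apply: cvgr_dist_lt; first exact: cvg_id.
by rewrite ltcR divr_gt0.
Unshelve. all: by end_near. Qed.

(** The iteration [u (n + 1) = u n + (y - Y (u n))] halves the residual at each step. The lower
    bound [below] gives injectivity, makes the iterates Cauchy, and bounds the inverse. *)
Lemma neumann (Y : {linear H -> H}) :
  (forall x, rnorm (Y x - x) <= rnorm x / 2) ->
  exists V : {linear H -> H}, [/\ continuous V, cancel Y V & cancel V Y].
Proof.
move=> HY.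
have below x : rnorm x <= 2 * rnorm (Y x).
  have := ler_rnormD (x - Y x) (Y x); rewrite subrK rnorm_distC.
  by have := HY x; lra.
have Y_inj x y : Y x = Y y -> x = y.
  move=> xy; apply/eqP; rewrite -subr_eq0; apply/eqP/rnorm_le0.
  by rewrite (le_trans (below _))// linearB xy subrr rnorm0 mulr0.
have surj y : exists x, Y x = y.
  pose fix u n : H := if n is n'.+1 then u n' + (y - Y (u n')) else 0.
  have d n : rnorm (y - Y (u n)) <= rnorm y / 2 ^+ n.
    elim: n => [|n IH]; first by rewrite /= linear0 subr0 expr0 divr1.
    rewrite /= linearD; set z := y - Y (u n) in IH *.
    have -> : y - (Y (u n) + Y z) = - (Y z - z) by rewrite /z; rewrite opprB opprD addrA.
    by rewrite rnorm_opp (le_trans (HY z))// exprSr invfM mulrA ler_wpM2r// invr_ge0.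
  have small r : 0 < r -> \forall n \near \oo, rnorm (y - Y (u n)) <= r.
    move=> r0; have y1 : 0 < rnorm y + 1 by rewrite ltr_wpDl// rnorm_ge0.
    have h : `|2^-1 : R| < 1 by rewrite ger0_norm ?invr_ge0// invf_lt1// ltr1n.
    have /cvgrPdist_le /(_ _ (divr_gt0 r0 y1)) := cvg_expr h; apply: filterS => n.
    rewrite sub0r normrN => /(le_trans (ler_norm _)) hn.
    rewrite (le_trans (d n))// -exprVn.
    rewrite (@le_trans _ _ ((rnorm y + 1) * 2^-1 ^+ n))//.
      by rewrite ler_wpM2r ?exprn_ge0 ?invr_ge0// lerDl.
    by rewrite mulrC -ler_pdivlMr.
  have [|x xP] := @rnorm_cauchy_cvg R H u.
    move=> r r0; have r4 : 0 < r / 4 by rewrite divr_gt0.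
    have [N _ HN] := small _ r4; exists N => i j Ni Nj.
    rewrite (le_trans (below _))// linearB.
    have -> : Y (u i) - Y (u j) = (y - Y (u j)) + - (y - Y (u i)).
      by rewrite opprB [RHS]addrC addrA subrK.
    have := ler_rnormD (y - Y (u j)) (- (y - Y (u i))); rewrite rnorm_opp.
    by have := HN i Ni; have := HN j Nj; rewrite /=; lra.
  exists x; apply/eqP; rewrite eq_sym -subr_eq0; apply/eqP/rnorm_le0.
  apply/ler_addgt0Pr => r r0; rewrite add0r.
  have r4 : 0 < r / 4 by rewrite divr_gt0.
  near \oo => n.
  have h1 : rnorm (y - Y (u n)) <= r / 4 by near: n; exact: small.
  have h2 : rnorm (u n - x) <= r / 4 by near: n; exact: xP.
  have -> : y - Y x = (y - Y (u n)) + ((Y (u n - x) - (u n - x)) + (u n - x)).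
    by rewrite subrK linearB addrA subrK.
  apply: le_trans (ler_rnormD _ _) _.
  have := ler_rnormD (Y (u n - x) - (u n - x)) (u n - x).
  by have := HY (u n - x); lra.
have [v vP] := choice surj.
have vlin : linear v.
  by move=> a x y; apply: Y_inj; rewrite linearP !vP.
have [V VE] := linear_of_linear vlin.
exists V; split; last by move=> x; rewrite VE vP.
- apply: (@bounded_linear_continuous_rnorm _ 2) => x.
  by rewrite (le_trans (below _))// VE vP.
- by move=> x; apply: Y_inj; rewrite VE vP.
Unshelve. all: by end_near. Qed.

Variable T : {linear H -> H}.
Hypothesis T_cont : continuous T.

Definition op_trunc (phi : nat -> R[i]) N x : H :=
  \sum_(0 <= n < N) phi n *: iter n T x.

(** The quotient of [T ^ n - lam ^ n] by [T - lam], built recursively. *)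
Fixpoint pow_quotient (lam : R[i]) n x : H :=
  if n is n'.+1 then T (pow_quotient lam n' x) + lam ^+ n' *: x else 0.

(** The divisibility of [p(z) - p(lam)] by [z - lam], applied to [T]. Both orders of composition are
    recorded because a resolvent is a two-sided inverse. *)
Lemma op_trunc_factor (phi : nat -> R[i]) N (lam : R[i]) :
  exists Q : {linear H -> H}, [/\ continuous Q,
    forall x, Q (T x - lam *: x) = op_trunc phi N x - ps_trunc phi N lam *: x &
    forall x, T (Q x) - lam *: Q x = op_trunc phi N x - ps_trunc phi N lam *: x].
Proof.
have TB a b : T (a - b) = T a - T b by exact: linearB.
have TD a b : T (a + b) = T a + T b by exact: linearD.
have TZ a b : T (a *: b) = a *: T b by exact: linearZ.
have [r rP] : exists r : nat -> H -> H, forall n, [/\ linear (r n), continuous (r n),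
    forall x, r n (T x) = T (r n x) &
    forall x, T (r n x) - lam *: r n x = iter n T x - lam ^+ n *: x].
  exists (pow_quotient lam).
  elim=> [|n [l c com E]]; split => /=.
  - by move=> a x y; rewrite scaler0 addr0.
  - exact: cst_continuous.
  - by move=> x; rewrite linear0.
  - by move=> x; rewrite linear0 scaler0 subr0 expr0 scale1r subrr.
  - move=> a x y; rewrite l linearP scalerDr scalerA [_ * a]mulrC -scalerA.
    by rewrite scalerDr addrACA.
  - move=> x; apply: cvgD.
      by apply: continuous_comp; [exact: c|exact: T_cont].
    by apply: cvgZr; exact: cvg_id.
  - by move=> x; rewrite com TD TZ.
  - move=> x.
    have ET : T (T (pow_quotient lam n x)) - lam *: T (pow_quotient lam n x) =
        T (iter n T x) - lam ^+ n *: T x by rewrite -!TZ -!TB E.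
    by rewrite TD TZ scalerDr opprD addrACA ET scalerA exprS addrA subrK.
elim: N => [|N [Q [cQ Q1 Q2]]].
  have [Q QE] := @linear_of_linear (fun=> 0) (fun a x y => esym (etrans (addr0 _) (scaler0 _ a))).
  exists Q; split.
  - by apply: (@bounded_linear_continuous_rnorm _ 0) => x; rewrite QE rnorm0 mul0r.
  - by move=> x; rewrite QE /op_trunc /ps_trunc !big_geq// scale0r subr0.
  - by move=> x; rewrite !QE linear0 scaler0 /op_trunc /ps_trunc !big_geq// scale0r !subr0.
have [l c com E] := rP N.
pose q x := Q x + phi N *: r N x.
have ql : linear q.
  move=> a x y; rewrite /q l linearP !scalerDr !scalerA [phi N * a]mulrC.
  by rewrite addrACA.
have [Q' Q'E] := linear_of_linear ql.
have [L LE] := linear_of_linear l.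
have rB x y : r N (x - y) = r N x - r N y by rewrite -!LE linearB.
have rZ a x : r N (a *: x) = a *: r N x by rewrite -!LE linearZ.
have tot x : op_trunc phi N.+1 x - ps_trunc phi N.+1 lam *: x =
    op_trunc phi N x - ps_trunc phi N lam *: x + phi N *: (iter N T x - lam ^+ N *: x).
  rewrite /op_trunc /ps_trunc !big_nat_recr//= scalerDl scalerBr scalerA.
  by rewrite opprD addrACA.
exists Q'; split.
- have -> : (Q' : H -> H) = q by apply/funext.
  move=> x; apply: cvgD; first exact: cQ.
  by apply: cvgZr; exact: c.
- by move=> x; rewrite Q'E /q Q1 tot rB com rZ E.
- by move=> x; rewrite Q'E /q tot -Q2 -E TD TZ scalerDr [lam *: (phi N *: _)]scalerA
    [lam * _]mulrC -scalerA opprD addrACA scalerBr.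
Qed.

(** If [s = p(lam)] had modulus larger than [2 * c], then [- s^-1 (T - lam) Q = 1 - s^-1 p(T)] would
    be within 1/2 of the identity, hence invertible, and so would be [T - lam]. The 2 comes from the
    ratio 1/2 in [neumann]; it is harmless, as the bound is applied with [c] tending to 0. *)
Lemma spectrum_bound (phi : nat -> R[i]) N (c : R) (lam : R[i]) : 0 <= c ->
  (forall x, rnorm (op_trunc phi N x) <= c * rnorm x) ->
  spectrum T lam -> normc (ps_trunc phi N lam) <= 2 * c.
Proof.
move=> c0 Hc; apply: contraPP => /negP; rewrite -ltNge => sc; apply.
set s := ps_trunc phi N lam in sc.
have s0 : s != 0 by rewrite -normc_eq0 gt_eqF// (le_lt_trans _ sc)// mulr_ge0.
have sp : 0 < normc s by rewrite lt_def normc_eq0 s0 normc_ge0.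
have [Q [cQ Q1 Q2]] := op_trunc_factor phi N lam.
have TB a b : T (a - b) = T a - T b by exact: linearB.
have TZ a b : T (a *: b) = a *: T b by exact: linearZ.
have TD a b : T (a + b) = T a + T b by exact: linearD.
have QZ a b : Q (a *: b) = a *: Q b by exact: linearZ.
have QD a b : Q (a + b) = Q a + Q b by exact: linearD.
pose y x := - s^-1 *: (T (Q x) - lam *: Q x).
have yl : linear y.
  move=> a x z; rewrite /y QD QZ TD TZ [a *: (_ *: _)]scalerA [a * _]mulrC -scalerA.
  rewrite -scalerDr; congr (_ *: _).
  by rewrite !scalerDr scalerN !scalerA [lam * a]mulrC opprD addrACA.
have [Y YE] := linear_of_linear yl.
have [x|V [cV VY YV]] := @neumann Y.
  have -> : Y x - x = - s^-1 *: op_trunc phi N x.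
    by rewrite YE /y Q2 scalerBr -/s scalerA mulNr mulVf// scaleN1r opprK addrK.
  rewrite rnorm_scale normcN normcV mulrC ler_pdivrMr//.
  apply: le_trans (Hc x) _.
  have -> : rnorm x / 2 * normc s = (normc s / 2) * rnorm x by ring.
  by rewrite ler_wpM2r ?rnorm_ge0//; lra.
have SL x : V (- s^-1 *: Q (T x - lam *: x)) = x.
  by rewrite -[RHS]VY YE /y Q1 Q2.
have SR x : T (- s^-1 *: Q (V x)) - lam *: (- s^-1 *: Q (V x)) = x.
  by rewrite TZ scalerA [lam * _]mulrC -scalerA -scalerBr -[RHS]YV YE.
(* The left inverse and the right inverse of [T - lam] coincide. *)
have SS x : - s^-1 *: Q (V x) = V (- s^-1 *: Q x).
  by rewrite -{2}[x](SR x) SL.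
have [|S SE] := @linear_of_linear (fun x => - s^-1 *: Q (V x)).
  move=> a x z; have -> : V (a *: x + z) = a *: V x + V z by exact: linearP.
  by rewrite QD QZ scalerDr !scalerA [- _ * a]mulrC.
exists S; split.
- have -> : (S : H -> H) = (fun x => - s^-1 *: Q (V x)) by apply/funext.
  move=> x; apply: cvgZr; apply: continuous_comp; [exact: cV|exact: cQ].
- by move=> x; rewrite SE SS SL.
- by move=> x; rewrite !SE SR.
Qed.

End OperatorCalculus.

(** * The annihilating series *)

Section AnnihilatingSeries.
Variables (R : realType) (k : nat -> R).
Hypothesis k_gt0 : forall n, 0 < k n.
Variable M : R.
Hypothesis M_ge0 : 0 <= M.
Hypothesis Rk_mul : forall f g K1 K2, Rk_bound k f K1 -> Rk_bound k g K2 ->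
  Rk_bound k (cauchy_product f g) (M * (K1 * K2)).
Variables (D : completeNormedModType R[i]) (dotD : {dot D for @Num.conj R[i]}).
Hypothesis dotD_norm : induces_norm dotD.
Variables (d : nat) (o : 'I_d -> D).
Hypothesis o_orth : forall i j, dotD (o i) (o j) = (i == j)%:R.
Hypothesis o_span : forall v, v = \sum_i dotD v (o i) *: o i.
Variables (H : completeNormedModType R[i]) (T : {linear H -> H}).
Hypothesis T_cont : continuous T.
Variable W : {linear H -> (nat -> D)}.
Hypothesis W_space : forall x, wspace k (W x).
Variables M1 M2 : R.
Hypothesis W_le : forall x, wnorm k (W x) <= M1 * rnorm x.
Hypothesis W_ge : forall x, rnorm x <= M2 * wnorm k (W x).
Hypothesis W_shift : forall x, W (T x) = backward_shift (W x).

Let k_ge0 n : 0 <= k n. Proof. exact: ltW. Qed.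

Lemma W_iter n x m : W (iter n T x) m = W x (n + m)%N.
Proof. by elim: n m => [//|n IH] m; rewrite iterS W_shift /backward_shift IH addSnnS. Qed.

Lemma o_norm i : dotD (o i) (o i) = 1.
Proof. by rewrite o_orth eqxx. Qed.

Lemma rnorm_le_coord v : rnorm v <= \sum_i normc (dotD v (o i)).
Proof.
have o1 i : rnorm (o i) = 1.
  have := dot_rnorm dotD_norm (o i); rewrite o_norm => -[] /esym/eqP.
  by rewrite sqrf_eq1 => /orP[/eqP//|/eqP ho]; have := rnorm_ge0 (o i); rewrite ho; lra.
rewrite {1}(o_span v); elim/big_rec2: _ => [|i y z _ yz]; first by rewrite rnorm0.
by rewrite (le_trans (ler_rnormD _ _))// rnorm_scale o1 mulr1 lerD2l.
Qed.

Lemma coord_bound x j N :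
  \sum_(0 <= n < N) normc (dotD (W x n) (o j)) ^+ 2 * k n <= wnorm k (W x) ^+ 2.
Proof.
rewrite (le_trans _ (wnorm_sum k_ge0 N (W_space x)))// ler_sum// => n _.
rewrite ler_wpM2r// ler_pXn2r ?nnegrE ?normc_ge0 ?rnorm_ge0//.
exact/rnorm_dot_le/o_norm.
Qed.

Definition coord_set : set ('I_d -> nat -> R[i]) :=
  [set f | exists x, f = fun j n => dotD (W x n) (o j)].

Lemma coord_set_shift f : coord_set f -> coord_set (fun j n => f j n.+1).
Proof.
by move=> [x ->]; exists (T x); apply/funext => j; apply/funext => n; rewrite W_shift.
Qed.

Lemma coord_set_bound f : coord_set f -> forall j, exists K, forall N,
  \sum_(0 <= n < N) normc (f j n) ^+ 2 * k n <= K.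
Proof. by move=> [x ->] j; eexists => N; exact: coord_bound. Qed.

Section Construction.
Variable lam : R[i].
Hypothesis lam_bound : exists K, forall N,
  \sum_(0 <= n < N) normc (lam ^+ n) ^+ 2 * k n <= K.
Hypothesis lam_resolvent : ~ spectrum T lam.

(** Eigenvectors of the backward shift for the eigenvalue [lam], spanning its eigenspace since [o]
    is a basis. *)
Let e (i : 'I_d) : nat -> D := fun n => lam ^+ n *: o i.

Lemma geometric_wspace i : wspace k (e i).
Proof.
have [K HK] := lam_bound.
apply: (wspace_bound k_ge0 (K := rnorm (o i) ^+ 2 * K) _).1 => N.
rewrite (_ : \sum_(0 <= n < N) _ =
    rnorm (o i) ^+ 2 * \sum_(0 <= n < N) normc (lam ^+ n) ^+ 2 * k n).
  by rewrite ler_wpM2l ?sqr_ge0.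
by rewrite mulr_sumr; apply: eq_bigr => n _; rewrite rnorm_scale; ring.
Qed.

(** The backward shift multiplies each [e i] by [lam], so such an [x] satisfies [T x = lam *: x],
    and the resolvent at [lam] forces [x = 0]. *)
Lemma no_eigenvector (c : 'I_d -> R[i]) x : W x = \sum_i c i *: e i -> forall i, c i = 0.
Proof.
move=> Wx; have Wn n : W x n = lam ^+ n *: \sum_i c i *: o i.
  rewrite Wx fct_sumE scaler_sumr; apply: eq_bigr => i _.
  by rewrite /e -[LHS]/(c i *: (lam ^+ n *: o i)) !scalerA mulrC.
have Tx : T x - lam *: x = 0.
  apply: rnorm_le0; apply: le_trans (W_ge _) _.
  have -> : W (T x - lam *: x) = 0.
    have -> : W (T x - lam *: x) = W (T x) - lam *: W x by rewrite linearB linearZ.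
    apply/funext => n; rewrite W_shift /backward_shift.
    by rewrite -[LHS]/(W x n.+1 - lam *: W x n) !Wn scalerA -exprS subrr.
  rewrite (_ : wnorm k 0 = 0) ?mulr0//.
  rewrite /wnorm /wnorm2 eseries0 ?sqrtr0// => n _ _.
  by rewrite rnorm0 expr0n mul0r.
have := lam_resolvent; rewrite /spectrum /= => /contrapT[S [_ Sl _]].
have x0 : x = 0 by rewrite -(Sl x) Tx linear0.
have E : \sum_i c i *: o i = 0.
  by have := Wn 0%N; rewrite x0 linear0 expr0 scale1r => <-.
move=> i; have : dotD (\sum_i c i *: o i) (o i) = c i.
  rewrite dot_suml (bigD1 i)//= dotZl o_norm mulr1 big1 ?addr0// => j ji.
  by rewrite dotZl o_orth (negbTE ji) mulr0.
by rewrite E dot0l.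
Qed.

(** The [d] functionals are induced by the components [w i] of the geometric sequences orthogonal to
    the range of [W]. Evaluation at [lam] is multiplicative, so [\det G] takes there the value of a
    Gram determinant, which is nonzero because the [w i] are independent. *)
Lemma annihilating_series : exists phi : fps R[i], [/\ Rk k phi, exists n, phi n != 0 &
  forall x j, vanishing (fun N => \sum_(0 <= n < N) phi n * dotD (W x n) (o j))].
Proof.
have Hx i := hilbert_projection dotD_norm k_ge0 W_space W_le W_ge (geometric_wspace i).
have [x xP] := choice Hx.
pose w i : nat -> D := e i - W (x i).
have wS i : wspace k (w i).
  by apply: wspaceD => //; [exact: geometric_wspace|exact: wspaceN].
have dot_expand u v : dotD u v = \sum_j dotD (o j) v * dotD u (o j).
  by rewrite {1}(o_span u) dot_suml; apply: eq_bigr => j _; rewrite dotZl mulrC.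
have Hpair i := choice (fun j => wpairing_cvg dotD_norm k_ge0 (geometric_wspace j) (wS i)).
pose Gam i := projT1 (Hpair i).
have GamP i : forall j, vanishing (fun N =>
    \sum_(0 <= n < N) dotD (e j n) (w i n) * (k n)%:C - Gam i j) := projT2 (Hpair i).
(* Multiplying by [k n] carries H_k to R_k isometrically, since [(k x)^2 / k = k x^2], and turns the
   inner product with [w i] into the bilinear pairing with row [i]. *)
pose G : 'M[fps R[i]]_d := \matrix_(i, j) (fun n => dotD (o j) (w i n) * (k n)%:C).
pose GamM : 'M[R[i]]_d := \matrix_(i, j) Gam i j.
have GR i j : Rk k (G i j).
  exists (wnorm k (w i) ^+ 2) => N.
  rewrite (le_trans _ (wnorm_sum k_ge0 N (wS i)))// ler_sum// => n _.
  rewrite mxE normcM normc_real// exprMn.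
  have -> : normc (dotD (o j) (w i n)) ^+ 2 * k n ^+ 2 / k n =
      normc (dotD (o j) (w i n)) ^+ 2 * k n by field; rewrite gt_eqF.
  rewrite ler_wpM2r// ler_pXn2r ?nnegrE ?normc_ge0 ?rnorm_ge0//.
  rewrite dotC -lecR -[X in X <= _]/(`|conjc (dotD (w i n) (o j))|) normcJ lecR.
  exact/rnorm_dot_le/o_norm.
have Gev i j : evaluates lam (G i j) (GamM i j).
  rewrite !mxE; have := GamP i j; congr vanishing; apply/funext => N.
  congr (_ - _); apply: eq_bigr => n _; rewrite /e dotZl; ring.
(* A null vector [v] yields a combination [z] of the [w i] orthogonal to every [e j] and to the
   range of [W]. As [z] lies in their sum, it is orthogonal to itself, so [z = 0], and a combination
   of the [e i] is in the range. The coefficients are conjugated because the inner product is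
   antilinear on the right. *)
have Gdet : \det GamM != 0.
  apply/negP => /det0P[v vn0 vG].
  pose c i := conjc (v 0 i); pose y := \sum_i c i *: x i.
  pose z : nat -> D := \sum_i c i *: w i.
  have zE : z = \sum_i c i *: e i - W y.
    rewrite /z /y linear_sum -sumrB; apply: eq_bigr => i _.
    by rewrite linearZ -scalerBr.
  have dotz u n : dotD u (z n) = \sum_i v 0 i * dotD u (w i n).
    rewrite /z fct_sumE dot_sumr; apply: eq_bigr => i _.
    by rewrite -[(c i *: w i) n]/(c i *: w i n) dotZr conjcK.
  have swap (u : nat -> D) N : \sum_(0 <= n < N) dotD (u n) (z n) * (k n)%:C =
      \sum_i v 0 i * \sum_(0 <= n < N) dotD (u n) (w i n) * (k n)%:C.
    under eq_bigr do rewrite dotz mulr_suml.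
    rewrite exchange_big/=; apply: eq_bigr => i _; rewrite mulr_sumr.
    by apply: eq_bigr => n _; rewrite mulrA.
  have ze j : vanishing (fun N => \sum_(0 <= n < N) dotD (e j n) (z n) * (k n)%:C).
    have := vanishing_sum (index_enum 'I_d) (fun i => vanishingM (v 0 i) (GamP i j)).
    congr vanishing; apply/funext => N; rewrite swap.
    under eq_bigr do rewrite mulrBr; rewrite sumrB.
    have := congr1 (fun A : 'rV_d => A 0 j) vG; rewrite !mxE => vG0.
    rewrite [X in _ - X](_ : _ = 0) ?subr0// -[RHS]vG0.
    by apply: eq_bigr => i _; rewrite mxE.
  have zW u : vanishing (fun N => \sum_(0 <= n < N) dotD (W u n) (z n) * (k n)%:C).
    have := vanishing_sum (index_enum 'I_d) (fun i => vanishingM (v 0 i) (xP i u)).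
    by congr vanishing; apply/funext => N; rewrite swap.
  have zz : vanishing (fun N => \sum_(0 <= n < N) dotD (z n) (z n) * (k n)%:C).
    have := vanishingD (vanishing_sum (index_enum 'I_d) (fun j => vanishingM (c j) (ze j)))
      (vanishingN (zW y)).
    congr vanishing; apply/funext => N.
    under eq_bigr do rewrite mulr_sumr.
    rewrite exchange_big -sumrB/=; apply: eq_bigr => n _.
    rewrite {3}zE -[((_ - W y) n)]/((\sum_i c i *: e i) n - W y n) dotDl dotNl mulrBl.
    congr (_ - _); rewrite fct_sumE dot_suml mulr_suml; apply: eq_bigr => j _.
    by rewrite -[(c j *: e j) n]/(c j *: e j n) [dotD (c j *: _) _]dotZl; ring.
  have z0 : z = 0.
    apply/funext => n; apply: rnorm_le0.
    suff : rnorm (z n) ^+ 2 * k n <= 0.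
      rewrite pmulr_lle0// => h; have /eqP : rnorm (z n) ^+ 2 = 0.
        by apply/eqP; rewrite eq_le h sqr_ge0.
      by rewrite sqrf_eq0 => /eqP ->.
    apply/ler_addgt0Pr => r r0; rewrite add0r.
    have [N _ HN] := zz r r0.
    have := HN (maxn N n.+1) (leq_maxl _ _).
    have -> : \sum_(0 <= n0 < maxn N n.+1) dotD (z n0) (z n0) * (k n0)%:C =
        (wsum k z (maxn N n.+1))%:C.
      rewrite rmorph_sum/=; apply: eq_bigr => m _.
      by rewrite (dot_rnorm dotD_norm) -rmorphM.
    rewrite normc_real ?wsum_ge0//; apply: le_trans.
    rewrite /wsum (@big_cat_nat _ _ _ n.+1)//= ?leq_maxr// big_nat_recr//=.
    rewrite -addrA addrCA lerDl addr_ge0// sumr_ge0// => m _;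
      by rewrite mulr_ge0// sqr_ge0.
  have Wy : W y = \sum_i c i *: e i.
    by apply/esym/eqP; rewrite -subr_eq0 -zE z0.
  have c0 := no_eigenvector Wy.
  move/eqP: vn0; apply; apply/rowP => i; rewrite mxE.
  by apply/eqP; rewrite -conjc_eq0; apply/eqP; exact: c0.
have detR : Rk k (\det G) := Rk_det k_gt0 Rk_mul GR.
exists (\det G); split => //.
  apply: contrapT => nz; move/eqP: Gdet; apply.
  have G0 : \det G = 0.
    by apply/funext => n; apply/eqP; apply: contrapT => /negP ?; apply: nz; exists n.
  have := evaluates_det k_gt0 M_ge0 Rk_mul lam_bound GR Gev; rewrite G0 => /vanishingN.
  have -> : (fun N => - (\sum_(0 <= n < N) (0 : fps R[i]) n * lam ^+ n - \det GamM)) =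
      (fun=> \det GamM).
    by apply/funext => N; rewrite big1 ?sub0r ?opprK// => n _; rewrite mul0r.
  exact: vanishing_cst.
move=> y j.
have Gann i : annihilates coord_set (fun j => G i j).
  move=> _ [u ->]; have := xP i u; congr vanishing; apply/funext => N.
  apply: eq_bigr => n _; rewrite dot_expand mulr_suml; apply: eq_bigr => l _.
  by rewrite mxE; ring.
(* Row [j] of [\adj G *m G] has [\det G] in position [j] and 0 elsewhere, so its pairing involves
   the [j]-th coordinate only. *)
have Aann : annihilates coord_set (fun l => (\adj G *m G) j l).
  have := annihilates_sum (index_enum 'I_d)
    (fun i => annihilatesM k_gt0 M_ge0 Rk_mul coord_set_shift coord_set_bound
       (Rk_adj k_gt0 Rk_mul GR j i) (fun l => GR i l) (Gann i)).
  by congr annihilates; apply/funext => l; rewrite mxE.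
have := Aann _ (ex_intro _ y erefl); congr vanishing; apply/funext => N.
apply: eq_bigr => n _; rewrite mul_adj_mx (bigD1 j)//= big1 ?addr0.
  by rewrite mxE eqxx mulr1n.
by move=> l lj; rewrite mxE eq_sym (negbTE lj) mulr0n mul0r.
Qed.

End Construction.

(** Since [phi] annihilates the range of [W], the truncation at [N] is minus the tail of the
    operator series, and [shift_calculus_bound] controls that tail by the squared R_k norm [tau N]
    of the tail of [phi]. *)
Lemma op_trunc_bound (phi : fps R[i]) : Rk k phi ->
  (forall x j, vanishing (fun N => \sum_(0 <= n < N) phi n * dotD (W x n) (o j))) ->
  exists2 eps : nat -> R, eps @ \oo --> (0 : R) &
    forall N lam, spectrum T lam -> normc (ps_trunc phi N lam) <= eps N.
Proof.
move=> phiR phi0; have [tau tau0 Htau] := Rk_tail_cvg k_gt0 phiR.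
have tau_ge0 N : 0 <= tau N := Rk_bound_ge0 (Htau N).
(* The outer 2 is that of [spectrum_bound], [M2] and [M1] carry norms through [W], and the inner 2
   comes from [(b + e)^2 <= 2 b^2 + 2 e^2], where [e] is the error of stopping the tail at a finite
   [P]. *)
pose eps N := 2 * (`|M2| * Num.sqrt (2 * (M * tau N * M1 ^+ 2))).
exists eps.
  have h : 2 * (`|M2| * Num.sqrt (2 * (M * 0 * M1 ^+ 2))) = 0 :> R.
    by rewrite mulr0 mul0r mulr0 sqrtr0 mulr0 mulr0.
  rewrite -[X in _ --> X]h; apply: cvgM; first exact: cvg_cst.
  apply: cvgM; first exact: cvg_cst.
  apply: (@cvg_comp _ _ _ (fun N => 2 * (M * tau N * M1 ^+ 2)) Num.sqrt) (@sqrt_continuous R _).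
  apply: cvgM; first exact: cvg_cst.
  apply: cvgM; last exact: cvg_cst.
  by apply: cvgM => //; exact: cvg_cst.
move=> N lam; apply: (spectrum_bound T_cont) => [|x]; first by rewrite mulr_ge0// sqrtr_ge0.
apply: le_trans (W_ge _) _.
have B0 : 0 <= 2 * (M * tau N * M1 ^+ 2) by rewrite mulr_ge0// mulr_ge0 ?sqr_ge0// mulr_ge0.
apply: (@le_trans _ _ (`|M2| * wnorm k (W (op_trunc T phi N x)))).
  by rewrite ler_wpM2r ?wnorm_ge0// ler_norm.
rewrite -[leRHS]mulrA ler_wpM2l//.
rewrite -(@ler_pXn2r _ 2) ?nnegrE ?wnorm_ge0 ?mulr_ge0 ?sqrtr_ge0 ?rnorm_ge0//.
rewrite [leRHS]exprMn [Num.sqrt (2 * _) ^+ 2]sqr_sqrtr//; set K := _ * rnorm x ^+ 2.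
apply: (wspace_bound k_ge0 _).2 => Q.
pose f n := rnorm (W x n).
have fK J : \sum_(0 <= n < J) f n ^+ 2 * k n <= M1 ^+ 2 * rnorm x ^+ 2.
  rewrite (le_trans (wnorm_sum k_ge0 J (W_space x)))// -exprMn.
  rewrite ler_pXn2r ?nnegrE ?wnorm_ge0// (le_trans _ (W_le x))// wnorm_ge0//.
apply/ler_addgt0Pr => r r0.
have S0 : 0 <= \sum_(0 <= m < Q) k m by rewrite sumr_ge0.
(* Chosen so that the errors, summed over [m < Q] with weights [k m], stay below [r]. *)
pose e := Num.sqrt (r / (2 * (\sum_(0 <= m < Q) k m + 1))).
have c0 : 0 < 2 * (\sum_(0 <= m < Q) k m + 1) by rewrite mulr_gt0// ltr_wpDl.
have e0 : 0 < e by rewrite sqrtr_gt0 divr_gt0.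
have e2 : e ^+ 2 = r / (2 * (\sum_(0 <= m < Q) k m + 1)) by rewrite sqr_sqrtr// divr_ge0// ltW.
have Wop m : W (op_trunc T phi N x) m = \sum_(0 <= n < N) phi n *: W x (n + m)%N.
  rewrite /op_trunc linear_sum fct_sumE; apply: eq_bigr => n _.
  by rewrite linearZ -[LHS]/(phi n *: W (iter n T x) m) W_iter.
(* One [P] must serve all [m < Q]. Entry [m] of the shifted sum is the pairing of [phi] with the
   coordinates of [W (iter m T x)], and finitely many vanishing sequences are small
   simultaneously. *)
have [P HP] : exists P, forall m, (m < Q)%N ->
    rnorm (W (op_trunc T phi N x) m) <=
      \sum_(N <= n < P) normc (phi n) * f (n + m)%N + e.
  have e1 : 0 < e / d.+1%:R by rewrite divr_gt0.
  have near m : \forall P \near \oo,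
      rnorm (\sum_(0 <= n < P) phi n *: W x (n + m)%N) <= e.
    have : \forall P \near \oo, forall j,
        normc (\sum_(0 <= n < P) phi n * dotD (W (iter m T x) n) (o j)) <= e / d.+1%:R.
      by apply: filter_forall => j; exact: (phi0 (iter m T x) j _ e1).
    apply: filterS => P hP; apply: le_trans (rnorm_le_coord _) _.
    apply: (@le_trans _ _ (\sum_(j < d) e / d.+1%:R)); last first.
      rewrite sumr_const card_ord -[_ *+ d]mulr_natr mulrAC ler_pdivrMr//.
      by rewrite ler_wpM2l ?(ltW e0)// ler_nat.
    apply: ler_sum => j _; apply: le_trans (hP j); rewrite dot_suml.
    rewrite le_eqVlt; apply/orP; left; apply/eqP; congr normc.
    by apply: eq_bigr => n _; rewrite dotZl W_iter addnC.
  have : \forall P \near \oo, forall m : 'I_Q,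
      rnorm (\sum_(0 <= n < P) phi n *: W x (n + m)%N) <= e.
    by apply: filter_forall => m; exact: near.
  move=> [P0 _ HP0]; exists (maxn P0 N) => m mQ.
  have := HP0 (maxn P0 N) (leq_maxl _ _) (Ordinal mQ).
  set P := maxn P0 N; rewrite /= (@big_cat_nat _ _ _ N)//= ?leq_maxr// -Wop => hE.
  set a := W _ m in hE *; set b := \sum_(N <= i < P) _ in hE.
  have -> : a = (a + b) + - b by rewrite addrK.
  rewrite (le_trans (ler_rnormD _ _))// [leLHS]addrC lerD// rnorm_opp /b.
  elim/big_rec2: _ => [|i y1 y2 _ h]; first by rewrite rnorm0.
  by rewrite (le_trans (ler_rnormD _ _))// rnorm_scale lerD2l.
have SC := shift_calculus_bound k_gt0 P Q M_ge0 Rk_mul (fun n => rnorm_ge0 (W x n)) (Htau N) fK.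
apply: (@le_trans _ _ (\sum_(0 <= m < Q) (2 * (k m * (\sum_(N <= n < P) normc (phi n) * f (n + m)%N) ^+ 2)
    + 2 * e ^+ 2 * k m))).
  apply: ler_sum_nat => m /andP[_ mQ].
  have := HP m mQ; set a := rnorm _; set b := \sum_(N <= n < P) _ => ab.
  have a0 : 0 <= a by exact: rnorm_ge0.
  have : a ^+ 2 <= 2 * b ^+ 2 + 2 * e ^+ 2.
    have := sqr_ge0 (b - e); rewrite sqrrB -mulr_natr => h.
    apply: (@le_trans _ _ ((b + e) ^+ 2)); first by rewrite ler_pXn2r ?nnegrE// (le_trans a0).
    by rewrite sqrrD -mulr_natr; lra.
  move=> /(ler_wpM2r (k_ge0 m)) /le_trans; apply.
  by rewrite le_eqVlt; apply/orP; left; apply/eqP; ring.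
rewrite big_split/= -!mulr_sumr lerD//.
  rewrite (le_trans (ler_wpM2l _ SC))// /K.
  by rewrite le_eqVlt; apply/orP; left; apply/eqP; ring.
rewrite e2; have -> : 2 * (r / (2 * (\sum_(0 <= m < Q) k m + 1))) * \sum_(0 <= m < Q) k m =
   r * ((\sum_(0 <= m < Q) k m) / (\sum_(0 <= m < Q) k m + 1)).
  by field; rewrite gt_eqF// ltr_wpDl.
by rewrite ler_piMr ?(ltW r0)// ler_pdivrMr ?mul1r ?lerDl// ltr_wpDl.
Qed.

End AnnihilatingSeries.

(** * Decay of the tails, and passage to the boundary *)

Section TailEstimates.
Variables (R : realType) (k : nat -> R).
Hypothesis k_gt0 : forall n, 0 < k n.

Lemma sum_nat_geq (F : nat -> R) P N :
  \sum_(0 <= n < N) (if (P <= n)%N then F n else 0) = \sum_(P <= n < N) F n.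
Proof.
have [NP|PN] := leqP N P.
  rewrite [RHS]big_geq// big1_seq// => i /andP[_]; rewrite mem_index_iota => /andP[_ iN].
  by rewrite leqNgt (leq_trans iN NP).
rewrite (@big_cat_nat _ _ _ P)//=; last exact: ltnW.
rewrite big1_seq ?add0r.
  by apply: eq_big_nat => i /andP[-> _].
by move=> i /andP[_]; rewrite mem_index_iota => /andP[_ iP]; rewrite leqNgt iP.
Qed.

(** Weighted Cauchy-Schwarz against the indicator of the indices from [P] on. *)
Lemma Rk_sum_tail (phi : nat -> R[i]) (K c : R) P N : Rk_bound k phi K ->
  \sum_(P <= n < N) k n <= c ->
  \sum_(P <= n < N) normc (phi n) <= Num.sqrt (c * K).
Proof.
move=> phiK kc.
have S0 : 0 <= \sum_(P <= n < N) normc (phi n) by rewrite sumr_ge0// => n _; exact: normc_ge0.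
rewrite -[leLHS]ger0_norm// -sqrtr_sqr ler_wsqrtr//.
have := cauchy_schwarz_weight (fun n => if (P <= n)%N then 1 else 0)
  (fun n => normc (phi n)) N k_gt0.
have -> : \sum_(0 <= n < N) (if (P <= n)%N then 1 else 0) * normc (phi n) =
    \sum_(P <= n < N) normc (phi n).
  by rewrite -[RHS]sum_nat_geq; apply: eq_bigr => n _; case: ifP; rewrite ?mul1r ?mul0r.
have -> : \sum_(0 <= n < N) (if (P <= n)%N then 1 else 0) ^+ 2 * k n = \sum_(P <= n < N) k n.
  rewrite -[RHS]sum_nat_geq; apply: eq_bigr => n _.
  by case: ifP; rewrite ?expr1n ?mul1r// expr0n mul0r.
move=> /le_trans; apply; apply: ler_pM => //.
  by rewrite sumr_ge0// => n _; exact: ltW.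
by rewrite sumr_ge0// => n _; rewrite divr_ge0 ?sqr_ge0// ltW.
Qed.

Lemma sum_tail_le (c : R) P N :
  (\sum_(P <= n <oo) (k n)%:E <= c%:E)%E -> \sum_(P <= n < N) k n <= c.
Proof.
move=> H; rewrite -lee_fin -sumEFin; apply: le_trans H.
by apply: nneseries_lim_ge => n _ _; rewrite lee_fin ltW.
Qed.

End TailEstimates.

Section BoundarySpectrum.
Variable R : realType.

Lemma closed_circle : closed (@circle R).
Proof.
move=> z cz; suff z1 : normc z = 1 by rewrite /circle /= -[LHS]/((normc z)%:C) z1.
apply/eqP; rewrite -subr_eq0 -normr_le0; apply/ler_addgt0Pr => r r0; rewrite add0r.
have : nbhs z (ball z r%:C) by apply: nbhsx_ballx; rewrite ltcR.
move=> /cz [w [/circle_normc w1]]; rewrite -ball_normE /= -[`|z - w|]/((normc (z - w))%:C) ltcR.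
by rewrite -w1 => /ltW; apply: le_trans; exact: ler_dist_normc.
Qed.

(** A polynomial is Lipschitz on the closed disc, so its bound on the spectrum inside the disc
    extends to limit points, with the same constant. *)
Lemma boundary_spectrum_bound (H : completeNormedModType R[i]) (T : {linear H -> H})
    (phi : nat -> R[i]) N (c : R) :
  (forall lam, spectrum T lam -> normc (ps_trunc phi N lam) <= c) ->
  forall z, boundary_spectrum T z -> normc (ps_trunc phi N z) <= c.
Proof.
move=> Hc z [cz /circle_normc z1].
have psE w : ps_trunc phi N w = (\poly_(i < N) phi i).[w].
  by rewrite horner_poly /ps_trunc big_mkord.
have [L L0 HL] := horner_lipschitz (\poly_(i < N) phi i).
apply/ler_addgt0Pr => r r0; have L1 : 0 < L + 1 by rewrite ltr_wpDl.
have r1 : 0 < r / (L + 1) by rewrite divr_gt0.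
have : nbhs z (ball z (r / (L + 1))%:C) by apply: nbhsx_ballx; rewrite ltcR.
move=> /cz [w [[sw dw]]]; rewrite -ball_normE /= => bw.
have w1 : normc w <= 1.
  by move: dw; rewrite /disc /= -[`|w|]/((normc w)%:C) ltcR => /ltW.
have {}bw : normc (z - w) <= r / (L + 1).
  by move: bw; rewrite -[`|z - w|]/((normc (z - w))%:C) ltcR => /ltW.
have -> : ps_trunc phi N z = ps_trunc phi N w + (ps_trunc phi N z - ps_trunc phi N w).
  by rewrite addrC subrK.
apply: le_trans (le_normcD _ _) _; rewrite lerD ?Hc// !psE.
apply: le_trans (HL _ _ _ w1) _; first by rewrite z1.
rewrite (le_trans (ler_wpM2l L0 bw))// mulrCA ler_piMr ?(ltW r0)//.
by rewrite ler_pdivrMr// mul1r lerDl.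
Qed.

End BoundarySpectrum.

Theorem theorem1p13 (R : realType) (alpha k : nat -> R)
  (alphaW : wiener alpha)
  (alpha_neq0 : forall t : R[i], `|t| < 1 -> power_series_value alpha t != 0)
  (alpha0 : alpha 0%N = 1)
  (kE : forall t : R[i], `|t| < 1 ->
    power_series k t @ \oo --> ((power_series_value alpha t)^-1 : R[i]^o))
  (k0 : k 0%N = 1)
  (k_gt0 : forall n, (1 <= n)%N -> 0 < k n)
  (D : completeNormedModType R[i]) (dotD : {dot D for @Num.conj R[i]})
  (dotD_norm : induces_norm dotD) (Dfin : finite_dimensional D)
  (Rk_alg : Rspace_banach_algebra k)
  (H : completeNormedModType R[i]) (dotH : {dot H for @Num.conj R[i]})
  (dotH_norm : induces_norm dotH)
  (T : {linear H -> H}) (Tcont : continuous T)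
  (Tsim : similar_to_part_of_shift D k T)
  (inf_lim : (fun n : nat =>
      inf [set k j / k (n + j)%N | j in [set: nat]] `^ n%:R^-1)
    @ \oo --> (1 : R))
  (root_lim : (fun n : nat => k n `^ n%:R^-1) @ \oo --> (1 : R))
  (tail : exists C eps : R, [/\ 0 < C, 0 < eps &
    forall N : nat, (1 <= N)%N ->
      (\sum_(N <= n <oo) (k n)%:E <= (C * N%:R `^ (- eps))%:E)%E])
  (not_cover : ~ (@disc R `<=` spectrum T)) :
  circle_measure (boundary_spectrum T) = 0%E /\
  carleson (boundary_spectrum T).
Proof.
have kp n : 0 < k n by case: n => [|n]; [rewrite k0|exact: k_gt0].
have [M M0 HM] := Rk_bound_mul kp Rk_alg.
have [d [u [uorth uspan]]] := orthonormal_basis dotD_norm Dfin.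
case: Tsim => L [W [[[LH _ _ _] _] rW [M1 W_le] [M2 W_ge] W_shift]].
have W_space x : wspace k (W x) by apply: LH; rewrite -rW; exists x.
have [C [eps [C0 eps0 Htail]]] := tail.
have kS P N : (1 <= P)%N -> \sum_(P <= n < N) k n <= C * P%:R `^ (- eps).
  by move=> P1; apply: sum_tail_le => //; exact: Htail.
have [lam [lam1 lam_res]] : exists lam, disc lam /\ ~ spectrum T lam.
  apply: contrapT => h; apply: not_cover => lam lam1; apply: contrapT => h2.
  by apply: h; exists lam.
(* The powers of [lam] have modulus at most 1, so the summability of [k] is enough; the tail
   estimate at [N = 1] gives [C], and index 0 is added separately. *)
have lam_bound : exists K, forall N,
    \sum_(0 <= n < N) normc (lam ^+ n) ^+ 2 * k n <= K.
  exists (k 0%N + C) => -[|N]; first by rewrite big_geq// k0 addr_ge0// ltW.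
  rewrite big_ltn// lerD//.
    by rewrite expr0 normc1 expr1n mul1r.
  have := kS 1%N N.+1 isT; rewrite powR1 mulr1; apply: le_trans.
  apply: ler_sum => n _; rewrite ler_piMl ?(ltW (kp n))//.
  rewrite exprn_ile1 ?normc_ge0// normcX exprn_ile1 ?normc_ge0//.
  by move: lam1; rewrite /disc /= -[`|lam|]/((normc lam)%:C) ltcR => /ltW.
have [phi [[K phiK] phin0 phi0]] := annihilating_series kp M0 HM dotD_norm uorth
  uspan W_space W_le W_ge W_shift lam_bound lam_res.
have [tau tau0 Htau] := op_trunc_bound kp M0 HM dotD_norm uorth uspan Tcont
  W_space W_le W_ge W_shift (ex_intro _ K phiK) phi0.
(* Cauchy-Schwarz takes the square root of the tail of [k], hence the exponent [eps / 2]. *)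
have phi_tail P N : (1 <= P)%N ->
    \sum_(P <= n < N) normc (phi n) <= Num.sqrt (C * K) * P%:R `^ (- (eps / 2)).
  move=> P1; apply: le_trans (Rk_sum_tail kp phiK (kS P N P1)) _.
  have -> : C * P%:R `^ (- eps) * K = C * K * (P%:R `^ (- (eps / 2))) ^+ 2.
    have -> : - eps = - (eps / 2) * 2%:R by lra.
    by rewrite powRrM powR_mulrn ?powR_ge0//; ring.
  by rewrite sqrtrM ?mulr_ge0 ?(ltW C0) ?(Rk_bound_ge0 phiK)// sqrtr_sqr ger0_norm ?powR_ge0.
apply: (@carleson_of_zero_set _ phi (normc (phi 0%N) + Num.sqrt (C * K))
  (Num.sqrt (C * K)) (eps / 2) tau) => //.
- move=> [|N]; first by rewrite big_geq// addr_ge0 ?normc_ge0 ?sqrtr_ge0.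
  by rewrite big_ltn// lerD2l; have := phi_tail 1%N N.+1 isT; rewrite powR1 mulr1.
- by rewrite divr_gt0.
- by apply: closedI; [exact: closed_closure|exact: closed_circle].
- by move=> z [].
- by move=> N; apply: boundary_spectrum_bound => l sl; exact: Htau.
Qed.
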